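(* Let $n\ge1$ be fixed. For each integer $M\ge1$, let $A_{0,M},A_{1,M},\ldots,A_{n,M}\in M_{N_M}(\mathbb C)$ be Hermitian matrices with $A_{i,M}\succeq0$ for $i=1,\ldots,n$, and assume $N_M=o(M)$ as $M\to\infty$. Suppose there is a constant $K$ such that $\max_{1\le i\le n}\|A_{i,M}\|_{\mathrm{op}}\le K$ for all $M$. Let $G_1,\ldots,G_n$ be independent $M\times M$ GUE matrices and $$H_M=A_{0,M}\otimes I_M+\frac1{\sqrt M}\sum_{i=1}^n A_{i,M}\otimes G_i .$$ Then there is a deterministic sequence $\varepsilon_M\to0$ such that, for all sufficiently large $M$, $$\mathbb E\|H_M\|_{\mathrm{op}}\le\rho_{*,M}+\varepsilon_M .$$ In particular, if $\rho_{*,M}\to\rho$ as $M\to\infty$, then $$\limsup_{M\to\infty}\mathbb E\|H_M\|_{\mathrm{op}}\le\rho .$$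
   Context: GUE normalization: $G_i$ is a random Hermitian $M\times M$ matrix with independent centered Gaussian entries on and above the diagonal; diagonal entries are real standard Gaussians $N(0,1)$, and the real and imaginary parts of the off-diagonal entries are independent $N(0,1/2)$. Here $\|\cdot\|_{\mathrm{op}}$ is the operator norm, $Z\succ0$ (resp. $Z\prec 0$) means Hermitian positive (resp. negative) definite, $\succeq 0$ means Hermitian positive semidefinite, and $\lambda_{\max},\lambda_{\min}$ denote the largest and smallest eigenvalues. For each $M$, with $Z$ ranging over $M_{N_M}(\mathbb C)$, $$\rho_{+,M}=\inf_{Z\succ0}\lambda_{\max}\Bigl(A_{0,M}+Z+\sum_{i=1}^n A_{i,M}Z^{-1}A_{i,M}\Bigr),\qquad \rho_{-,M}=\sup_{Z\prec0}\lambda_{\min}\Bigl(A_{0,M}+Z+\sum_{i=1}^n A_{i,M}Z^{-1}A_{i,M}\Bigr),$$ and $\rho_{*,M}=\max\{\rho_{+,M},-\rho_{-,M}\}$. *)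

(* Defs.v *)
From HB Require Import structures.
From mathcomp Require Import all_boot all_order all_algebra.
From mathcomp Require Import sesquilinear spectral.
From mathcomp Require Import complex mxtens.
From mathcomp Require Import all_classical all_reals all_analysis.

Set Implicit Arguments.
Unset Strict Implicit.
Unset Printing Implicit Defensive.

Import Order.TTheory GRing.Theory Num.Theory.
Import numFieldNormedType.Exports.

Local Open Scope classical_set_scope.
Local Open Scope ring_scope.
Local Open Scope complex_scope.
Local Open Scope sesquilinear_scope.

Notation "A *t B" := (tensmx A B)
  (at level 40, left associativity, format "A  *t  B") : ring_scope.

Section Matrices.
Variable R : realType.
Local Notation C := R[i].

Definition l2norm m (v : 'cV[C]_m) : R :=
  Num.sqrt (\sum_i Normc.normc (v i 0) ^+ 2).

(* Operator norm induced by the Euclidean norm. *)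
Definition opnorm m (A : 'M[C]_m) : R :=
  sup [set l2norm (A *m v) | v in [set v : 'cV[C]_m | l2norm v <= 1]].

Definition quadform m (A : 'M[C]_m) (v : 'cV[C]_m) : C :=
  (v ^t* *m A *m v) 0 0.

(* The order of R[i] is partial: 0 < z (resp. z < 0, 0 <= z) includes the fact
   that z is real. *)
Definition posdef m (Z : 'M[C]_m) : Prop :=
  Z \is hermsymmx /\ forall v : 'cV[C]_m, v != 0 -> 0 < quadform Z v.

Definition negdef m (Z : 'M[C]_m) : Prop :=
  Z \is hermsymmx /\ forall v : 'cV[C]_m, v != 0 -> quadform Z v < 0.

Definition possemidef m (Z : 'M[C]_m) : Prop :=
  Z \is hermsymmx /\ forall v : 'cV[C]_m, 0 <= quadform Z v.

(* Meant for Hermitian matrices of positive size: the set of real eigenvalues is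
   then the whole (finite, nonempty) spectrum, so sup and inf are a maximum and
   a minimum. *)
Definition lambda_max m (A : 'M[C]_m) : R :=
  sup [set x : R | eigenvalue A x%:C].

Definition lambda_min m (A : 'M[C]_m) : R :=
  inf [set x : R | eigenvalue A x%:C].

Section Rho.
Variables (n N : nat) (A0 : 'M[C]_N) (A : 'I_n -> 'M[C]_N).

Definition rho_arg (Z : 'M[C]_N) : 'M[C]_N :=
  A0 + Z + \sum_(i < n) A i *m invmx Z *m A i.

(* When N > 0 and A0, A i are Hermitian, this set is nonempty and
   bounded below by lambda_max A0, so the real infimum is the genuine one;
   symmetrically for rho_minus. *)
Definition rho_plus : R :=
  inf [set lambda_max (rho_arg Z) | Z in [set Z | posdef Z]].

Definition rho_minus : R :=
  sup [set lambda_min (rho_arg Z) | Z in [set Z | negdef Z]].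

Definition rho_star : R := Num.max rho_plus (- rho_minus).

End Rho.

Definition gauss_model (n N M : nat) (A0 : 'M[C]_N) (A : 'I_n -> 'M[C]_N)
    (G : 'I_n -> 'M[C]_M) : 'M[C]_(N * M) :=
  A0 *t 1%:M + ((Num.sqrt M%:R)^-1)%:C *: \sum_(i < n) A i *t G i.

End Matrices.

Section Randomness.
Context {d : measure_display} {T : measurableType d} {R : realType}.
Variable P : probability T R.
Local Notation C := R[i].

Definition mutually_independent (I : finType) (F : I -> set_system T) : Prop :=
  forall (J : {set I}) (E : I -> set T),
    (forall i, i \in J -> F i (E i)) ->
    P (\bigcap_(i in [set` J]) E i) = (\prod_(i in J) P (E i))%E.

Definition real_family_independent (I : finType) (X : I -> T -> R) : Prop :=
  mutually_independent (fun i => g_sigma_algebra_preimage (X i)).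

(* The parameter s is the standard deviation. *)
Definition centered_gaussian (X : T -> R) (s : R) : Prop :=
  measurable_fun [set: T] X /\
  forall B : set R, measurable B -> P (X @^-1` B) = normal_prob 0 s B.

(* The M ^ 2 real coordinates of a Hermitian matrix: the real parts of the
   entries on and above the diagonal, and, at a position (i, j) below it, the
   imaginary part of the entry (j, i). *)
Definition herm_coord M (G : T -> 'M[C]_M) (ij : 'I_M * 'I_M) (w : T) : R :=
  if (ij.1 <= ij.2)%N then complex.Re (G w ij.1 ij.2)
  else complex.Im (G w ij.2 ij.1).

Definition is_GUE M (G : T -> 'M[C]_M) : Prop :=
  [/\ forall w, G w \is hermsymmx,
      forall ij, centered_gaussian (herm_coord G ij)
        (if ij.1 == ij.2 then 1 else Num.sqrt (1 / 2)) &
      real_family_independent (herm_coord G)].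

(* The sigma-algebra generated by a random matrix. *)
Definition mx_sigma_algebra M (G : T -> 'M[C]_M) : set_system T :=
  <<s \bigcup_(ij in [set: 'I_M * 'I_M])
        (g_sigma_algebra_preimage (fun w => complex.Re (G w ij.1 ij.2)) `|`
         g_sigma_algebra_preimage (fun w => complex.Im (G w ij.1 ij.2))) >>.

Definition independent_GUE n M (G : 'I_n -> T -> 'M[C]_M) : Prop :=
  (forall k, is_GUE (G k)) /\
  mutually_independent (fun k => mx_sigma_algebra (G k)).

End Randomness.

(* Main.v *)
(** A Gaussian comparison argument. Read a unit vector of C^N (x) C^M as an N x M matrix U and
    choose S with S S^h = U U^h. The quadratic form of H_M at U is
    tr (U^h A_0 U) + M^(-1/2) sum_i tr (U^h A_i U G_i). Because the A_i are positive, the increments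
    of this process in U are dominated by those of 2 sum_i Re tr (Gamma_i^h S^h A_i U), where the
    Gamma_i are independent N x M complex Gaussian matrices with entries of variance 1 / M. By
    Sudakov-Fernique, E lambda_max H_M is at most the expected supremum of
    tr (U^h A_0 U) + 2 sum_i Re tr (Gamma_i^h S^h A_i U). If s >= 1 bounds the norm of the block
    column (Gamma_1, ..., Gamma_n), then AM-GM along a factorization Z = Q^h Q bounds this supremum
    by lambda_max (A_0 + Z + sum_i A_i Z^-1 A_i) + (s - 1) (1 + n K^2), for every Z > 0. The other end of the
    spectrum is handled in the same comparison by an independent copy of the Gamma_i, since
    - rho_-(A_0) = rho_+(- A_0).
    A second comparison, of Re <u, Gamma v> with a combination of independent Gaussian vectors
    paired with u and v, shows that E (s - 1)_+ tends to 0 when N / M does. *)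
Require Import Defs.
From HB Require Import structures.
From mathcomp Require Import all_boot all_order all_algebra.
From mathcomp Require Import sesquilinear spectral.
From mathcomp Require Import complex mxtens.
From mathcomp Require Import all_classical all_reals all_analysis.
From mathcomp Require Import measurable_realfun.
From mathcomp Require Import ring lra.

Set Implicit Arguments.
Unset Strict Implicit.
Unset Printing Implicit Defensive.

Import Order.TTheory GRing.Theory Num.Theory.
Import numFieldNormedType.Exports.

Local Open Scope classical_set_scope.
Local Open Scope ring_scope.

(** Positivity enters through A = L^h L. With a = L U and x = L S one has x x^h = a a^h, so S^h A U
    and U^h A U have the same Hilbert-Schmidt norm, and the comparison of increments becomes an
    inequality between Gram matrices that follows from AM-GM used twice. Sudakov-Fernique constrains
    increments only, so S may be any square root chosen separately for each U; since suprema are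
    taken along countable families and reached from finite maxima, the choice of S carries no
    regularity in U. The error has to be uniform in Z, because the infimum defining rho_+ may not be
    attained and nothing controls near-minimisers as M grows. The norm of the Gaussian block column
    is handled in expectation, without concentration: after the second comparison its excess over 1
    is bounded pointwise by an explicit polynomial in independent Gaussians, which is integrated
    term by term. *)

Section RealDeriv.
Context {R : realType}.
Implicit Types (f g : R -> R) (x df dg : R).

Lemma is_deriveDr f g x df dg : is_derive x (1 : R) f df -> is_derive x (1 : R) g dg ->
  is_derive x (1 : R) (fun y => f y + g y) (df + dg).
Proof. exact: is_deriveD. Qed.

Lemma is_deriveMr f g x df dg : is_derive x (1 : R) f df -> is_derive x (1 : R) g dg ->
  is_derive x (1 : R) (fun y => f y * g y) (f x * dg + g x * df).
Proof. exact: is_deriveM. Qed.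

Lemma is_deriveMcr f x df (c : R) : is_derive x (1 : R) f df ->
  is_derive x (1 : R) (fun y => c * f y) (c * df).
Proof. exact: is_deriveZ. Qed.

Lemma is_derive_affine (a b x : R) : is_derive x (1 : R) (fun y => a + b * y) b.
Proof.
have h := is_deriveDr (is_derive_cst a x (1:R)) (is_deriveMcr b (is_derive_id x (1:R))).
by rewrite add0r mulr1 in h.
Qed.
End RealDeriv.

(** * One-dimensional Gaussian integrals *)
Section OneDimGauss.
Context {R : realType}.
Local Notation leb := (@lebesgue_measure R).
Local Notation gam := (@normal_prob R 0 1).
Implicit Types (m s x y a b : R).

(** Change of variables through the Radon-Nikodym derivative, which agrees almost everywhere with
    the density since both integrate to the same measure. *)
Lemma ge0_integral_normal_prob m s (f : R -> \bar R) :
  (forall x, 0 <= f x)%E -> measurable_fun [set: R] f ->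
  (\int[normal_prob m s]_x f x = \int[leb]_x (f x * (normal_pdf m s x)%:E))%E.
Proof.
move=> f0 mf.
have dom := @normal_prob_dominates R m s.
rewrite -(Radon_Nikodym_SigmaFinite.change_of_variables dom)//.
apply: ae_eq_integral => //.
- apply: emeasurable_funM => //.
  exact: measurable_int (Radon_Nikodym_SigmaFinite.f_integrable _).
- apply: emeasurable_funM => //.
  by apply/measurable_EFinP; exact: measurable_normal_pdf.
- apply: ae_eqe_mul2l; apply: integral_ae_eq => //.
  + exact: Radon_Nikodym_SigmaFinite.f_integrable.
  + by apply/measurable_EFinP; exact: measurable_normal_pdf.
  + by move=> E _ mE; rewrite -Radon_Nikodym_SigmaFinite.f_integral.
Qed.

Lemma ge0_integral_affine a b (G : R -> R) : 0 < b ->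
  continuous G -> (forall x, 0 <= G x) ->
  (\int[leb]_x (G x)%:E = \int[leb]_x (G (a + b * x) * b)%:E)%E.
Proof.
move=> b0 cG G0.
pose F : R -> R := fun x => a + b * x.
have dF x : is_derive x (1 : R) F b by exact: is_derive_affine.
have F'E : F^`()%classic = cst b.
  by apply/funext => x; rewrite derive1E; apply: derive_val.
rewrite (@increasing_ge0_integration_by_substitutionT _ F G)//.
- by apply: eq_integral => x _; rewrite F'E.
- by move=> x y xy; rewrite /F ltrD2l ltr_pM2l.
- by rewrite F'E => x; exact: cvg_cst.
- by rewrite F'E; exact: is_cvg_cst.
- by rewrite F'E; exact: is_cvg_cst.
- move=> A [r [_ rA]]; exists ((r - a) / b); split; first exact: num_real.
  by move=> x; rewrite ltr_pdivlMr// ltrBrDl mulrC => /rA.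
- move=> A [r [_ rA]]; exists ((r - a) / b); split; first exact: num_real.
  by move=> x; rewrite ltr_pdivrMr// ltrBlDl mulrC => /rA.
Qed.

Lemma ge0_continuous_normal_prob m s (f : R -> R) :
  (forall x, 0 <= f x) -> continuous f ->
  (\int[normal_prob m s]_x (f x)%:E = \int[leb]_x (f x * normal_pdf m s x)%:E)%E.
Proof.
move=> f0 cf; rewrite ge0_integral_normal_prob.
- by apply: eq_integral => x _; rewrite EFinM.
- by move=> x; rewrite lee_fin.
- by apply/measurable_EFinP; exact: continuous_measurable_fun.
Qed.

Lemma normal_peakE s : 0 < s -> normal_peak s = s^-1 * normal_peak 1.
Proof.
move=> s0; rewrite /normal_peak -!mulrnAr (sqrtrM _ (sqr_ge0 s)) (sqrtrM _ (sqr_ge0 1)) !sqrtr_sqr.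
by rewrite gtr0_norm// normr1 mul1r invfM.
Qed.

Lemma normal_pdf_scale s x : 0 < s ->
  normal_pdf 0 s (s * x) * s = normal_pdf 0 1 x.
Proof.
move=> s0; rewrite !normal_pdfE ?gt_eqF// normal_peakE// /normal_fun.
rewrite !subr0 expr1n.
have -> : - (s * x) ^+ 2 / (s ^+ 2 *+ 2) = - x ^+ 2 / (1 *+ 2) by field; rewrite gt_eqF.
by field; rewrite gt_eqF.
Qed.

Lemma cont_gauss_pdf m s : 0 < s -> continuous (normal_pdf m s).
Proof. by move=> s0; apply: continuous_normal_pdf; rewrite gt_eqF. Qed.

Lemma continuous_affine a b : continuous (fun x : R => a + b * x).
Proof.
move=> x; apply: (@cvgD _ R^o); first exact: cvg_cst.
by apply: (@cvgMl_tmp _ R^o); exact: cvg_id.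
Qed.

Lemma normal_prob_scale s (f : R -> R) : 0 < s ->
  continuous f -> (forall x, 0 <= f x) ->
  (\int[normal_prob 0 s]_x (f x)%:E = \int[gam]_x (f (s * x))%:E)%E.
Proof.
move=> s0 cf f0.
have cfs : continuous (fun x => f (s * x)).
  move=> x; apply: (@continuous_comp _ _ _ (fun x => s * x) f); last exact: cf.
  exact: mulrl_continuous.
rewrite (ge0_continuous_normal_prob _ _ f0 cf).
rewrite (ge0_continuous_normal_prob _ _ (fun x => f0 (s * x)) cfs).
rewrite (@ge0_integral_affine 0 s); [|exact: s0|..].
- apply: eq_integral => x _.
  by rewrite add0r -mulrA normal_pdf_scale.
- by move=> x; apply: (@cvgM R^o); [exact: cf|exact: cont_gauss_pdf].
- by move=> x; rewrite mulr_ge0// normal_pdf_ge0.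
Qed.

(** Completing the square. For z = a x + b y, the joint density of (x, y) is rewritten as the
    density of z times that of x given z, which is N(a z, b^2); the factor b is the Jacobian. *)
Lemma gauss_pdf_product a b x z : 0 < b -> a ^+ 2 + b ^+ 2 = 1 ->
  normal_pdf 0 1 (z / b - a / b * x) * normal_pdf 0 1 x =
  b * normal_pdf 0 1 z * normal_pdf (a * z) b x.
Proof.
move=> b0 ab; rewrite !normal_pdfE ?gt_eqF// (normal_peakE b0) /normal_fun.
set p := normal_peak 1.
rewrite !subr0 expr1n.
transitivity (p * p * (expR (- (z / b - a / b * x) ^+ 2 / (1 *+ 2)) * expR (- x ^+ 2 / (1 *+ 2)))).
  by ring.
transitivity (p * p * (expR (- z ^+ 2 / (1 *+ 2)) * expR (- (x - a * z) ^+ 2 / (b ^+ 2 *+ 2)))); last first.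
  by field; rewrite gt_eqF.
rewrite -!expRD; congr (_ * expR _).
have b0' : b != 0 by rewrite gt_eqF.
transitivity (- z ^+ 2 / (1 *+ 2) + - (x - a * z) ^+ 2 / (b ^+ 2 *+ 2) -
    (1 - (a ^+ 2 + b ^+ 2)) * ((z ^+ 2 - x ^+ 2) / (b ^+ 2 *+ 2))); first by field.
by rewrite ab subrr mul0r subr0.
Qed.

(** Substitute z = a x + b y in the inner integral and exchange by Tonelli: what remains of x is its
    conditional density given z, of mass 1. *)
Lemma gauss_stable a b (f : R -> R) : 0 < b -> a ^+ 2 + b ^+ 2 = 1 ->
  continuous f -> (forall x, 0 <= f x) ->
  (\int[gam]_x \int[gam]_y (f (a * x + b * y))%:E = \int[gam]_x (f x)%:E)%E.
Proof.
move=> b0 ab cf f0.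
pose k x z := f z * (normal_pdf 0 1 z * normal_pdf (a * z) b x).
have inner x : (\int[gam]_y (f (a * x + b * y))%:E * (normal_pdf 0 1 x)%:E = 
    \int[leb]_z (k x z)%:E)%E.
  have cg : continuous (fun y => f (a * x + b * y)).
    move=> y; apply: (@continuous_comp _ _ _ (fun y => a * x + b * y) f); last exact: cf.
    exact: continuous_affine.
  rewrite (ge0_continuous_normal_prob _ _ _ cg); last by [].
  rewrite (@ge0_integral_affine (- (a / b) * x) b^-1); [|by rewrite invr_gt0|..].
  - rewrite -ge0_integralZr//; last 3 first.
    + apply/measurable_EFinP; apply: continuous_measurable_fun => y.
      apply: (@cvgM R^o); last exact: cvg_cst.
      apply: (@continuous_comp _ _ _ (fun y => - (a / b) * x + b^-1 * y) (fun y => f (a * x + b * y) * normal_pdf 0 1 y)).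
        exact: continuous_affine.
      by apply: (@cvgM R^o); [exact: cg|exact: cont_gauss_pdf].
    + by move=> y _; rewrite lee_fin !mulr_ge0// ?normal_pdf_ge0// invr_ge0 ltW.
    + by rewrite lee_fin normal_pdf_ge0.
    apply: eq_integral => z _; rewrite -EFinM /k; congr EFin.
    have -> : a * x + b * (- (a / b) * x + b^-1 * z) = z by field; rewrite gt_eqF.
    have -> : - (a / b) * x + b^-1 * z = z / b - a / b * x by ring.
    transitivity (f z / b * (normal_pdf 0 1 (z / b - a / b * x) * normal_pdf 0 1 x)).
      by ring.
    by rewrite gauss_pdf_product//; field; rewrite gt_eqF.
  - by move=> y; apply: (@cvgM R^o); [exact: cg|exact: cont_gauss_pdf].
  - by move=> y; rewrite mulr_ge0// normal_pdf_ge0.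
have mk : measurable_fun [set: R * R] (fun p => (k p.1 p.2)%:E).
  apply/measurable_EFinP; apply: measurable_funM.
    by apply: measurableT_comp => //; exact: continuous_measurable_fun.
  apply: measurable_funM.
    by apply: measurableT_comp => //; exact: measurable_normal_pdf.
  rewrite (_ : (fun _ => _) = normal_pdf 0 b \o (fun p : R * R => p.1 - a * p.2)).
    apply: measurableT_comp; first exact: measurable_normal_pdf.
    by apply: measurable_funB => //; exact: measurable_funM.
  by apply/funext => p; rewrite /= !normal_pdfE ?gt_eqF// /normal_fun subr0.
rewrite ge0_integral_normal_prob; last 2 first.
- by move=> x; apply: integral_ge0 => y _; rewrite lee_fin.
- apply: (@measurable_fun_fubini_tonelli_F _ _ _ _ _ gam (fun p => (f (a * p.1 + b * p.2))%:E)).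
  + apply/measurable_EFinP; apply: measurableT_comp; first exact: continuous_measurable_fun.
    by apply: measurable_funD => //; exact: measurable_funM.
  + by move=> p; rewrite lee_fin.
under eq_integral do rewrite inner.
rewrite (@fubini_tonelli _ _ _ _ _ leb leb _ mk); last first.
  by move=> x; rewrite lee_fin mulr_ge0// mulr_ge0// normal_pdf_ge0.
rewrite (ge0_continuous_normal_prob _ _ f0 cf).
apply: eq_integral => z _.
rewrite /k /=.
under eq_integral do rewrite mulrA EFinM.
rewrite ge0_integralZl//; last 3 first.
- by apply/measurable_EFinP; exact: measurable_normal_pdf.
- by move=> ? _; rewrite lee_fin normal_pdf_ge0.
- by rewrite lee_fin mulr_ge0// normal_pdf_ge0.
by rewrite integral_normal_pdf mule1.
Qed.

Lemma continuous_sqr_fun (c : R) n : continuous (fun x : R => c * x ^+ n).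
Proof.
move=> x; apply: (@cvgM R^o); first exact: cvg_cst.
exact: exprn_continuous.
Qed.

(** Against the standard density the exponential gives s times the density of N(0, s^2). At s = 2 it
    is an integrable majorant of polynomials; as s decreases to 1 it yields the second moment. *)
Lemma integral_gauss_exp_sqr s : 0 < s ->
  (\int[gam]_x (expR ((1 - s ^- 2) / 2 * x ^+ 2))%:E = s%:E)%E.
Proof.
move=> s0.
have ce : continuous (fun x => expR ((1 - s ^- 2) / 2 * x ^+ 2)).
  move=> x; apply: (@continuous_comp _ _ _ (fun x => (1 - s ^- 2) / 2 * x ^+ 2) expR).
    exact: continuous_sqr_fun.
  exact: continuous_expR.
rewrite ge0_continuous_normal_prob; last 2 first.
- by move=> x; exact: expR_ge0.
- exact: ce.
transitivity (\int[leb]_x (s%:E * (normal_pdf 0 s x)%:E))%E.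
  apply: eq_integral => x _; rewrite -EFinM !normal_pdfE ?gt_eqF// (normal_peakE s0).
  rewrite /normal_fun !subr0 mulrCA -expRD -!mulrA mulVKf ?gt_eqF//.
  by congr (_ * expR _)%:E; field; rewrite gt_eqF.
rewrite ge0_integralZl//.
- by rewrite integral_normal_pdf mule1.
- by apply/measurable_EFinP; exact: measurable_normal_pdf.
- by move=> ? _; rewrite lee_fin normal_pdf_ge0.
- by rewrite lee_fin ltW.
Qed.

Lemma gauss_integrable (f : R -> R) C : measurable_fun [set: R] f ->
  (forall x, `|f x| <= C * (1 + x ^+ 4)) -> gam.-integrable setT (EFin \o f).
Proof.
move=> mf fC.
have C0 : 0 <= C.
  by have := le_trans (normr_ge0 _) (fC 0); rewrite expr0n addr0 mulr1.
pose g x : R := expR ((1 - 2 ^- 2) / 2 * x ^+ 2).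
have mg : measurable_fun [set: R] g.
  apply: measurableT_comp => //; apply: measurable_funM => //.
(* Since e^t >= 1 + t^2 / 2 at t = 3/8 x^2, the factor 15 suffices: 15 * 9 / 128 >= 1. *)
have ig : gam.-integrable setT (EFin \o (fun x => C * 15 * g x)).
  apply/integrableP; split.
    by apply/measurable_EFinP; exact: measurable_funM.
  under eq_integral do rewrite /= ger0_norm ?mulr_ge0// ?expR_ge0//.
  under eq_integral do rewrite EFinM.
  rewrite ge0_integralZl//.
  - by rewrite integral_gauss_exp_sqr// -EFinM ltry.
  - exact/measurable_EFinP.
  - by move=> x _; rewrite lee_fin expR_ge0.
  - by rewrite lee_fin mulr_ge0.
apply: (le_integrable _ _ _ ig) => //.
  exact/measurable_EFinP.
move=> x _ /=; rewrite lee_fin (le_trans (fC x))// ger0_norm; last first.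
  by rewrite !mulr_ge0// expR_ge0.
rewrite -mulrA ler_wpM2l// /g.
have t0 : 0 <= (1 - 2 ^- 2) / 2 * x ^+ 2 by rewrite mulr_ge0 ?sqr_ge0//; lra.
apply: (@le_trans _ _ (15 * (1 + ((1 - 2 ^- 2) / 2 * x ^+ 2) ^+ 2 / 2`!%:R))); last first.
  by rewrite ler_wpM2l//; exact: expR_ge1Dxn.
have := sqr_ge0 (x ^+ 2).
rewrite (_ : 2`!%:R = 2 :> R)//.
have -> : x ^+ 4 = (x ^+ 2) ^+ 2 by rewrite -exprM.
by move: (x ^+ 2) => y y0; have -> : 15 * (1 + ((1 - 2 ^- 2) / 2 * y) ^+ 2 / 2) = 
  15 + (15 * 9 / 128) * y ^+ 2 :> R; [field | lra].
Qed.

Lemma gauss_integrableX n : (n <= 4)%N -> gam.-integrable setT (fun x => (x ^+ n)%:E).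
Proof.
move=> n4; apply: (@gauss_integrable (fun x => x ^+ n) 1) => [|x].
  exact: measurable_funX.
rewrite mul1r normrX; have [x1|x1] := leP `|x| 1.
  by rewrite (le_trans (exprn_ile1 _ (normr_ge0 x) x1))// lerDl exprn_even_ge0.
rewrite -[x ^+ 4]ger0_norm ?exprn_even_ge0// normrX.
by rewrite (le_trans (ler_weXn2l (ltW x1) n4))// lerDr.
Qed.

Lemma gauss_integrable_normX n : (n <= 4)%N -> gam.-integrable setT (fun x => (`|x| ^+ n)%:E).
Proof.
move=> n4; have := integrable_abse (gauss_integrableX n4).
by apply: eq_integrable => // x _ /=; rewrite normrX.
Qed.

(* This is 1, but only [0 <= gvar <= 1] is needed. *)
Definition gvar : R := \int[gam]_x (x ^+ 2).

Lemma gvar_ge0 : 0 <= gvar.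
Proof. by apply: Rintegral_ge0 => x _; exact: sqr_ge0. Qed.

Lemma gauss_RintegralE (f : R -> R) : gam.-integrable setT (EFin \o f) ->
  (\int[gam]_x (f x)%:E = (\int[gam]_x f x)%:E)%E.
Proof. by move=> fi; rewrite fineK//; exact: integrable_fin_num. Qed.

Lemma gauss_integrable_cst c : gam.-integrable setT (EFin \o cst c).
Proof. by apply: finite_measure_integrable_cst. Qed.

Lemma gauss_Rintegral_cst c : \int[gam]_x c = c.
Proof. by rewrite /Rintegral integral_cst// [X in (_ * X)%E]probability_setT mule1. Qed.

Lemma gauss_integrableZl (f : R -> R) c : gam.-integrable setT (EFin \o f) ->
  gam.-integrable setT (EFin \o (fun x => c * f x)).
Proof.
by move=> fi; have := integrableZl measurableT c fi; apply: eq_integrable.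
Qed.

Lemma gauss_integrableD (f g : R -> R) : gam.-integrable setT (EFin \o f) ->
  gam.-integrable setT (EFin \o g) -> gam.-integrable setT (EFin \o (fun x => f x + g x)).
Proof.
by move=> fi gi; have := integrableD measurableT fi gi; apply: eq_integrable.
Qed.

(** Integrating 1 + t <= e^t at t = (1 - s^-2) x^2 / 2 gives gvar <= 2 s^2 / (s + 1), and the right
    side tends to 1 as s decreases to 1. *)
Lemma gvar_le1 : gvar <= 1.
Proof.
apply/ler_addgt0Pr => e e0.
have e2 : 0 < e / 2 by rewrite divr_gt0.
pose s := 1 + e / 2.
have s1 : 0 < s by rewrite addr_gt0.
have k0 : 0 <= 1 - s ^- 2.
  rewrite subr_ge0 invf_le1 ?exprn_gt0// exprn_ege1// /s lerDl ltW//.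
have i2 := gauss_integrableX (isT : (2 <= 4)%N).
have : (\int[gam]_x (1 + (1 - s ^- 2) / 2 * x ^+ 2)%:E <= s%:E)%E.
  rewrite -integral_gauss_exp_sqr//; apply: ge0_le_integral => //.
  - by move=> x _; rewrite lee_fin addr_ge0// mulr_ge0 ?sqr_ge0// divr_ge0.
  - by apply/measurable_EFinP; apply: measurable_funD => //; exact: measurable_funM.
  - by apply/measurable_EFinP; apply: measurableT_comp => //; exact: measurable_funM.
  - by move=> x _; rewrite lee_fin expR_ge1Dx.
have iZ := gauss_integrableZl ((1 - s ^- 2) / 2) i2.
have i1 := gauss_integrable_cst 1.
rewrite (gauss_RintegralE (gauss_integrableD i1 iZ)) lee_fin RintegralD//.
rewrite RintegralZl// -/gvar gauss_Rintegral_cst => h.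
have {h} : (1 - s ^- 2) / 2 * gvar <= s - 1 by rewrite lerBrDl.
have -> : (1 - s ^- 2) / 2 = (s - 1) * ((s + 1) / (2 * s ^+ 2)) by field; rewrite gt_eqF.
have s10 : 0 < s - 1 by rewrite /s addrC addKr.
rewrite -mulrA -[leRHS]mulr1 ler_pM2l// => h.
have : (s + 1) * gvar <= 2 * s ^+ 2.
  by move: h; rewrite mulrAC ler_pdivrMr ?mul1r// mulr_gt0// exprn_gt0.
have := gvar_ge0; rewrite /s; move: gvar => v v0.
by nra.
Qed.

(** Lipschitz functions are integrable for the Gaussian law and integrating out one variable keeps
    the constant, so iterated integrals stay in the class. *)
Definition lip1 (f : R -> R) := exists2 L : R, 0 <= L & forall x y, `|f x - f y| <= L * `|x - y|.

Lemma lip1_continuous f : lip1 f -> continuous f.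
Proof.
move=> [L L0 fL] x; apply/(@cvgrPdist_lt _ R^o) => e e0; near=> y.
rewrite (le_lt_trans (fL _ _))//.
apply: (@le_lt_trans _ _ ((L + 1) * `|x - y|)).
  by rewrite ler_wpM2r// lerDl.
rewrite mulrC -ltr_pdivlMr ?ltr_wpDl//.
near: y; apply: (@cvgr_dist_lt _ R^o); first exact: cvg_id.
by rewrite divr_gt0// ltr_wpDl.
Unshelve. all: by end_near. Qed.

Lemma lip1_measurable f : lip1 f -> measurable_fun [set: R] f.
Proof. by move=> /lip1_continuous; exact: continuous_measurable_fun. Qed.

Lemma lip1_integrable f : lip1 f -> gam.-integrable setT (EFin \o f).
Proof.
move=> lf; have [L L0 fL] := lf.
apply: (@gauss_integrable _ (`|f 0| + L)); first exact: lip1_measurable.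
move=> x; apply: (@le_trans _ _ (`|f 0| + L * `|x|)).
  rewrite -[X in `|X|](subrK (f 0)) addrC (le_trans (ler_normD _ _))// lerD2l.
  by rewrite (le_trans (fL _ _))// subr0.
have : `|x| <= 1 + x ^+ 4.
  have := @real_normK _ x (num_real x).
  rewrite (exprM x 2 2) => <-; have := normr_ge0 x; move: (`|x| : R) => y y0.
  have := sqr_ge0 (y ^+ 2 - 1 / 2); have := sqr_ge0 (y - 1 / 2); nra.
have := normr_ge0 (f 0); have := normr_ge0 x.
have x4 : 0 <= x ^+ 4 by rewrite exprn_even_ge0.
move: (x ^+ 4) `|x| `|f 0| x4 => u w t; nra.
Qed.

Lemma lip1_affine (f : R -> R) a b : lip1 f -> lip1 (fun y => f (a + b * y)).
Proof.
move=> [L L0 fL]; exists (L * `|b|) => [|x y]; first by rewrite mulr_ge0.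
by rewrite (le_trans (fL _ _))// opprD addrACA subrr add0r -mulrBr normrM mulrA.
Qed.

Lemma lip1_integral (f : R -> R -> R) (L : R) : 0 <= L ->
  (forall x y z, `|f x z - f y z| <= L * `|x - y|) ->
  (forall x, lip1 (f x)) -> lip1 (fun x => \int[gam]_z f x z).
Proof.
move=> L0 fL lf; exists L => // x y.
have ifx z := lip1_integrable (lf z).
rewrite -RintegralB//.
have iB : gam.-integrable setT (EFin \o (fun z => f x z - f y z)).
  by have := integrableB measurableT (ifx x) (ifx y); apply: eq_integrable.
rewrite (le_trans (le_normr_Rintegral measurableT iB))//.
rewrite -[leRHS]gauss_Rintegral_cst; apply: le_Rintegral => //.
- by have := integrable_abse iB; apply: eq_integrable.
- exact: gauss_integrable_cst.
Qed.

(** Positive and negative parts of a Lipschitz function are Lipschitz, and [gauss_stable] applies to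
    each. *)
Lemma gauss_stable_lip1 a b (f : R -> R) : 0 < b -> a ^+ 2 + b ^+ 2 = 1 ->
  lip1 f ->
  \int[gam]_x (\int[gam]_y f (a * x + b * y)) = \int[gam]_x f x.
Proof.
move=> b0 ab lf.
pose fp x := Num.max (f x) 0. pose fn x := Num.max (- f x) 0.
have lfp : lip1 fp.
  have [L L0 fL] := lf; exists L => // x y; have := fL x y; rewrite /fp.
  by case: (leP (f x) 0); case: (leP (f y) 0); rewrite !ler_norml; move: (L * _) => q; lra.
have lfn : lip1 fn.
  have [L L0 fL] := lf; exists L => // x y; have := fL x y; rewrite /fn.
  by case: (leP (- f x) 0); case: (leP (- f y) 0); rewrite !ler_norml; move: (L * _) => q; lra.
have fE x : f x = fp x - fn x.
  by rewrite /fp /fn; case: (leP (f x) 0); case: (leP (- f x) 0); lra.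
have inl (g : R -> R) : lip1 g -> lip1 (fun x => \int[gam]_y g (a * x + b * y)).
  move=> lg; have [L L0 gL] := lg.
  apply: (@lip1_integral _ (L * `|a|)); first by rewrite mulr_ge0.
    move=> x y z; rewrite (le_trans (gL _ _))// -mulrA -normrM mulrBr.
    by rewrite opprD addrACA subrr addr0.
  by move=> x; exact: lip1_affine.
have key (g : R -> R) : lip1 g -> (forall x, 0 <= g x) ->
    \int[gam]_x (\int[gam]_y g (a * x + b * y)) = \int[gam]_x g x.
  move=> lg g0; congr fine.
  rewrite -(gauss_stable b0 ab (lip1_continuous lg) g0).
  apply: eq_integral => x _; rewrite -gauss_RintegralE//.
  by apply: lip1_integrable; exact: lip1_affine.
transitivity (\int[gam]_x ((\int[gam]_y fp (a * x + b * y)) - (\int[gam]_y fn (a * x + b * y)))).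
  apply: eq_Rintegral => x _; rewrite -RintegralB//.
  - by apply: eq_Rintegral => y _; rewrite fE.
  - by apply: lip1_integrable; exact: lip1_affine.
  - by apply: lip1_integrable; exact: lip1_affine.
rewrite RintegralB//; try by apply: lip1_integrable; exact: inl.
rewrite !key//.
- rewrite -RintegralB//; try exact: lip1_integrable.
  by apply: eq_Rintegral => y _; rewrite fE.
- by move=> x; rewrite /fn le_max lexx orbT.
- by move=> x; rewrite /fp le_max lexx orbT.
Qed.

Lemma lip1_id : lip1 id.
Proof. by exists 1 => // x y; rewrite mul1r. Qed.

(** Stability at (3/5, 4/5) applied to the identity gives m = 7/5 m for the mean m. *)
Lemma gauss_mean0 : \int[gam]_x x = 0.
Proof.
have h : (3 / 5 : R) ^+ 2 + (4 / 5) ^+ 2 = 1 by field.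
have := gauss_stable_lip1 (divr_gt0 (ltr0n _ 4) (ltr0n _ 5)) h lip1_id.
have ix := lip1_integrable lip1_id.
have iZ c := gauss_integrableZl c ix.
set m := \int[gam]_x x => /=.
have inner x : \int[gam]_y (3 / 5 * x + 4 / 5 * y) = 3 / 5 * x + 4 / 5 * m.
  rewrite RintegralD; [|by []|exact: gauss_integrable_cst|exact: iZ].
  by rewrite gauss_Rintegral_cst RintegralZl.
under eq_Rintegral do rewrite inner.
rewrite RintegralD; [|by []|exact: iZ|exact: gauss_integrable_cst].
rewrite gauss_Rintegral_cst RintegralZl// -/m; lra.
Qed.

(** Rounding the first argument down to the grid of step 1 / (n + 1) gives functions made of
    countably many measurable pieces, and these converge pointwise to f. *)
Lemma lip2_measurable (f : R -> R -> R) : (forall y, lip1 (f ^~ y)) ->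
  (forall x, lip1 (f x)) -> measurable_fun [set: R * R] (fun p => f p.1 p.2).
Proof.
move=> l1 l2.
pose h (n : nat) (p : R * R) := f ((Num.floor (p.1 * n.+1%:R))%:~R / n.+1%:R) p.2.
apply: (@measurable_fun_cvg _ _ _ _ h) => [n _ Y mY|[x y] _ /=].
  have -> : [set: R * R] `&` h n @^-1` Y = \bigcup_(k : int)
      ([set x | Num.floor (x * n.+1%:R) = k] `*` (f (k%:~R / n.+1%:R) @^-1` Y)).
    apply/seteqP; split => [[x y] /= [_ Yh]|[x y] /= [k _ [/= <-]]]//.
    by exists (Num.floor (x * n.+1%:R)).
  apply: countable_bigcupT_measurable => // k; apply: measurableX.
    have -> : [set x : R | Num.floor (x * n.+1%:R) = k] = `[k%:~R / n.+1%:R, (k + 1)%:~R / n.+1%:R[%classic.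
      apply/seteqP; split => x /=; rewrite in_itv /= ler_pdivrMr ?ltr_pdivlMr ?ltr0n// -floor_eq.
        by move/eqP.
      by move/eqP.
    exact: measurable_itv.
  by rewrite -[X in measurable X]setTI; exact: (lip1_measurable (l2 _)).
have [L L0 fL] := l1 y.
have L1 : 0 < L + 1 by rewrite ltr_wpDl.
apply/(@cvgrPdist_le _ R^o) => e e0.
have eL : 0 < e / (L + 1) by rewrite divr_gt0.
near=> n.
have n0 : 0 < n.+1%:R :> R by rewrite ltr0n.
rewrite (le_trans (fL _ _))//=.
have /andP[h1 h2] := floor_itv (x * n.+1%:R).
have -> : x - (Num.floor (x * n.+1%:R))%:~R / n.+1%:R = (x * n.+1%:R - (Num.floor (x * n.+1%:R))%:~R) / n.+1%:R.
  by rewrite mulrBl mulfK ?gt_eqF.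
rewrite ger0_norm; last by rewrite divr_ge0 ?subr_ge0.
apply: (@le_trans _ _ ((L + 1) * n.+1%:R^-1)).
  apply: ler_pM => //.
  - by rewrite divr_ge0 ?subr_ge0.
  - by rewrite lerDl.
  - rewrite ler_pdivrMr// mulVf ?gt_eqF//.
    by rewrite lerBlDl; move: h2; rewrite intrD => /ltW.
rewrite mulrC -ler_pdivlMr//; apply: ltW.
by near: n; exact: (near_infty_natSinv_lt (PosNum eL)).
Unshelve. all: by end_near. Qed.

Lemma gauss_Fubini (f : R -> R -> R) L : 0 <= L ->
  (forall x y x' y', `|f x y - f x' y'| <= L * (`|x - x'| + `|y - y'|)) ->
  \int[gam]_x \int[gam]_y f x y = \int[gam]_y \int[gam]_x f x y.
Proof.
move=> L0 fL.
have l1 y : lip1 (f ^~ y).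
  by exists L => // x x'; rewrite (le_trans (fL _ _ _ _))// subrr normr0 addr0.
have l2 x : lip1 (f x).
  by exists L => // y y'; rewrite (le_trans (fL _ _ _ _))// subrr normr0 add0r.
have mf := lip2_measurable l1 l2.
have fi : (gam \x gam)%E.-integrable [set: R * R] (fun p => (f p.1 p.2)%:E).
  apply/(integrable12ltyP gam gam); first exact/measurable_EFinP.
  have lx x : lip1 (fun y => `|f x y|).
    exists L => // y y'; rewrite (le_trans (ler_dist_dist _ _))//.
    by rewrite (le_trans (fL _ _ _ _))// subrr normr0 add0r.
  rewrite (_ : (\int[_]_x _)%E = (\int[gam]_x (\int[gam]_y `|f x y|)%:E)%E); last first.
    by apply: eq_integral => x _; rewrite -gauss_RintegralE//; exact: lip1_integrable.
  have ll : lip1 (fun x => \int[gam]_y `|f x y|).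
    apply: (@lip1_integral _ L) => // x x' y.
    rewrite (le_trans (ler_dist_dist _ _))//.
    by rewrite (le_trans (fL _ _ _ _))// subrr normr0 addr0.
  by rewrite gauss_RintegralE ?ltry//; exact: lip1_integrable.
have := Fubini fi => /= h; rewrite /Rintegral.
congr fine.
transitivity (\int[gam]_x \int[gam]_y (f x y)%:E)%E.
  by apply: eq_integral => x _; rewrite -gauss_RintegralE//; exact: lip1_integrable.
rewrite h; apply: eq_integral => y _.
by rewrite -gauss_RintegralE//; exact: lip1_integrable.
Qed.
End OneDimGauss.

(** * The Sudakov-Fernique inequality for finite families *)
Section GaussOperators.
Context {R : realType} {m : nat}.
Local Notation gam := (@normal_prob R 0 1).
Local Notation V := 'rV[R]_m.
Implicit Types (psi : V -> R) (z a b : V) (va vb : seq V).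

Definition nrm1 z : R := \sum_i `|z 0 i|.

Lemma nrm1_ge0 z : 0 <= nrm1 z.
Proof. exact: sumr_ge0. Qed.

Lemma nrm1Z (x : R) z : nrm1 (x *: z) = `|x| * nrm1 z.
Proof. by rewrite mulr_sumr; apply: eq_bigr => i _; rewrite mxE normrM. Qed.

Lemma ler_nrm1D z z' : nrm1 (z + z') <= nrm1 z + nrm1 z'.
Proof. by rewrite -big_split; apply: ler_sum => i _; rewrite mxE ler_normD. Qed.

Lemma coord_le_nrm1 z i : `|z 0 i| <= nrm1 z.
Proof. by rewrite /nrm1 (bigD1 i)//= lerDl sumr_ge0. Qed.

Definition lipV psi := exists2 L : R, 0 <= L & forall z z', `|psi z - psi z'| <= L * nrm1 (z - z').

Definition gstep a psi z := \int[gam]_x psi (z + x *: a).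

(* [gsteps va psi z] is the expectation of [psi (z + \sum_k x_k *: va_k)] for independent
   standard Gaussian [x_k]. *)
Definition gsteps va psi := foldr gstep psi va.

Lemma lipV_line psi z a : lipV psi -> lip1 (fun x => psi (z + x *: a)).
Proof.
move=> [L L0 pL]; exists (L * nrm1 a) => [|x y]; first by rewrite mulr_ge0// nrm1_ge0.
rewrite (le_trans (pL _ _))// opprD addrACA subrr add0r -scalerBl nrm1Z.
by rewrite [X in L * X]mulrC mulrA.
Qed.

Lemma lipV_line_integrable psi z a : lipV psi ->
  gam.-integrable setT (EFin \o (fun x => psi (z + x *: a))).
Proof. by move=> lp; apply: lip1_integrable; exact: lipV_line. Qed.

Lemma gstep_lip a psi : lipV psi -> lipV (gstep a psi).
Proof.
move=> lp; have [L L0 pL] := lp; exists L => // z z'.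
have ip z0 := lipV_line_integrable z0 a lp.
rewrite /gstep -RintegralB//.
have iB : gam.-integrable setT (EFin \o (fun x => psi (z + x *: a) - psi (z' + x *: a))).
  by have := integrableB measurableT (ip z) (ip z'); apply: eq_integrable.
rewrite (le_trans (le_normr_Rintegral measurableT iB))//.
rewrite -[leRHS]gauss_Rintegral_cst; apply: le_Rintegral => //.
- by have := integrable_abse iB; apply: eq_integrable.
- exact: gauss_integrable_cst.
- by move=> x _; rewrite (le_trans (pL _ _))// opprD addrACA subrr addr0.
Qed.

Lemma gsteps_lip va psi : lipV psi -> lipV (gsteps va psi).
Proof. by move=> lp; elim: va => //= a s IH; exact: gstep_lip. Qed.

Lemma gstep_le a psi psi' c z : lipV psi -> lipV psi' ->
  (forall z, psi z <= psi' z + c) -> gstep a psi z <= gstep a psi' z + c.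
Proof.
move=> lp lp' h; rewrite /gstep -[in leRHS](gauss_Rintegral_cst c) -RintegralD//.
- apply: le_Rintegral => //; first exact: lipV_line_integrable.
  apply: gauss_integrableD; first exact: lipV_line_integrable.
  exact: gauss_integrable_cst.
- exact: lipV_line_integrable.
- exact: gauss_integrable_cst.
Qed.

Lemma gsteps_le va psi psi' c z : lipV psi -> lipV psi' ->
  (forall z, psi z <= psi' z + c) -> gsteps va psi z <= gsteps va psi' z + c.
Proof.
move=> lp lp' h; elim: va z => //= a s IH z.
by apply: gstep_le; [exact: gsteps_lip|exact: gsteps_lip|].
Qed.

Lemma gstep_comm a b psi : lipV psi -> gstep a (gstep b psi) = gstep b (gstep a psi).
Proof.
move=> [L L0 pL]; apply/funext => z; rewrite /gstep.
rewrite (@gauss_Fubini _ (fun x y => psi (z + x *: a + y *: b)) (L * (nrm1 a + nrm1 b))).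
- by apply: eq_Rintegral => y _; apply: eq_Rintegral => x _; rewrite addrAC.
- by rewrite mulr_ge0// addr_ge0// nrm1_ge0.
- move=> x y x' y'; rewrite (le_trans (pL _ _))// -mulrA ler_wpM2l//.
  have -> : z + x *: a + y *: b - (z + x' *: a + y' *: b) = (x - x') *: a + (y - y') *: b.
    by apply/rowP => i; rewrite !mxE; ring.
  rewrite (le_trans (ler_nrm1D _ _))// !nrm1Z.
  have := nrm1_ge0 a; have := nrm1_ge0 b.
  have := normr_ge0 (x - x'); have := normr_ge0 (y - y').
  by move: (nrm1 a) (nrm1 b) `|x - x'| `|y - y'| => p q u v; nra.
Qed.

Lemma gstep_gsteps a vb psi : lipV psi -> gstep a (gsteps vb psi) = gsteps vb (gstep a psi).
Proof.
move=> lp; elim: vb => //= b s IH.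
by rewrite gstep_comm ?IH//; exact: gsteps_lip.
Qed.

Lemma gsteps_comm va vb psi : lipV psi -> gsteps va (gsteps vb psi) = gsteps vb (gsteps va psi).
Proof.
move=> lp; elim: va => //= a s ->; rewrite gstep_gsteps//; exact: gsteps_lip.
Qed.

(** Variances of independent steps along one direction add: this is stability with weights s / r and
    t / r, where r^2 = s^2 + t^2. *)
Lemma gstep_semigroup (s t : R) a psi : 0 < s -> 0 < t -> lipV psi ->
  gstep (s *: a) (gstep (t *: a) psi) = gstep (Num.sqrt (s ^+ 2 + t ^+ 2) *: a) psi.
Proof.
move=> s0 t0 lp; apply/funext => z; rewrite /gstep.
set r := Num.sqrt _.
have r2 : 0 < s ^+ 2 + t ^+ 2 by rewrite addr_gt0// exprn_gt0.
have r0 : 0 < r by rewrite sqrtr_gt0.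
have rr : r ^+ 2 = s ^+ 2 + t ^+ 2 by rewrite sqr_sqrtr// ltW.
rewrite -(@gauss_stable_lip1 _ (s / r) (t / r) (fun x => psi (z + x *: (r *: a)))).
- apply: eq_Rintegral => x _; apply: eq_Rintegral => y _.
  rewrite -addrA !scalerA -scalerDl; congr (psi (_ + _ *: _)).
  by field; rewrite gt_eqF.
- by rewrite divr_gt0.
- by rewrite !expr_div_n -mulrDl -rr divff// expf_neq0// gt_eqF.
- exact: lipV_line.
Qed.

Lemma gsteps_semigroup (s t : R) va psi : 0 < s -> 0 < t -> lipV psi ->
  gsteps (map (fun a => s *: a) va) (gsteps (map (fun a => t *: a) va) psi) =
  gsteps (map (fun a => Num.sqrt (s ^+ 2 + t ^+ 2) *: a) va) psi.
Proof.
move=> s0 t0 lp; elim: va => //= a l IH.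
rewrite -IH -gstep_semigroup//; last by do 2! apply: gsteps_lip.
by congr gstep; rewrite -gstep_gsteps//; apply: gsteps_lip.
Qed.
End GaussOperators.

(** * Mean value theorem and a second order Taylor bound *)

Section Taylor.
Context {R : realType}.
Implicit Types (f g : R -> R).

Lemma is_derive_comp1 f g x df dg : is_derive (f x) (1 : R) g dg -> is_derive x (1 : R) f df ->
  is_derive x (1 : R) (fun y => g (f y)) (dg * df).
Proof. by move=> hg hf; exact: is_derive1_comp. Qed.

Lemma is_derive_bigsum n (h : 'I_n -> R -> R) (dh : 'I_n -> R) x :
  (forall i, is_derive x (1 : R) (h i) (dh i)) ->
  is_derive x (1 : R) (fun y => \sum_i h i y) (\sum_i dh i).
Proof.
move=> hd; have := is_derive_sum hd.
by rewrite (_ : \sum_(i < n) h i = (fun y => \sum_i h i y))//; apply/funext => y; rewrite fct_sumE.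
Qed.

Lemma is_derive_continuous f df : (forall x, is_derive x (1 : R) f (df x)) -> continuous f.
Proof.
move=> h x; apply/differentiable_continuous/derivable1_diffP.
by have [] := h x.
Qed.

(** The location of c is given by a distance, so the order of x and y is immaterial. The proof uses
    the condition (c - x)(c - y) <= 0, which is symmetric in x and y. *)
Lemma mean_value f df x y : (forall x, is_derive x (1 : R) f (df x)) ->
  exists2 c, `|c - x| <= `|y - x| & f y - f x = df c * (y - x).
Proof.
move=> h; have cf := is_derive_continuous h.
suff [c cxy e] : exists2 c, (c - x) * (c - y) <= 0 & f y - f x = df c * (y - x).
  exists c => //; move: cxy; have -> : c - y = (c - x) - (y - x) by ring.
  move: (c - x) (y - x) => u w.
  have [->|u0] := eqVneq u 0; first by rewrite normr0.
  rewrite mulrBr subr_le0 => uw.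
  have : `|u| * `|u| <= `|u| * `|w|.
    by rewrite -!normrM ger0_norm -?expr2 ?sqr_ge0// (le_trans uw)// ler_norm.
  by rewrite ler_pM2l// normr_gt0.
wlog xy : x y / x <= y.
  move=> W; have [/W//|/ltW/W[c cx e]] := leP x y.
  by exists c; [rewrite mulrC|rewrite -opprB e -mulrN opprB].
have [c] := MVT_segment xy (fun z _ => h z) (continuous_subspaceT cf).
rewrite in_itv /= => /andP[xc cy] e; exists c => //.
by rewrite mulr_ge0_le0 ?subr_ge0 ?subr_le0.
Qed.

Lemma derive_bounded_lip f df (C : R) x y : (forall x, is_derive x (1 : R) f (df x)) ->
  (forall x, `|df x| <= C) -> `|f y - f x| <= C * `|y - x|.
Proof.
by move=> h hC; have [c _ ->] := mean_value x y h; rewrite normrM ler_wpM2r.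
Qed.

(** The mean value theorem is applied to the remainder and then to dg, so that a Lipschitz bound at
    0 on the second derivative stands in for a third derivative. *)
Lemma taylor2_bound g dg ddg (C x : R) :
  (forall x, is_derive x (1 : R) g (dg x)) ->
  (forall x, is_derive x (1 : R) dg (ddg x)) ->
  (forall x, `|ddg x - ddg 0| <= C * `|x|) ->
  `|g x - g 0 - x * dg 0 - x ^+ 2 / 2 * ddg 0| <= C * `|x| ^+ 3.
Proof.
move=> h1 h2 hC.
pose r y : R := g y + ((- dg 0) * y + (- ddg 0 / 2) * (y * y)).
have dr y : is_derive y (1 : R) r (dg y + (- dg 0 - ddg 0 * y)).
  have d1 := is_deriveMcr (- dg 0) (is_derive_id y (1 : R)).
  have d2 := is_deriveMcr (- ddg 0 / 2) (is_deriveMr (is_derive_id y (1 : R)) (is_derive_id y (1:R))).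
  have := is_deriveDr (h1 y) (is_deriveDr d1 d2).
  rewrite (_ : dg y + _ = dg y + (- dg 0 - ddg 0 * y))//; congr (_ + _).
  by rewrite /= !mulr1; field.
have [c cx e] := mean_value 0 x dr.
have [c' c'c e'] := mean_value 0 c h2.
have -> : g x - g 0 - x * dg 0 - x ^+ 2 / 2 * ddg 0 = r x - r 0 by rewrite /r; field.
move: cx c'c; rewrite !subr0 => cx c'c.
have C0 : 0 <= C.
  have := le_trans (normr_ge0 _) (hC 1); by rewrite normr1 mulr1.
have -> : r x - r 0 = (ddg c' - ddg 0) * c * x.
  rewrite e subr0; congr (_ * _).
  have -> : dg c = ddg c' * (c - 0) + dg 0 by rewrite -e' subrK.
  by ring.
rewrite !normrM exprSr mulrA ler_wpM2r// expr2 mulrA.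
apply: ler_pM => //; rewrite (le_trans (hC _))// ler_wpM2l//.
exact: le_trans c'c cx.
Qed.
End Taylor.

(** * The smooth maximum and its derivatives along lines *)

Section Softmax.
Context {R : realType} {m : nat}.
Local Notation V := 'rV[R]_m.+1.
Implicit Types (z a b : V) (f : 'I_m.+1 -> R).

Definition sumexp z : R := \sum_i expR (z 0 i).
(* The smooth maximum; its Hessian is the covariance of the Gibbs weights. *)
Definition lse z : R := ln (sumexp z).
Definition gibbs z i : R := expR (z 0 i) / sumexp z.
Definition gmean f z : R := \sum_i gibbs z i * f i.
Definition gvariance a z : R := gmean (fun i => a 0 i ^+ 2) z - gmean (a 0) z ^+ 2.

Lemma sumexp_gt0 z : 0 < sumexp z.
Proof.
rewrite /sumexp (bigD1 ord0)//= ltr_pwDl ?expR_gt0//.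
by apply: sumr_ge0 => i _; exact: expR_ge0.
Qed.

Lemma gibbs_ge0 z i : 0 <= gibbs z i.
Proof. by rewrite divr_ge0 ?expR_ge0// ltW// sumexp_gt0. Qed.

Lemma sum_gibbs z : \sum_i gibbs z i = 1.
Proof. by rewrite -mulr_suml divff// gt_eqF// sumexp_gt0. Qed.

Lemma gmean_bound f z B : (forall i, `|f i| <= B) -> `|gmean f z| <= B.
Proof.
move=> fB; rewrite (le_trans (ler_norm_sum _ _ _))//.
rewrite -[leRHS]mul1r -(sum_gibbs z) mulr_suml; apply: ler_sum => i _.
by rewrite normrM ger0_norm ?gibbs_ge0// ler_wpM2l// gibbs_ge0.
Qed.

Lemma is_derive_sumexp f z b x :
  is_derive x (1 : R) (fun x => \sum_i f i * expR ((z + x *: b) 0 i))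
    (\sum_i f i * b 0 i * expR ((z + x *: b) 0 i)).
Proof.
apply: is_derive_bigsum => i.
have -> : (fun y => f i * expR ((z + y *: b) 0 i)) = (fun y => f i * expR (z 0 i + b 0 i * y)).
  by apply/funext => y; rewrite !mxE [_ * y]mulrC.
have := is_deriveMcr (f i) (is_derive_comp1 (is_derive_expR _) (is_derive_affine (z 0 i) (b 0 i) x)).
rewrite (_ : f i * _ = f i * b 0 i * expR ((z + x *: b) 0 i))//.
by rewrite [(z + x *: b) 0 i]mxE [(x *: b) 0 i]mxE [x * b 0 i]mulrC [_ * b 0 i]mulrC mulrA.
Qed.

Lemma is_derive_lse z b x :
  is_derive x (1 : R) (fun x => lse (z + x *: b)) (gmean (b 0) (z + x *: b)).
Proof.
have h := is_derive_sumexp (fun=> 1) z b x.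
have e : (fun x => \sum_i 1 * expR ((z + x *: b) 0 i)) = (fun x => sumexp (z + x *: b)).
  by apply/funext => y; apply: eq_bigr => i _; rewrite mul1r.
rewrite e in h.
have := is_derive_comp1 (is_derive1_ln (sumexp_gt0 (z + x *: b))) h.
rewrite (_ : _^-1 * _ = gmean (b 0) (z + x *: b))// mulr_sumr.
by apply: eq_bigr => i _; rewrite /gibbs; ring.
Qed.

(** The derivative of a Gibbs mean is a Gibbs covariance; for f = b it is the second derivative of
    [lse] along b. *)
Lemma is_derive_gmean f z b x :
  is_derive x (1 : R) (fun x => gmean f (z + x *: b))
   (gmean (fun i => f i * b 0 i) (z + x *: b) - gmean f (z + x *: b) * gmean (b 0) (z + x *: b)).
Proof.
have h := is_derive_sumexp (fun=> 1) z b x.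
have e : (fun x => \sum_i 1 * expR ((z + x *: b) 0 i)) = (fun x => sumexp (z + x *: b)).
  by apply/funext => y; apply: eq_bigr => i _; rewrite mul1r.
rewrite e in h.
have Z0 := sumexp_gt0 (z + x *: b).
have hV := is_deriveV (lt0r_neq0 Z0) h.
have hN := is_derive_sumexp f z b x.
have := is_deriveMr hN hV.
have gE g y : gmean g y = (\sum_i g i * expR (y 0 i)) * (sumexp y)^-1.
  by rewrite mulr_suml; apply: eq_bigr => i _; rewrite /gibbs; ring.
rewrite (_ : (fun y => _) = (fun x => gmean f (z + x *: b))); last first.
  by apply/funext => y; rewrite gE.
rewrite (_ : _ + _ = gmean (fun i => f i * b 0 i) (z + x *: b) -
  gmean f (z + x *: b) * gmean (b 0) (z + x *: b))//.
rewrite !gE.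
have -> : \sum_i 1 * b 0 i * expR ((z + x *: b) 0 i) = \sum_i b 0 i * expR ((z + x *: b) 0 i).
  by apply: eq_bigr => i _; rewrite mul1r.
rewrite /GRing.scale /=.
move: (\sum_i f i * expR _) (\sum_i _ * b 0 i * _) (\sum_i b 0 i * _) (sumexp _) Z0 => p q r s s0.
by field; rewrite gt_eqF.
Qed.

Lemma gmean_lip f z b x F B : (forall i, `|f i| <= F) -> (forall i, `|b 0 i| <= B) ->
  `|gmean f (z + x *: b) - gmean f z| <= 2 * F * B * `|x|.
Proof.
move=> fF bB.
have := @derive_bounded_lip _ _ _ (2 * F * B) 0 x (is_derive_gmean f z b).
rewrite scale0r addr0 subr0; apply => y.
rewrite (le_trans (ler_normB _ _))// -mulrA mulr_natl mulr2n; apply: lerD.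
  by apply: gmean_bound => i; rewrite normrM ler_pM.
by rewrite normrM ler_pM// gmean_bound.
Qed.

Lemma gvariance_lip a z b x A B : (forall i, `|a 0 i| <= A) -> (forall i, `|b 0 i| <= B) ->
  `|gvariance a (z + x *: b) - gvariance a z| <= 6 * A ^+ 2 * B * `|x|.
Proof.
move=> aA bB; rewrite /gvariance.
have h1 : `|gmean (fun i => a 0 i ^+ 2) (z + x *: b) - gmean (fun i => a 0 i ^+ 2) z| <=
   2 * A ^+ 2 * B * `|x|.
  by apply: gmean_lip => // i; rewrite normrX lerXn2r// nnegrE// (le_trans _ (aA i)).
have h2 := @gmean_lip (a 0) z b x A B aA bB.
have h3 := @gmean_bound (a 0) z A aA.
have h4 := @gmean_bound (a 0) (z + x *: b) A aA.
move: (gmean (fun i => _) _) (gmean (fun i => _) _) h1 => p' p h1.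
move: (gmean _ _) (gmean _ _) h2 h3 h4 => q' q h2 h4 h3.
have -> : p - q ^+ 2 - (p' - q' ^+ 2) = (p - p') - (q - q') * (q + q') by ring.
rewrite (le_trans (ler_normB _ _))// normrM.
have h5 : `|q + q'| <= 2 * A by rewrite (le_trans (ler_normD _ _))// mulr_natl mulr2n lerD.
(* The mean of squares contributes 2 and the squared mean contributes 2 times 2, whence 6. *)
have -> : 6 * A ^+ 2 * B * `|x| = 2 * A ^+ 2 * B * `|x| + 2 * A * B * `|x| * (2 * A) by ring.
by rewrite lerD// ler_pM.
Qed.

Lemma lse_lip : lipV lse.
Proof.
exists 1 => // z z'; rewrite mul1r.
have := @derive_bounded_lip _ _ _ (nrm1 (z - z')) 0 1 (is_derive_lse z' (z - z')).
rewrite scale0r addr0 scale1r subr0 normr1 mulr1 [z' + (z - z')]addrC subrK; apply => y.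
by apply: gmean_bound => i; exact: coord_le_nrm1.
Qed.

Lemma gvariance_lipV a : lipV (gvariance a).
Proof.
exists (6 * nrm1 a ^+ 2) => [|z z']; first by rewrite mulr_ge0// sqr_ge0.
have := @gvariance_lip a z' (z - z') 1 (nrm1 a) (nrm1 (z - z')) (coord_le_nrm1 a) (coord_le_nrm1 _).
by rewrite scale1r normr1 mulr1 [z' + (z - z')]addrC subrK.
Qed.

Lemma lse_taylor2 z a x :
  `|lse (z + x *: a) - lse z - x * gmean (a 0) z - x ^+ 2 / 2 * gvariance a z| <=
  6 * nrm1 a ^+ 3 * `|x| ^+ 3.
Proof.
pose dg y := gmean (a 0) (z + y *: a); pose ddg y := gvariance a (z + y *: a).
have h1 y := is_derive_lse z a y.
have h2 y : is_derive y (1 : R) dg (ddg y).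
  have := is_derive_gmean (a 0) z a y; rewrite (_ : _ - _ = ddg y)//.
have h3 y : `|ddg y - ddg 0| <= 6 * nrm1 a ^+ 3 * `|y|.
  have := @gvariance_lip a z a y _ _ (coord_le_nrm1 a) (coord_le_nrm1 a).
  by rewrite -(mulrA 6) -exprSr /ddg scale0r addr0.
have := taylor2_bound x h1 h2 h3.
by rewrite /dg /ddg scale0r addr0.
Qed.
End Softmax.

(** * Comparison for the smooth maximum, then for the maximum *)

Section SudakovFernique.
Context {R : realType} {m : nat}.
Local Notation gam := (@normal_prob R 0 1).
Local Notation V := 'rV[R]_m.+1.
Implicit Types (psi : V -> R) (z a b : V) (va vb : seq V).

Definition gabs k : R := \int[gam]_x (`|x| ^+ k).

Lemma gabs_ge0 k : 0 <= gabs k.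
Proof. by apply: Rintegral_ge0 => x _; exact: exprn_ge0. Qed.

Lemma gauss_integral_approx (f g : R -> R) (C : R) k : (k <= 4)%N ->
  gam.-integrable setT (EFin \o f) -> gam.-integrable setT (EFin \o g) ->
  (forall x, `|f x - g x| <= C * `|x| ^+ k) ->
  `|\int[gam]_x f x - \int[gam]_x g x| <= C * gabs k.
Proof.
move=> k4 fi gi fg; rewrite -RintegralB//.
have iB : gam.-integrable setT (EFin \o (fun x => f x - g x)).
  by have := integrableB measurableT fi gi; apply: eq_integrable.
rewrite (le_trans (le_normr_Rintegral measurableT iB))//.
have ik := gauss_integrable_normX (R := R) k4.
rewrite /gabs -RintegralZl//; apply: le_Rintegral => //.
- by have := integrable_abse iB; apply: eq_integrable.
- exact: gauss_integrableZl.
Qed.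

(** In the Taylor expansion the linear term has mean zero, the quadratic one has mean proportional
    to [gvar], and the remainder is controlled by the third absolute moment. *)
Lemma gstep_lse_approx (e : R) z a : 0 <= e ->
  `|gstep (e *: a) lse z - lse z - e ^+ 2 / 2 * gvar * gvariance a z| <=
  6 * nrm1 a ^+ 3 * gabs 3 * e ^+ 3.
Proof.
move=> e0.
pose g x : R := lse z + (e * gmean (a 0) z * x + e ^+ 2 / 2 * gvariance a z * x ^+ 2).
have i0 := @gauss_integrable_cst R (lse z).
have i1 : gam.-integrable setT (EFin \o (fun x => e * gmean (a 0) z * x)).
  by apply: gauss_integrableZl; exact: (lip1_integrable lip1_id).
have i2 : gam.-integrable setT (EFin \o (fun x => e ^+ 2 / 2 * gvariance a z * x ^+ 2)).
  by apply: gauss_integrableZl; exact: (@gauss_integrableX R 2).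
have i12 := gauss_integrableD i1 i2.
have gi : gam.-integrable setT (EFin \o g) by exact: gauss_integrableD.
have gE : \int[gam]_x g x = lse z + e ^+ 2 / 2 * gvar * gvariance a z.
  rewrite /g RintegralD// RintegralD// gauss_Rintegral_cst RintegralZl//; last exact: (lip1_integrable lip1_id).
  rewrite gauss_mean0 mulr0 add0r RintegralZl//; last exact: (@gauss_integrableX R 2).
  by rewrite -/gvar mulrAC.
rewrite -addrA -opprD -gE.
have -> : 6 * nrm1 a ^+ 3 * gabs 3 * e ^+ 3 = 6 * nrm1 a ^+ 3 * e ^+ 3 * gabs 3 by ring.
apply: gauss_integral_approx => //; first exact: lipV_line_integrable lse_lip.
move=> x; rewrite scalerA.
have := lse_taylor2 z a (x * e).
have -> : lse (z + (x * e) *: a) - lse z - x * e * gmean (a 0) z -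
    (x * e) ^+ 2 / 2 * gvariance a z = lse (z + (x * e) *: a) - g x by rewrite /g; field.
by rewrite normrM (ger0_norm e0) exprMn mulrA [_ * e ^+ 3 * _]mulrAC.
Qed.

Lemma gstep_approx psi L (e : R) z a : 0 <= e -> 0 <= L ->
  (forall z z', `|psi z - psi z'| <= L * nrm1 (z - z')) ->
  `|gstep (e *: a) psi z - psi z| <= L * nrm1 a * gabs 1 * e.
Proof.
move=> e0 L0 pL; have lp : lipV psi by exists L.
rewrite -(gauss_Rintegral_cst (psi z)).
have -> : L * nrm1 a * gabs 1 * e = L * nrm1 a * e * gabs 1 by ring.
apply: gauss_integral_approx => //.
- exact: lipV_line_integrable.
- exact: gauss_integrable_cst.
move=> x; rewrite (le_trans (pL _ _))// addrC addKr !nrm1Z (ger0_norm e0) expr1.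
by rewrite mulrCA mulrC [e * _]mulrC !mulrA.
Qed.

Lemma gstepD a psi psi' z : lipV psi -> lipV psi' ->
  gstep a (fun z => psi z + psi' z) z = gstep a psi z + gstep a psi' z.
Proof. by move=> l l'; rewrite /gstep RintegralD//; exact: lipV_line_integrable. Qed.

Lemma gstepZ a psi c z : lipV psi ->
  gstep a (fun z => c * psi z) z = c * gstep a psi z.
Proof. by move=> l; rewrite /gstep RintegralZl//; exact: lipV_line_integrable. Qed.

Lemma lipVD psi psi' : lipV psi -> lipV psi' -> lipV (fun z => psi z + psi' z).
Proof.
move=> [L L0 h] [L' L'0 h']; exists (L + L') => [|z z']; first exact: addr_ge0.
by rewrite opprD addrACA mulrDl (le_trans (ler_normD _ _))// lerD.
Qed.

Lemma lipVZ c psi : lipV psi -> lipV (fun z => c * psi z).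
Proof.
move=> [L L0 h]; exists (`|c| * L) => [|z z']; first exact: mulr_ge0.
by rewrite -mulrBr normrM -mulrA ler_wpM2l.
Qed.

Lemma gstep_le2 a psi psi' c z : lipV psi -> lipV psi' ->
  (forall z, `|psi z - psi' z| <= c) -> `|gstep a psi z - gstep a psi' z| <= c.
Proof.
move=> l l' h.
have h1 : gstep a psi z <= gstep a psi' z + c.
  by apply: gstep_le => // y; have := h y; rewrite ler_norml; lra.
have h2 : gstep a psi' z <= gstep a psi z + c.
  by apply: gstep_le => // y; have := h y; rewrite ler_norml; lra.
by rewrite ler_norml; lra.
Qed.

(** Induction on the directions. The inner steps leave a term e^2 W with W Lipschitz; a further step
    of size e moves W by O(e), hence the whole by O(e^3). *)
Lemma gsteps_lse_approx va : exists2 C : R, 0 <= C & forall (e : R) z, 0 <= e <= 1 ->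
  `|gsteps (map (fun a => e *: a) va) lse z - lse z -
    e ^+ 2 / 2 * gvar * \sum_(a <- va) gvariance a z| <= C * e ^+ 3.
Proof.
elim: va => [|a va [C C0 IH]].
  by exists 0 => // e z _; rewrite big_nil mulr0 subr0 subrr normr0 mul0r.
pose W z : R := \sum_(a <- va) gvariance a z.
have [L L0 WL] : lipV W.
  rewrite /W; elim: va {IH W} => [|b l IHl].
    by exists 0 => // z z'; rewrite !big_nil subrr normr0 mul0r.
  have := lipVD (gvariance_lipV b) IHl.
  by rewrite (_ : (fun z => _ + _) = (fun z => \sum_(a0 <- b :: l) gvariance a0 z))//; apply/funext => z; rewrite big_cons.
have lW : lipV W by exists L.
exists (C + 6 * nrm1 a ^+ 3 * gabs 3 + gvar / 2 * (L * nrm1 a * gabs 1)) => [|e z e01].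
  by rewrite !addr_ge0// ?mulr_ge0// ?exprn_ge0 ?gabs_ge0 ?gvar_ge0 ?nrm1_ge0 ?invr_ge0.
have /andP[e0 e1] := e01.
rewrite /= big_cons -/(W z).
pose psi' z : R := lse z + e ^+ 2 / 2 * gvar * W z.
set psi := gsteps _ _.
have lpsi : lipV psi by apply: gsteps_lip; exact: lse_lip.
have lpsi' : lipV psi' by apply: lipVD; [exact: lse_lip|exact: lipVZ].
have h1 : `|gstep (e *: a) psi z - gstep (e *: a) psi' z| <= C * e ^+ 3.
  by apply: gstep_le2 => // y; rewrite /psi' opprD addrA; exact: IH.
have h2 : gstep (e *: a) psi' z = gstep (e *: a) lse z + e ^+ 2 / 2 * gvar * gstep (e *: a) W z.
  by rewrite gstepD ?gstepZ//; [exact: lse_lip|exact: lipVZ].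
have h3 := gstep_lse_approx z a e0.
have h4 := gstep_approx z a e0 L0 WL.
have k0 : 0 <= e ^+ 2 / 2 * gvar by rewrite mulr_ge0 ?gvar_ge0// divr_ge0// exprn_ge0.
have -> : gstep (e *: a) psi z - lse z - e ^+ 2 / 2 * gvar * (gvariance a z + W z) =
  (gstep (e *: a) psi z - gstep (e *: a) psi' z) +
  (gstep (e *: a) lse z - lse z - e ^+ 2 / 2 * gvar * gvariance a z) +
  e ^+ 2 / 2 * gvar * (gstep (e *: a) W z - W z) by rewrite h2; ring.
rewrite (le_trans (ler_normD _ _))// mulrDl lerD//.
  by rewrite (le_trans (ler_normD _ _))// mulrDl lerD.
rewrite normrM ger0_norm// (le_trans (ler_wpM2l k0 h4))//.
by rewrite le_eqVlt; apply/orP; left; apply/eqP; field.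
Qed.

(** Both expansions carry the same nonnegative factor [gvar], so the order of the variances decides
    up to third order. *)
Lemma lse_comparison_step va vb :
  (forall z, \sum_(a <- va) gvariance a z <= \sum_(b <- vb) gvariance b z) ->
  exists2 C : R, 0 <= C & forall (e : R) z, 0 <= e <= 1 ->
   gsteps (map (fun a => e *: a) va) lse z <= gsteps (map (fun b => e *: b) vb) lse z + C * e ^+ 3.
Proof.
move=> h; have [Ca Ca0 ha] := gsteps_lse_approx va; have [Cb Cb0 hb] := gsteps_lse_approx vb.
exists (Ca + Cb) => [|e z e01]; first exact: addr_ge0.
have := ha e z e01; have := hb e z e01.
have /andP[e0 e1] := e01.
have k0 : 0 <= e ^+ 2 / 2 * gvar by rewrite mulr_ge0 ?gvar_ge0// divr_ge0// exprn_ge0.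
have := ler_wpM2l k0 (h z); rewrite !ler_norml mulrDl.
move: (_ * \sum_(a <- va) _) (_ * \sum_(a <- vb) _) (gsteps _ _ _) (gsteps _ _ _) (lse z) (Ca * _) (Cb * _) => p q r s t u v.
by lra.
Qed.

(* Lindeberg replacement: by stability of the Gaussian law, smoothing along [va] is a [k.+1]-fold
   composition of smoothings of size [e = 1 / sqrt k.+1], and exchanging one factor costs [C e^3]. *)
Lemma lse_comparison va vb z :
  (forall z, \sum_(a <- va) gvariance a z <= \sum_(b <- vb) gvariance b z) ->
  gsteps va lse z <= gsteps vb lse z.
Proof.
move=> h; have [C C0 hC] := lse_comparison_step h.
have ll := @lse_lip R m.
have key (e : R) k z0 : 0 < e <= 1 ->
   gsteps (map (fun a => (Num.sqrt k.+1%:R * e) *: a) va) lse z0 <=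
   gsteps (map (fun b => (Num.sqrt k.+1%:R * e) *: b) vb) lse z0 + k.+1%:R * (C * e ^+ 3).
  move=> /andP[e0 e1]; elim: k z0 => [|k IH] z0.
    by rewrite sqrtr1 !mul1r; apply: hC; rewrite ltW.
  have sq : Num.sqrt k.+2%:R * e = Num.sqrt ((Num.sqrt k.+1%:R * e) ^+ 2 + e ^+ 2).
    rewrite exprMn sqr_sqrtr ?ler0n// -{2}(mul1r (e ^+ 2)) -mulrDl -natr1.
    by rewrite sqrtrM ?addr_ge0// sqrtr_sqr gtr0_norm// natr1.
  have s0 : 0 < Num.sqrt k.+1%:R * e by rewrite mulr_gt0// sqrtr_gt0 ltr0n.
  rewrite sq -!gsteps_semigroup//.
  apply: le_trans (_ : gsteps (map (fun a => (Num.sqrt k.+1%:R * e) *: a) va)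
     (gsteps (map (fun b => e *: b) vb) lse) z0 + C * e ^+ 3 <= _).
    apply: gsteps_le; try exact: gsteps_lip.
    by move=> y; apply: hC; rewrite ltW.
  rewrite gsteps_comm// [in leRHS]gsteps_comm// -[k.+2]addn1 natrD mulrDl mul1r addrA lerD2r.
  by apply: gsteps_le; try exact: gsteps_lip.
apply/ler_addgt0Pr => d d0.
(* The k + 1 exchanges cost C (k + 1)^(-3/2) each, in all C / sqrt (k + 1), to be made at most d. *)
have [k hk] : exists k : nat, C <= d * Num.sqrt k.+1%:R.
  exists (Num.truncn ((C / d) ^+ 2)).
  have cd : 0 <= C / d by rewrite divr_ge0// ltW.
  have : Num.sqrt ((C / d) ^+ 2) <= Num.sqrt (Num.truncn ((C / d) ^+ 2)).+1%:R.
    by rewrite ler_sqrt ?ler0n// ltW// truncnS_gt.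
  by rewrite sqrtr_sqr ger0_norm// ler_pdivrMr// mulrC.
have s0 : 0 < Num.sqrt (k.+1%:R : R) by rewrite sqrtr_gt0 ltr0n.
have s1 : 1 <= Num.sqrt (k.+1%:R : R) by rewrite -[leLHS]sqrtr1 ler_wsqrtr// ler1n.
have := @key (Num.sqrt k.+1%:R)^-1 k z; rewrite invr_gt0 s0 invf_le1// s1 divff ?gt_eqF//.
rewrite !(eq_map (g := id)); try by move=> y; rewrite scale1r.
rewrite !map_id => /(_ isT) H; rewrite (le_trans H)// lerD2l.
rewrite -[X in X * _](@sqr_sqrtr _ k.+1%:R)//.
have -> : Num.sqrt k.+1%:R ^+ 2 * (C * (Num.sqrt k.+1%:R)^-1 ^+ 3) = C / Num.sqrt k.+1%:R :> R.
  by field; rewrite gt_eqF.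
by rewrite ler_pdivrMr.
Qed.

(** A variance is half the mean squared difference of two independent copies. In this form only the
    increments of a appear, which is how the Sudakov-Fernique hypothesis enters. *)
Lemma gvarianceE a z : gvariance a z =
  2^-1 * \sum_i \sum_j gibbs z i * gibbs z j * (a 0 i - a 0 j) ^+ 2.
Proof.
have h i : \sum_j gibbs z i * gibbs z j * (a 0 i - a 0 j) ^+ 2 =
  gibbs z i * a 0 i ^+ 2 + gibbs z i * gmean (fun i => a 0 i ^+ 2) z
   - 2 * (gibbs z i * a 0 i) * gmean (a 0) z.
  rewrite /gmean !mulr_sumr -[X in X + _ - _]mulr1 -{1}(sum_gibbs z) mulr_sumr.
  rewrite -big_split /= -sumrB; apply: eq_bigr => j _; ring.
rewrite (eq_bigr _ (fun i _ => h i)) sumrB big_split /= -!mulr_suml -mulr_sumr.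
rewrite (divff (lt0r_neq0 (sumexp_gt0 z))) mul1r /gvariance.
by rewrite (_ : \sum_i gibbs z i * a 0 i = gmean (a 0) z)//
  (_ : \sum_i gibbs z i * a 0 i ^+ 2 = gmean (fun i => a 0 i ^+ 2) z)//; field.
Qed.

Lemma sum_gvariance_le va vb z :
  (forall i j, \sum_(a <- va) (a 0 i - a 0 j) ^+ 2 <= \sum_(b <- vb) (b 0 i - b 0 j) ^+ 2) ->
  \sum_(a <- va) gvariance a z <= \sum_(b <- vb) gvariance b z.
Proof.
move=> h; under eq_bigr do rewrite gvarianceE; under [leRHS]eq_bigr do rewrite gvarianceE.
rewrite -!mulr_sumr ler_wpM2l ?invr_ge0//.
rewrite exchange_big [leRHS]exchange_big; apply: ler_sum => i _ /=.
rewrite exchange_big [leRHS]exchange_big; apply: ler_sum => j _ /=.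
by rewrite -!mulr_sumr ler_wpM2l// mulr_ge0 ?gibbs_ge0.
Qed.

Definition vmax z : R := \big[Num.max/z 0 ord0]_i z 0 i.

Lemma le_vmax z i : z 0 i <= vmax z.
Proof. exact: le_bigmax. Qed.

Lemma vmax_le z (c : R) : (forall i, z 0 i <= c) -> vmax z <= c.
Proof. by move=> h; apply/bigmax_leP; split. Qed.

Lemma vmax_lip : lipV vmax.
Proof.
have h z z' : vmax z <= vmax z' + nrm1 (z - z').
  apply: vmax_le => i; rewrite -lerBlDl; have := le_vmax z' i.
  have := ler_norm ((z - z') 0 i); have := coord_le_nrm1 (z - z') i; rewrite !mxE; lra.
exists 1 => // z z'; rewrite mul1r.
have := h z z'; have := h z' z.
have -> : nrm1 (z' - z) = nrm1 (z - z').
  by rewrite -opprB -scaleN1r nrm1Z normrN1 mul1r.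
by rewrite ler_norml; lra.
Qed.

Lemma le_vmax_lse z : vmax z <= lse z.
Proof.
apply: vmax_le => i; rewrite -[leLHS]expRK /lse ler_ln ?posrE ?expR_gt0 ?sumexp_gt0//.
by rewrite /sumexp (bigD1 i)//= lerDl sumr_ge0// => j _; exact: expR_ge0.
Qed.

Lemma lse_le_vmax z : lse z <= vmax z + ln m.+1%:R.
Proof.
rewrite -[vmax z]expRK -lnM ?posrE ?expR_gt0// ler_ln ?posrE ?mulr_gt0 ?expR_gt0 ?sumexp_gt0//.
rewrite mulr_natr -[X in _ *+ X]card_ord -sumr_const.
by apply: ler_sum => i _; rewrite ler_expR le_vmax.
Qed.

Lemma vmaxZ (c : R) z : 0 < c -> vmax (c *: z) = c * vmax z.
Proof.
move=> c0; apply/eqP; rewrite eq_le; apply/andP; split.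
  by apply: vmax_le => i; rewrite mxE ler_pM2l// le_vmax.
rewrite mulrC -ler_pdivlMr//; apply: vmax_le => i; rewrite ler_pdivlMr// mulrC.
by have := le_vmax (c *: z) i; rewrite mxE.
Qed.

Lemma gsteps_scale (c : R) va psi z :
  gsteps (map (fun a => c *: a) va) psi (c *: z) = gsteps va (fun z => psi (c *: z)) z.
Proof.
elim: va z => //= a va IH z; apply: eq_Rintegral => x _.
by rewrite -IH scalerDr !scalerA mulrC.
Qed.

Lemma vmax_comparison va vb z :
  (forall i j, \sum_(a <- va) (a 0 i - a 0 j) ^+ 2 <= \sum_(b <- vb) (b 0 i - b 0 j) ^+ 2) ->
  gsteps va vmax z <= gsteps vb vmax z.
Proof.
move=> h; apply/ler_addgt0Pr => e e0.
have lv := vmax_lip; have ll := @lse_lip R m.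
(* The smooth maximum is off by at most ln (m + 1), and working at scale c divides this error by c.
   The + 1 keeps c positive when m = 0. *)
pose c : R := ln m.+1%:R / e + 1.
have l0 : 0 <= ln m.+1%:R :> R by rewrite ln_ge0// ler1n.
have c0 : 0 < c by rewrite ltr_wpDl// divr_ge0// ltW.
have main : gsteps va (fun z => vmax (c *: z)) z <= gsteps vb (fun z => vmax (c *: z)) z + ln m.+1%:R.
  rewrite -!gsteps_scale.
  apply: le_trans (_ : gsteps (map (fun a => c *: a) va) lse (c *: z) + 0 <= _).
    by apply: gsteps_le => // y; rewrite addr0; exact: le_vmax_lse.
  rewrite addr0; apply: le_trans (_ : gsteps (map (fun b => c *: b) vb) lse (c *: z) <= _).
    apply: lse_comparison => y; apply: sum_gvariance_le => i j.
    rewrite !big_map; under eq_bigr do rewrite !mxE -mulrBr exprMn.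
    under [leRHS]eq_bigr do rewrite !mxE -mulrBr exprMn.
    by rewrite -!mulr_sumr ler_wpM2l// sqr_ge0.
  by apply: gsteps_le => // y; exact: lse_le_vmax.
have lin s y : gsteps s (fun z => vmax (c *: z)) y = c * gsteps s vmax y.
  elim: s y => [|a s IH] y /=; first by rewrite vmaxZ.
  by rewrite -gstepZ; [apply: eq_Rintegral => x _; exact: IH|exact: gsteps_lip].
rewrite !lin in main; rewrite -(ler_pM2l c0) mulrDr (le_trans main)//.
rewrite lerD2l /c mulrDl mul1r divfK ?gt_eqF// lerDl ltW//.
Qed.
End SudakovFernique.

(** * Gaussian vectors and countable comparison *)
Section GaussTuple.
Context {R : realType}.
Local Notation gam := (@normal_prob R 0 1).

Definition tcons q (p : measurableTypeR R * q.-tuple R) : q.+1.-tuple R := [tuple of p.1 :: p.2].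

Lemma measurable_tcons q : measurable_fun setT (@tcons q).
Proof. exact: (measurable_cons measurable_fst measurable_snd). Qed.

HB.instance Definition _ q :=
  isMeasurableFun.Build _ _ _ _ (@tcons q) (@measurable_tcons q).

(** Coordinate k has standard deviation s k. The recursion on the length lets an integral unfold one
    coordinate at a time, in step with [gsteps]. *)
Fixpoint gauss_tuple q (s : nat -> R) : probability (q.-tuple R) R :=
  match q with
  | 0 => \d_ [tuple]
  | q'.+1 => distribution (normal_prob 0 (s 0%N) \x gauss_tuple q' (fun k => s k.+1))%E
      (@tcons q')
  end.

Definition box q (B : 'I_q -> set R) : set (q.-tuple R) :=
  [set t | forall i, B i (tnth t i)].

Lemma measurable_box q (B : 'I_q -> set R) :
  (forall i, measurable (B i)) -> measurable (box B).
Proof.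
move=> mB; have -> : box B = \bigcap_(i in [set: 'I_q]) (fun t => tnth t i) @^-1` B i.
  by apply/seteqP; split => t /= h i; [move=> _; exact: h|exact: h].
apply: fin_bigcap_measurable; first exact: finite_finset.
by move=> i _; rewrite -[X in measurable X]setTI; exact: measurable_tnth.
Qed.

Lemma measurable_tupleE q : @measurable _ (q.-tuple R) =
  <<s [set box B | B in [set B | forall i, measurable (B i)]] >>.
Proof.
apply/seteqP; split.
  apply: smallest_sub; first exact: smallest_sigma_algebra.
  rewrite -bigcup_seq => A /= [i _ [Y mY <-]].
  apply: sub_sigma_algebra; exists (fun j => if j == i then Y else setT).
    by move=> j /=; case: ifP.
  apply/seteqP; split => t /=; first by move/(_ i); rewrite eqxx.
  by move=> [_ Yt] j /=; case: eqP => // ->.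
apply: smallest_sub; first exact: sigma_algebra_measurable.
by move=> _ [B mB <-]; exact: measurable_box.
Qed.

(** Boxes are stable under intersection and generate the sigma-algebra of tuples. *)
Lemma tuple_law_unique q (m1 m2 : probability (q.-tuple R) R) :
  (forall B, (forall i, measurable (B i)) -> m1 (box B) = m2 (box B)) ->
  forall A, measurable A -> m1 A = m2 A.
Proof.
move=> h A mA.
apply: (measure_unique [set box B | B in [set B | forall i, measurable (B i)]] (fun=> setT)) => //.
- exact: measurable_tupleE.
- move=> _ _ [B mB <-] [B' mB' <-]; exists (fun i => B i `&` B' i).
    by move=> i; exact: measurableI.
  apply/seteqP; split => t /=; first by move=> H; split => i; have [] := H i.
  by move=> [H1 H2] i; split; [exact: H1|exact: H2].
- move=> _; exists (fun=> setT) => //=; exact/seteqP.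
- by rewrite bigcup_const.
- by move=> _ [B mB <-]; exact: h.
- by move=> k; apply: (le_lt_trans (probability_le1 m1 measurableT)); exact: ltry.
Qed.

Lemma box_tcons q (B : 'I_q.+1 -> set R) :
  @tcons q @^-1` box B = B ord0 `*` box (fun i => B (lift ord0 i)).
Proof.
apply/seteqP; split => [[x t] /= h|[x t] /= [h0 h] i].
  by split => [|i]; [have := h ord0|have := h (lift ord0 i); rewrite tnthS].
by have [j ->|->//] := unliftP ord0 i; rewrite tnthS; exact: h.
Qed.

Lemma gauss_tuple_box q s (B : 'I_q -> set R) : (forall i, measurable (B i)) ->
  gauss_tuple q s (box B) = (\prod_(i < q) normal_prob 0 (s i) (B i))%E.
Proof.
elim: q s B => [|q IH] s B mB.
  rewrite big_ord0 /= diracE mem_set// => -[]//.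
rewrite big_ord_recl -(IH (fun k => s k.+1))//= /distribution /pushforward box_tcons.
apply: product_measure1E; first exact: mB.
by apply: measurable_box => i; exact: mB.
Qed.

Lemma ge0_integral_gauss_tupleS q s (f : q.+1.-tuple R -> \bar R) :
  measurable_fun setT f -> (forall t, 0 <= f t)%E ->
  (\int[gauss_tuple q.+1 s]_t f t =
   \int[normal_prob 0 (s 0%N)]_x \int[gauss_tuple q (fun k => s k.+1)]_t f (tcons (x, t)))%E.
Proof.
move=> mf f0; rewrite [LHS]ge0_integral_distribution//.
rewrite fubini_tonelli1//=.
by apply: measurableT_comp => //; exact: measurable_tcons.
Qed.

Lemma measurable_vmax d (T : measurableType d) m (f : T -> 'rV[R]_m.+1) :
  (forall i, measurable_fun setT (fun x => f x 0 i)) ->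
  measurable_fun setT (fun x => vmax (f x)).
Proof.
move=> mf; rewrite /vmax.
move: (index_enum _) => l; elim: l => [|i l IH].
  by under eq_fun do rewrite big_nil; exact: mf.
by under eq_fun do rewrite big_cons; exact: measurable_maxr.
Qed.

Lemma measurable_lincomb m q (a : 'I_q -> 'rV[R]_m) (z : 'rV[R]_m) i :
  measurable_fun [set: q.-tuple R] (fun t => (z + \sum_k tnth t k *: a k) 0 i).
Proof.
under eq_fun do rewrite mxE summxE.
apply: measurable_funD => //; apply: measurable_sum => k.
under eq_fun do rewrite mxE.
by apply: measurable_funM => //; exact: measurable_tnth.
Qed.

(** Coordinate 0 stays at a nonnegative constant, so the maximum is nonnegative and the coordinates
    can be integrated out one by one by Tonelli. *)
Lemma integral_gauss_tuple_vmax m q (s : nat -> R) (a : 'I_q -> 'rV[R]_m.+1) (z : 'rV[R]_m.+1) :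
  (forall k : nat, 0 < s k) ->
  (forall k : 'I_q, a k 0 ord0 = 0) -> 0 <= z 0 ord0 ->
  (\int[gauss_tuple q s]_t (vmax (z + \sum_k tnth t k *: a k))%:E =
   (gsteps [seq s (k : 'I_q) *: a k | k <- enum 'I_q] vmax z)%:E)%E.
Proof.
elim: q s a z => [|q IH] s a z s0 a0 z0.
  rewrite /= integral_dirac// ?diracT ?mul1e; last first.
    by apply/measurable_EFinP; apply: measurable_vmax => i; exact: measurable_lincomb.
  by rewrite big_ord0 addr0 enum_ord0.
rewrite ge0_integral_gauss_tupleS; last 2 first.
- by apply/measurable_EFinP; apply: measurable_vmax => i; exact: measurable_lincomb.
- move=> t; rewrite lee_fin (le_trans _ (le_vmax _ ord0))// mxE summxE big1 ?addr0// => k _.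
  by rewrite mxE a0 mulr0.
pose g x := gsteps [seq s (k : 'I_q).+1 *: a (lift ord0 k) | k <- enum 'I_q] vmax (z + x *: a ord0).
have IHx x : (\int[gauss_tuple q (fun k => s k.+1)]_t
    (vmax (z + \sum_k tnth (tcons (x, t)) k *: a k))%:E = (g x)%:E)%E.
  rewrite /g -(IH (fun k => s k.+1) (fun k => a (lift ord0 k)))//.
    apply: eq_integral => t _; congr (vmax _)%:E.
    rewrite big_ord_recl addrA; congr (_ + _ + _).
    by apply: eq_bigr => k _; rewrite tnthS.
  by rewrite !mxE a0 mulr0 addr0.
under eq_integral do rewrite IHx.
have lg : lip1 g by apply: lipV_line; apply: gsteps_lip; exact: vmax_lip.
rewrite normal_prob_scale//; last 2 first.
- exact: lip1_continuous.
- move=> x; rewrite -lee_fin -IHx; apply: integral_ge0 => t _.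
  rewrite lee_fin (le_trans _ (le_vmax _ ord0))// mxE summxE big1 ?addr0// => k _.
  by rewrite mxE a0 mulr0.
rewrite enum_ordSl /= -map_comp gauss_RintegralE.
  congr EFin; rewrite /gstep; apply: eq_Rintegral => x _; rewrite /g scalerA mulrC.
  by congr (gsteps _ _ _); apply: eq_map => k.
have := lip1_integrable (lip1_affine 0 (s 0%N) lg).
by apply: eq_integrable => // x _; rewrite /= add0r.
Qed.

(** The variance of x^2 for a standard Gaussian x, kept as an unevaluated real constant. *)
Definition kurt : R := \int[gam]_x ((x ^+ 2 - gvar) ^+ 2).

Local Notation stdn q := (gauss_tuple q (fun=> 1)).

Lemma gauss_integrable_sqrB : gam.-integrable setT (EFin \o (fun x : R => x ^+ 2 - gvar)).
Proof.
exact: (gauss_integrableD (gauss_integrableX (R := R) (isT : (2 <= 4)%N)) (gauss_integrable_cst (- gvar))).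
Qed.

Lemma gauss_integrable_dev2 : gam.-integrable setT (EFin \o (fun x : R => (x ^+ 2 - gvar) ^+ 2)).
Proof.
have h1 := gauss_integrableX (R := R) (isT : (4 <= 4)%N).
have h2 := gauss_integrableZl (- (2 * gvar)) (gauss_integrableX (R := R) (isT : (2 <= 4)%N)).
have := gauss_integrableD (gauss_integrableD h1 h2) (gauss_integrable_cst (gvar ^+ 2)).
by apply: eq_integrable => // x _; rewrite /=; congr EFin; ring.
Qed.

Lemma integral_gauss_tuple_sqr q (c : R) (w : 'I_q -> R) : 0 <= c -> (forall k, 0 <= w k) ->
  (\int[stdn q]_t (c + \sum_k w k * tnth t k ^+ 2)%:E = (c + gvar * \sum_k w k)%:E)%E.
Proof.
elim: q c w => [|q IH] c w c0 w0.
  rewrite /= integral_dirac// ?diracT ?mul1e ?big_ord0 ?mulr0//.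
  apply/measurable_EFinP; apply: measurable_funD => //; apply: measurable_sum => k.
  by apply: measurable_funM => //; apply: measurable_funX; exact: measurable_tnth.
have sq0 (t : q.+1.-tuple R) : 0 <= \sum_k w k * tnth t k ^+ 2.
  by apply: sumr_ge0 => k _; rewrite mulr_ge0// sqr_ge0.
rewrite ge0_integral_gauss_tupleS; last 2 first.
- apply/measurable_EFinP; apply: measurable_funD => //; apply: measurable_sum => k.
  by apply: measurable_funM => //; apply: measurable_funX; exact: measurable_tnth.
- by move=> t; rewrite lee_fin addr_ge0.
have IHx (x : R) : (\int[stdn q]_t
    (c + \sum_k w k * tnth (tcons (x, t)) k ^+ 2)%:E =
    (c + gvar * (\sum_k w (lift ord0 k)) + w ord0 * x ^+ 2)%:E)%E.
  rewrite [RHS](_ : _ = ((c + w ord0 * x ^+ 2) + gvar * \sum_k w (lift ord0 k))%:E); last first.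
    by rewrite addrAC.
  rewrite -IH//; last by rewrite addr_ge0// mulr_ge0// sqr_ge0.
  apply: eq_integral => t _; rewrite big_ord_recl addrA; congr (_ + _)%:E.
  by apply: eq_bigr => k _; rewrite tnthS.
under eq_integral do rewrite IHx.
have h2 := gauss_integrableZl (w ord0) (gauss_integrableX (R := R) (isT : (2 <= 4)%N)).
have h1 := gauss_integrable_cst (c + gvar * (\sum_k w (lift ord0 k))).
rewrite (gauss_RintegralE (gauss_integrableD h1 h2)) RintegralD// gauss_Rintegral_cst RintegralZl//; last exact: gauss_integrableX.
by rewrite big_ord_recl -/gvar; congr EFin; ring.
Qed.

(** The constant c absorbs the coordinate just fixed; when it is integrated in turn, the cross term
    has mean zero because x^2 is centered at its mean [gvar]. *)
Lemma integral_gauss_tuple_dev q (c : R) (w : 'I_q -> R) :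
  (\int[stdn q]_t ((c + \sum_k w k * (tnth t k ^+ 2 - gvar)) ^+ 2)%:E =
   (c ^+ 2 + kurt * \sum_k w k ^+ 2)%:E)%E.
Proof.
elim: q c w => [|q IH] c w.
  rewrite /= integral_dirac// ?diracT ?mul1e ?big_ord0 ?mulr0 ?addr0//.
  apply/measurable_EFinP; apply: measurable_funX; apply: measurable_funD => //; apply: measurable_sum => k.
  apply: measurable_funM => //; apply: measurable_funB => //.
  by apply: measurable_funX; exact: measurable_tnth.
rewrite ge0_integral_gauss_tupleS; last 2 first.
- apply/measurable_EFinP; apply: measurable_funX; apply: measurable_funD => //; apply: measurable_sum => k.
  apply: measurable_funM => //; apply: measurable_funB => //.
  by apply: measurable_funX; exact: measurable_tnth.
- by move=> t; rewrite lee_fin sqr_ge0.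
have IHx (x : R) : (\int[stdn q]_t
    ((c + \sum_k w k * (tnth (tcons (x, t)) k ^+ 2 - gvar)) ^+ 2)%:E =
    (c ^+ 2 + kurt * (\sum_k w (lift ord0 k) ^+ 2) + 2 * c * w ord0 * (x ^+ 2 - gvar)
     + w ord0 ^+ 2 * (x ^+ 2 - gvar) ^+ 2)%:E)%E.
  rewrite [RHS](_ : _ = ((c + w ord0 * (x ^+ 2 - gvar)) ^+ 2 + kurt * \sum_k w (lift ord0 k) ^+ 2)%:E); last first.
    by congr EFin; ring.
  rewrite -IH//; apply: eq_integral => t _; rewrite big_ord_recl addrA; congr ((_ + _) ^+ 2)%:E.
  by apply: eq_bigr => k _; rewrite tnthS.
under eq_integral do rewrite IHx.
have h1 := gauss_integrable_cst (c ^+ 2 + kurt * (\sum_k w (lift ord0 k) ^+ 2)).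
have h2 := gauss_integrableZl (2 * c * w ord0) gauss_integrable_sqrB.
have h3 := gauss_integrableZl (w ord0 ^+ 2) gauss_integrable_dev2.
have h12 := gauss_integrableD h1 h2.
rewrite (gauss_RintegralE (gauss_integrableD h12 h3)) RintegralD// RintegralD//.
rewrite gauss_Rintegral_cst RintegralZl//; last exact: gauss_integrable_sqrB.
rewrite RintegralZl//; last exact: gauss_integrable_dev2.
rewrite RintegralB//; [|exact: gauss_integrableX|exact: gauss_integrable_cst].
by rewrite gauss_Rintegral_cst big_ord_recl -/gvar -/kurt; congr EFin; ring.
Qed.

End GaussTuple.

(** * Comparison of suprema over countable Gaussian families *)

Section Comparison.
Context {R : realType}.
Local Notation stdn q := (gauss_tuple q (fun=> (1 : R))).

Definition linrow q (mu : nat -> R) (a : nat -> 'I_q -> R) (t : q.-tuple R) (i : nat) : R :=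
  mu i + \sum_k a i k * tnth t k.

Lemma vmax_attained m (z : 'rV[R]_m.+1) : exists i, vmax z = z 0 i.
Proof.
rewrite /vmax; move: (index_enum _) => l; elim: l => [|i l [j e]].
  by exists ord0; rewrite big_nil.
rewrite big_cons e; have [h|h] := leP (z 0 i) (z 0 j); [by exists j|by exists i].
Qed.

Lemma linrowE m q (mu : nat -> R) (a : nat -> 'I_q -> R) (t : q.-tuple R) (i : 'I_m.+1) :
  (\row_(i < m.+1) mu i + \sum_k tnth t k *: (\row_(i < m.+1) a i k)) 0 i = linrow mu a t i.
Proof.
rewrite !mxE summxE; congr (_ + _); apply: eq_bigr => k _.
by rewrite !mxE mulrC.
Qed.

Lemma linrow_vmax_integral m q (s mu : nat -> R) (a : nat -> 'I_q -> R) :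
  (forall k, 0 < s k) -> mu 0%N = 0 -> (forall k, a 0%N k = 0) ->
  (\int[gauss_tuple q s]_t (vmax (\row_(i < m.+1) mu i + \sum_k tnth t k *: (\row_(i < m.+1) a i k)))%:E =
   (gsteps [seq s (k : 'I_q) *: (\row_(i < m.+1) a i k) | k <- enum 'I_q] vmax (\row_(i < m.+1) mu i))%:E)%E.
Proof.
move=> s0 mu0 a0; apply: integral_gauss_tuple_vmax => // [k|]; first by rewrite mxE a0.
by rewrite mxE mu0.
Qed.

(* The index [0] is pinned to the value 0, which makes all suprema nonnegative. *)
Lemma gauss_comparison p q (s mu : nat -> R) (a : nat -> 'I_p -> R) (b : nat -> 'I_q -> R)
    (F : q.-tuple R -> \bar R) :
  (forall k, 0 < s k) -> mu 0%N = 0 -> (forall k, a 0%N k = 0) -> (forall k, b 0%N k = 0) ->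
  (forall i j, \sum_(k < p) (s k * (a i k - a j k)) ^+ 2 <= \sum_k (b i k - b j k) ^+ 2) ->
  measurable_fun setT F -> (forall i t, ((linrow mu b t i)%:E <= F t)%E) ->
  (\int[gauss_tuple p s]_t ereal_sup (range (fun i => (linrow mu a t i)%:E)) <=
   \int[stdn q]_t F t)%E.
Proof.
move=> s0 mu0 a0 b0 hab mF hF.
pose f m (t : p.-tuple R) : \bar R :=
  (vmax (\row_(i < m.+1) mu i + \sum_k tnth t k *: (\row_(i < m.+1) a i k)))%:E.
have fle m t (c : R) : (f m t <= c%:E)%E <-> (forall i, (i <= m)%N -> linrow mu a t i <= c).
  rewrite /f lee_fin; split => [h i im|h].
    have := le_trans (le_vmax _ (Ordinal (im : (i < m.+1)%N))) h.
    by rewrite linrowE.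
  by apply: vmax_le => i; rewrite linrowE; apply: h; rewrite -ltnS.
have lef m t i : (i <= m)%N -> ((linrow mu a t i)%:E <= f m t)%E.
  by move=> im; rewrite lee_fin; exact: ((fle m t _).1 (lexx _)).
have ndf t : nondecreasing_seq (f ^~ t).
  move=> m m' mm'; apply/(fle m t) => i im.
  by have := lef m' t i (leq_trans im mm'); rewrite lee_fin.
have limf t : limn (f ^~ t) = ereal_sup (range (fun i => (linrow mu a t i)%:E)).
  apply/cvg_lim => //; have := ereal_nondecreasing_cvgn (ndf t).
  rewrite (_ : ereal_sup (range (f ^~ t)) = ereal_sup (range (fun i => (linrow mu a t i)%:E)))//.
  apply/eqP; rewrite eq_le; apply/andP; split; apply: ge_ereal_sup => _ [m _ <-].
    have [i im e] : exists2 i, (i <= m)%N & f m t = (linrow mu a t i)%:E.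
      have [i e] := vmax_attained (\row_(i < m.+1) mu i + \sum_k tnth t k *: (\row_(i < m.+1) a i k)).
      by exists i; [rewrite -ltnS|rewrite /f e linrowE].
    by rewrite e; apply: ereal_sup_ubound; exists i.
  by apply: le_trans (lef m t m (leqnn _)) _; apply: ereal_sup_ubound; exists m.
have mf m : measurable_fun setT (f m).
  by apply/measurable_EFinP; apply: measurable_vmax => i; exact: measurable_lincomb.
have f0 m t : (0 <= f m t)%E.
  have := lef m t 0%N (leq0n _); rewrite /linrow mu0 add0r big1// => k _.
  by rewrite a0 mul0r.
(* The supremum is the increasing limit of the maxima over the indices up to m. Each of these is a
   finite comparison with the same bound, and monotone convergence concludes. *)
under eq_integral do rewrite -limf.
rewrite monotone_convergence//.
apply: lime_le.
  apply: ereal_nondecreasing_is_cvgn => m m' mm'; apply: ge0_le_integral => //.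
  by move=> t _; exact: ndf.
apply: nearW => m; rewrite linrow_vmax_integral//.
apply: le_trans (_ : (gsteps [seq 1 *: (\row_(i < m.+1) b i k) | k <- enum 'I_q] vmax (\row_(i < m.+1) mu i))%:E <= _)%E.
  rewrite lee_fin; apply: vmax_comparison => i j.
  rewrite !big_map -!enumT !big_enum /=.
  under eq_bigr do rewrite !mxE -mulrBr.
  by under [leRHS]eq_bigr do rewrite !mxE !mul1r; exact: hab.
rewrite -(@linrow_vmax_integral m q (fun=> 1))//; apply: ge0_le_integral => //.
- move=> t _; rewrite lee_fin (le_trans _ (le_vmax _ ord0))// linrowE /linrow mu0 add0r.
  by rewrite big1// => k _; rewrite b0 mul0r.
- by apply/measurable_EFinP; apply: measurable_vmax => i; exact: measurable_lincomb.
- move=> t _.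
  have [i ->] := vmax_attained (\row_(i < m.+1) mu i + \sum_k tnth t k *: (\row_(i < m.+1) b i k)).
  by rewrite linrowE.
Qed.

Lemma big_enum_rank (I : finType) (G : I -> 'I_#|I| -> R) :
  \sum_(k < #|I|) G (enum_val k) k = \sum_i G i (enum_rank i).
Proof.
rewrite (reindex (@enum_rank I)) /=; last by apply: onW_bij; exact: enum_rank_bij.
by apply: eq_bigr => i _; rewrite enum_rankK.
Qed.

(** Joint independence and centered Gaussian marginals in a single condition on boxes, which
    determines the joint law; [sd] gives standard deviations. *)
Definition box_law (d : measure_display) (T : measurableType d) (P : probability T R)
    (I : finType) (X : I -> T -> R) (sd : I -> R) :=
  forall B : I -> set R, (forall i, measurable (B i)) ->
    P [set w | forall i, B i (X i w)] = (\prod_i normal_prob 0 (sd i) (B i))%E.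

Lemma ge0_integral_box_law (d : measure_display) (T : measurableType d) (P : probability T R)
    q (X : 'I_q -> T -> R) (s : nat -> R) (f : q.-tuple R -> \bar R) :
  (forall i, measurable_fun setT (X i)) -> box_law P X (fun i => s i) ->
  measurable_fun setT f -> (forall t, 0 <= f t)%E ->
  (\int[P]_w f [tuple X i w | i < q] = \int[gauss_tuple q s]_t f t)%E.
Proof.
move=> mX hX mf f0.
have mT : measurable_fun setT (fun w => [tuple X i w | i < q]).
  apply/measurable_fun_tnthP => i; have := mX i.
  by congr measurable_fun; apply/funext => w; rewrite /= tnth_mktuple.
pose Y : {mfun T >-> q.-tuple R} := HB.pack (fun w => [tuple X i w | i < q])
  (isMeasurableFun.Build _ _ _ _ (fun w => [tuple X i w | i < q]) mT).
have h A : measurable A -> distribution P Y A = gauss_tuple q s A.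
  apply: tuple_law_unique => B mB; rewrite gauss_tuple_box// -hX//.
  congr (P _); apply/seteqP; split => w /= H i; have := H i; by rewrite tnth_mktuple.
transitivity (\int[distribution P Y]_t f t)%E; first by rewrite ge0_integral_distribution.
by apply: eq_measure_integral => A mA _; exact: h.
Qed.

Lemma ereal_sup_measurable (d : measure_display) (T : measurableType d) (f : nat -> T -> \bar R) :
  (forall k, measurable_fun setT (f k)) ->
  measurable_fun setT (fun t => ereal_sup (range (fun k => f k t))).
Proof.
move=> mf; rewrite (_ : (fun t => _) = (fun t => ereal_sup [set f i t | i in [set i | (0 <= i)%N]])).
  exact: (@measurable_fun_esups _ _ _ _ f).
by apply/funext => t; congr ereal_sup; apply/seteqP; split => _ [i _ <-]; exists i.
Qed.

(** The right side is any measurable pointwise majorant F of the second process, so that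
    deterministic matrix estimates can be inserted before integrating. *)
Lemma gauss_comparison_law (d : measure_display) (T : measurableType d) (P : probability T R)
    (I J : finType) (X : I -> T -> R) (sd : I -> R)
    (mu : nat -> R) (a : nat -> I -> R) (b : nat -> J -> R) (F : #|J|.-tuple R -> \bar R) :
  (forall i, measurable_fun setT (X i)) -> (forall i, 0 < sd i) -> box_law P X sd ->
  mu 0%N = 0 -> (forall k, a 0%N k = 0) -> (forall k, b 0%N k = 0) ->
  (forall i j, \sum_k (sd k * (a i k - a j k)) ^+ 2 <= \sum_k (b i k - b j k) ^+ 2) ->
  measurable_fun setT F ->
  (forall i t, ((mu i + \sum_k b i k * tnth t (enum_rank k))%:E <= F t)%E) ->
  (\int[P]_w ereal_sup (range (fun i => (mu i + \sum_k a i k * X k w)%:E)) <=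
   \int[stdn #|J|]_t F t)%E.
Proof.
move=> mX sd0 hX mu0 a0 b0 hab mF hF.
(* The default 1 keeps all standard deviations positive beyond the range of I. *)
pose s (k : nat) : R := if insub k is Some k' then sd (enum_val (k' : 'I_#|I|)) else 1.
have sE (k : 'I_#|I|) : s k = sd (enum_val k) by rewrite /s valK.
have s0 k : 0 < s k by rewrite /s; case: insubP.
pose a' i (k : 'I_#|I|) := a i (enum_val k); pose b' i (k : 'I_#|J|) := b i (enum_val k).
pose X' (k : 'I_#|I|) w := X (enum_val k) w.
pose f (t : #|I|.-tuple R) := ereal_sup (range (fun i => (linrow mu a' t i)%:E)).
have mX' k : measurable_fun setT (X' k) by exact: mX.
have hX' : box_law P X' (fun k => s k).
  move=> B mB; have mB' i : measurable (B (enum_rank i)) by exact: mB.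
  rewrite (_ : [set w | _] = [set w | forall i, B (enum_rank i) (X i w)]); last first.
    apply/seteqP; split => w /= H i; first by have := H (enum_rank i); rewrite /X' enum_rankK.
    by have := H (enum_val i); rewrite enum_valK.
  rewrite (hX _ mB') (reindex (@enum_val I predT)) /=; last first.
    by apply: onW_bij; exact: enum_val_bij.
  by apply: eq_bigr => k _; rewrite sE enum_valK.
have f0 t : (0 <= f t)%E.
  apply: le_trans (_ : (linrow mu a' t 0)%:E <= _)%E; last by apply: ereal_sup_ubound; exists 0%N.
  by rewrite /linrow mu0 add0r big1// => k _; rewrite /a' a0 mul0r.
have mf : measurable_fun setT f.
  apply: ereal_sup_measurable => i; apply/measurable_EFinP.
  apply: measurable_funD => //; apply: measurable_sum => k.
  by apply: measurable_funM => //; exact: measurable_tnth.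
have -> : (\int[P]_w ereal_sup (range (fun i => (mu i + \sum_k a i k * X k w)%:E)) =
    \int[P]_w f [tuple X' i w | i < #|I|])%E.
  apply: eq_integral => w _; congr ereal_sup; apply: eq_imagel => i _.
  congr (_ + _)%:E; rewrite /a' /X'.
  rewrite (big_enum_rank (fun i' k => a i i' * _)).
  by apply: eq_bigr => k _; rewrite tnth_mktuple enum_rankK.
rewrite (ge0_integral_box_law mX' hX')//.
apply: (@gauss_comparison _ _ s mu a' b') => //.
- by move=> k; rewrite /a' a0.
- by move=> k; rewrite /b' b0.
- move=> i j.
  rewrite (big_enum_rank (fun k (_ : 'I_#|J|) => (b i k - b j k) ^+ 2)).
  have := hab i j; rewrite -(big_enum_rank (fun k (_ : 'I_#|I|) => (sd k * (a i k - a j k)) ^+ 2)).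
  by under eq_bigr do rewrite -sE.
- move=> i t; have := hF i t; rewrite /linrow -(big_enum_rank (fun k k' => b i k * tnth t k')).
  by [].
Qed.

Lemma gauss_tuple_coord_law (I : finType) :
  box_law (stdn #|I|) (fun (i : I) t => tnth t (enum_rank i)) (fun=> 1).
Proof.
move=> B mB.
rewrite (_ : [set w | _] = box (fun k => B (enum_val k))); last first.
  apply/seteqP; split => w /= H i; first by have := H (enum_val i); rewrite enum_valK.
  by have := H (enum_rank i); rewrite enum_rankK.
rewrite gauss_tuple_box// (reindex (@enum_val I predT)) /=; last first.
  by apply: onW_bij; exact: enum_val_bij.
by [].
Qed.
End Comparison.

Local Open Scope complex_scope.
Local Open Scope sesquilinear_scope.

(** * Matrix inequalities *)
Section RealInner.
Context {R : realType}.
Local Notation C := R[i].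
Implicit Types (x y z : C).

Lemma Re_sum I (r : seq I) (P : pred I) (F : I -> C) :
  complex.Re (\sum_(i <- r | P i) F i) = \sum_(i <- r | P i) complex.Re (F i).
Proof. by apply: (big_morph (@complex.Re R)) => // -[? ?] [? ?]. Qed.

Lemma Im_sum I (r : seq I) (P : pred I) (F : I -> C) :
  complex.Im (\sum_(i <- r | P i) F i) = \sum_(i <- r | P i) complex.Im (F i).
Proof. by apply: (big_morph (@complex.Im R)) => // -[? ?] [? ?]. Qed.

Definition cip x y : R := complex.Re (x^* * y).

Lemma cipE x y : cip x y = complex.Re x * complex.Re y + complex.Im x * complex.Im y.
Proof. by case: x => a b; case: y => c d; rewrite /cip /= mulNr opprK. Qed.

Lemma cipC x y : cip x y = cip y x.
Proof. by rewrite !cipE mulrC [complex.Im x * _]mulrC. Qed.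

Lemma cip_normc x : cip x x = Normc.normc x ^+ 2.
Proof.
by case: x => a b; rewrite cipE /= sqr_sqrtr ?addr_ge0 ?sqr_ge0// !expr2.
Qed.

(** The real Hilbert-Schmidt inner product Re tr (X^h Y). It turns complex matrices into a real
    Euclidean space, the setting for real Gaussian coordinates and for AM-GM. *)
Definition rip m n (X Y : 'M[C]_(m, n)) : R := \sum_i \sum_j cip (X i j) (Y i j).

Lemma ripC m n (X Y : 'M[C]_(m, n)) : rip X Y = rip Y X.
Proof. by apply: eq_bigr => i _; apply: eq_bigr => j _; exact: cipC. Qed.

Lemma rip_ge0 m n (X : 'M[C]_(m, n)) : 0 <= rip X X.
Proof.
by apply: sumr_ge0 => i _; apply: sumr_ge0 => j _; rewrite cip_normc sqr_ge0.
Qed.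

Lemma ripDl m n (X Y Z : 'M[C]_(m, n)) : rip (X + Y) Z = rip X Z + rip Y Z.
Proof.
rewrite -big_split; apply: eq_bigr => i _; rewrite -big_split; apply: eq_bigr => j _.
rewrite !cipE mxE; case: (X i j) => a b; case: (Y i j) => c d /=; ring.
Qed.

Lemma ripDr m n (X Y Z : 'M[C]_(m, n)) : rip Z (X + Y) = rip Z X + rip Z Y.
Proof. by rewrite ripC ripDl !(ripC Z). Qed.

Lemma ripNl m n (X Y : 'M[C]_(m, n)) : rip (- X) Y = - rip X Y.
Proof.
rewrite -sumrN; apply: eq_bigr => i _; rewrite -sumrN; apply: eq_bigr => j _.
rewrite !cipE mxE; case: (X i j) => a b /=; ring.
Qed.

Lemma ripNr m n (X Y : 'M[C]_(m, n)) : rip X (- Y) = - rip X Y.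
Proof. by rewrite ripC ripNl ripC. Qed.

Lemma ripZl m n (c : R) (X Y : 'M[C]_(m, n)) : rip (c%:C *: X) Y = c * rip X Y.
Proof.
rewrite mulr_sumr; apply: eq_bigr => i _; rewrite mulr_sumr; apply: eq_bigr => j _.
rewrite !cipE mxE; case: (X i j) => a b /=; ring.
Qed.

Lemma ripZr m n (c : R) (X Y : 'M[C]_(m, n)) : rip X (c%:C *: Y) = c * rip X Y.
Proof. by rewrite ripC ripZl ripC. Qed.

Lemma rip0l m n (X : 'M[C]_(m, n)) : rip 0 X = 0.
Proof. by rewrite -(subrr X) ripDl ripNl subrr. Qed.

Lemma rip0r m n (X : 'M[C]_(m, n)) : rip X 0 = 0.
Proof. by rewrite ripC rip0l. Qed.

Lemma rip_sumr m n I (r : seq I) (X : 'M[C]_(m, n)) (F : I -> 'M[C]_(m, n)) :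
  rip X (\sum_(i <- r) F i) = \sum_(i <- r) rip X (F i).
Proof. by apply: (big_morph (rip X)); [move=> Y Z; exact: ripDr|exact: rip0r]. Qed.

Lemma rip_suml m n I (r : seq I) (X : 'M[C]_(m, n)) (F : I -> 'M[C]_(m, n)) :
  rip (\sum_(i <- r) F i) X = \sum_(i <- r) rip (F i) X.
Proof. by rewrite ripC rip_sumr; apply: eq_bigr => i _; rewrite ripC. Qed.

Definition ctr m n (A : 'M[C]_(m, n)) : 'M[C]_(n, m) := A ^t*.
Local Notation "A ^h" := (ctr A) (at level 8, format "A ^h").

Lemma ctrK m n (A : 'M[C]_(m, n)) : A^h^h = A.
Proof. exact: trmxCK. Qed.

Lemma ctrmxE m n (A : 'M[C]_(m, n)) i j : (A^h) i j = (A j i)^*.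
Proof. by rewrite /ctr !mxE. Qed.

Lemma rip_tr m n (X Y : 'M[C]_(m, n)) : rip X Y = complex.Re (\tr (X^h *m Y)).
Proof.
rewrite /mxtrace Re_sum /rip exchange_big; apply: eq_bigr => j _.
by rewrite mxE Re_sum; apply: eq_bigr => i _; rewrite ctrmxE.
Qed.

Lemma ctrmx_mul m n p (A : 'M[C]_(m, n)) (B : 'M[C]_(n, p)) : (A *m B)^h = B^h *m A^h.
Proof. by rewrite /ctr trmx_mul map_mxM. Qed.

Lemma ctrmxD m n (A B : 'M[C]_(m, n)) : (A + B)^h = A^h + B^h.
Proof. by rewrite /ctr linearD /= map_mxD. Qed.

Lemma rip_mull m n p (A : 'M[C]_(m, n)) (X : 'M[C]_(n, p)) Y : rip (A *m X) Y = rip X (A^h *m Y).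
Proof. by rewrite !rip_tr ctrmx_mul mulmxA. Qed.

Lemma rip_mulr m n p (A : 'M[C]_(n, p)) (X : 'M[C]_(m, n)) Y : rip (X *m A) Y = rip X (Y *m A^h).
Proof. by rewrite !rip_tr ctrmx_mul -mulmxA mxtrace_mulC mulmxA. Qed.

Lemma rip_ctr m n (X Y : 'M[C]_(m, n)) : rip (X^h) (Y^h) = rip X Y.
Proof.
rewrite /rip exchange_big; apply: eq_bigr => i _; apply: eq_bigr => j _.
by rewrite !ctrmxE !cipE; case: (X i j) => a b; case: (Y i j) => c d /=; rewrite mulrNN.
Qed.

Lemma rip_amgm m n (X Y : 'M[C]_(m, n)) : 2 * rip X Y <= rip X X + rip Y Y.
Proof. by have := rip_ge0 (X - Y); rewrite ripDl !ripDr !ripNl !ripNr (ripC Y X); lra. Qed.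

Lemma rip_amgm_scaled m n (X Y : 'M[C]_(m, n)) (s : R) : 0 < s ->
  2 * rip X Y <= s * rip X X + s^-1 * rip Y Y.
Proof.
move=> s0.
have s0' : Num.sqrt s ^+ 2 = s by rewrite sqr_sqrtr ?ltW.
have sn0 : Num.sqrt s != 0 by rewrite gt_eqF// sqrtr_gt0.
have := rip_amgm ((Num.sqrt s)%:C *: X) (((Num.sqrt s)^-1)%:C *: Y).
by rewrite !ripZl !ripZr mulVKf// !mulrA -!expr2 exprVn s0'.
Qed.

(** The left side is 4 rip (y x^h) (b a^h), and AM-GM bounds it by twice the overlap of x^h x with
    y^h y plus twice that of a^h a with b^h b. A second AM-GM bounds the former by the squared norms
    of x^h x and y^h y, which depend only on x x^h = a a^h and y y^h = b b^h. *)
Lemma comparison_increments m n p (x y : 'M[C]_(m, p)) (a b : 'M[C]_(m, n)) :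
  x *m x^h = a *m a^h -> y *m y^h = b *m b^h ->
  4 * rip (x^h *m a) (y^h *m b) <=
  rip (a^h *m a + b^h *m b) (a^h *m a + b^h *m b).
Proof.
move=> hx hy.
have sq k l (u : 'M[C]_(k, l)) : rip (u^h *m u) (u^h *m u) = rip (u *m u^h) (u *m u^h).
  by rewrite rip_mull ctrK [RHS]rip_mulr ctrK !mulmxA.
have cross k l r (u : 'M[C]_(k, l)) (w : 'M[C]_(r, l)) :
  rip (u *m w^h) (u *m w^h) = rip (u^h *m u) (w^h *m w).
  by rewrite rip_mulr ctrK rip_mull ctrK mulmxA.
have e1 : rip (x^h *m a) (y^h *m b) = rip (y *m x^h) (b *m a^h).
  by rewrite ripC rip_mull ctrK [RHS]ripC rip_mulr ctrK mulmxA.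
have h1 := rip_amgm (y *m x^h) (b *m a^h).
have h2 := rip_amgm (y^h *m y) (x^h *m x).
rewrite e1 !ripDl !ripDr.
move: h1 h2; rewrite !cross !sq hx hy -!sq (ripC (a^h *m a) (b^h *m b)).
by lra.
Qed.

Lemma ctrZ m n (c : R) (A : 'M[C]_(m, n)) : (c%:C *: A)^h = c%:C *: A^h.
Proof.
apply/matrixP => k l; rewrite [RHS]mxE !ctrmxE mxE rmorphM.
by congr (_ * _); exact: conjc_real.
Qed.

(** * Hermitian matrices: spectrum, square roots and operator norm *)

Lemma hermsymmxP n (A : 'M[C]_n) : A \is hermsymmx <-> A^h = A.
Proof.
split=> [/is_hermitianmxP|h]; first by rewrite expr0 scale1r => e; exact: esym e.
by apply/is_hermitianmxP; rewrite expr0 scale1r; exact: esym h.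
Qed.

Lemma spectral_real n (A : 'M[C]_n) : A^h = A ->
  exists (P : 'M[C]_n) (d : 'I_n -> R),
  [/\ P^h *m P = 1%:M, P *m P^h = 1%:M &
  A = P^h *m diag_mx (\row_j (d j)%:C) *m P].
Proof.
move=> /hermsymmxP hA; have uP := spectral_unitarymx A.
have e := invmx_unitary uP.
exists (spectralmx A), (fun j => complex.Re (spectral_diag A 0 j)).
have PP : spectralmx A *m (spectralmx A)^h = 1%:M by exact/unitarymxP.
split=> //.
  by rewrite (mulmx1C PP).
have /hermitian_normalmx/orthomx_spectralP {1}-> := hA.
rewrite e; congr (_ *m diag_mx _ *m _); apply/rowP => j.
rewrite mxE RRe_real//.
by have /mxOverP/(_ 0 j) := hermitian_spectral_diag_real hA.
Qed.

Lemma rip_diag n m (d : 'I_n -> R) (U : 'M[C]_(n, m)) :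
  rip U (diag_mx (\row_j (d j)%:C) *m U) = \sum_i d i * \sum_k cip (U i k) (U i k).
Proof.
apply: eq_bigr => i _; rewrite mulr_sumr; apply: eq_bigr => k _.
rewrite mul_diag_mx !mxE !cipE; case: (U i k) => a b /=; ring.
Qed.

Lemma rip_unitary n m (P : 'M[C]_n) (U : 'M[C]_(n, m)) : P^h *m P = 1%:M -> rip (P *m U) (P *m U) = rip U U.
Proof. by move=> h; rewrite rip_mull mulmxA h mul1mx. Qed.

Lemma eigenvalue_spectral n (P : 'M[C]_n) (d : 'I_n -> R) j : P *m P^h = 1%:M ->
  eigenvalue (P^h *m diag_mx (\row_j (d j)%:C) *m P) (d j)%:C.
Proof.
move=> PP; apply/eigenvalueP; exists (row j P).
  rewrite !rowE !mulmxA -[delta_mx 0 j *m P *m P^h]mulmxA PP mulmx1.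
  by rewrite -[delta_mx 0 j *m diag_mx _]rowE row_diag_mx mxE scalemxAl.
apply/eqP => h; have := congr1 (fun X => (row j X) 0 j) PP.
by rewrite row_mul h mul0mx !mxE eqxx => /esym/eqP; rewrite oner_eq0.
Qed.

Lemma cip_ge0 x : 0 <= cip x x.
Proof. by rewrite cip_normc sqr_ge0. Qed.

Lemma rip_le_lambda_max n (A : 'M[C]_n) m (U : 'M[C]_(n, m)) : A^h = A ->
  rip U (A *m U) <= lambda_max A * rip U U.
Proof.
move=> hA; have [P [d [PhP PPh AE]]] := spectral_real hA.
have ub k (V : 'M[C]_(n, k)) (c : R) : (forall j, d j <= c) -> rip V (A *m V) <= c * rip V V.
  move=> dc; rewrite AE -!mulmxA -rip_mull -(rip_unitary V PhP).
  rewrite rip_diag mulr_sumr; apply: ler_sum => i _.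
  by rewrite ler_wpM2r// sumr_ge0// => j _; exact: cip_ge0.
apply: (ub m U (lambda_max A)) => j; apply: ub_le_sup; last by rewrite /= AE; exact: eigenvalue_spectral.
(* [sup] is genuine only once the spectrum is bounded above: the form is at most this crude
   constant, and it is evaluated at an eigenvector. *)
exists (\sum_j `|d j|) => x /= /eigenvalueP[v vA v0].
have v0' : 0 < rip v^h v^h.
  rewrite lt_def rip_ge0 andbT; apply: contra v0 => /eqP h.
  apply/eqP/rowP => k; rewrite mxE.
  have := cip_ge0 (v^h k 0); have : cip (v^h k 0) (v^h k 0) <= rip v^h v^h.
    rewrite /rip (bigD1 k)//= big_ord1 lerDl; apply: sumr_ge0 => i _.
    by apply: sumr_ge0 => l _; exact: cip_ge0.
  rewrite h cip_normc ctrmxE => h1 h2.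
  have : Normc.normc (v 0 k)^* = 0.
    by apply/eqP; rewrite -sqrf_eq0; apply/eqP/le_anti; rewrite h1 h2.
  by move/Normc.eq0_normc/eqP; rewrite conjC_eq0 => /eqP.
have Av : A *m v^h = x%:C *: v^h.
  have : (v *m A)^h = (x%:C *: v)^h by rewrite vA.
  rewrite ctrmx_mul hA => ->; exact: ctrZ.
rewrite -(ler_pM2r v0') -ripZr -Av; apply: (ub _ v^h) => i.
by rewrite (le_trans (ler_norm _))// (bigD1 i)//= lerDl sumr_ge0.
Qed.

Lemma psd_factor n (A : 'M[C]_n) : A^h = A -> (forall v : 'cV[C]_n, 0 <= rip v (A *m v)) ->
  exists L : 'M[C]_n, A = L^h *m L.
Proof.
move=> hA pA; have [P [d [PhP PPh AE]]] := spectral_real hA.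
have d0 j : 0 <= d j.
  have := pA (P^h *m delta_mx j 0).
  rewrite AE -!mulmxA [P *m (P^h *m _)]mulmxA PPh mul1mx rip_mull ctrK !mulmxA PPh mul1mx.
  rewrite rip_diag (bigD1 j)//= big_ord1 big1 ?addr0.
    by rewrite !mxE !eqxx cipE /= mulr0 addr0 !mulr1.
  by move=> i /negPf ij; rewrite big_ord1 !mxE ij cipE /= !mul0r addr0 mulr0.
exists (diag_mx (\row_j (Num.sqrt (d j))%:C) *m P).
rewrite ctrmx_mul mulmxA -[P^h *m _ *m _]mulmxA.
suff -> : (diag_mx (\row_j (Num.sqrt (d j))%:C))^h *m diag_mx (\row_j (Num.sqrt (d j))%:C) =
  diag_mx (\row_j (d j)%:C) :> 'M[C]_n by [].
have -> : (diag_mx (\row_j (Num.sqrt (d j))%:C))^h = diag_mx (\row_j (Num.sqrt (d j))%:C) :> 'M[C]_n.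
  rewrite /ctr tr_diag_mx map_diag_mx; congr diag_mx; apply/rowP => j.
  by rewrite !mxE; exact: conjc_real.
rewrite mulmx_diag; congr diag_mx; apply/rowP => j; rewrite !mxE.
by rewrite -[RHS]/((d j)%:C) -{3}(sqr_sqrtr (d0 j)) expr2 rmorphM.
Qed.

Lemma gram_sqrt n m (U : 'M[C]_(n, m)) : exists Q : 'M[C]_n, Q *m Q^h = U *m U^h.
Proof.
have [||L e] := @psd_factor n (U *m U^h).
- by rewrite ctrmx_mul ctrK.
- by move=> v; rewrite -mulmxA -{1}(ctrK U) -rip_mull rip_ge0.
by exists L^h; rewrite ctrK -e.
Qed.

Lemma l2normE n (v : 'cV[C]_n) : l2norm v = Num.sqrt (rip v v).
Proof. by rewrite /l2norm /rip; congr Num.sqrt; apply: eq_bigr => i _; rewrite big_ord1 cip_normc. Qed.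

Lemma rip_cols m n (X Y : 'M[C]_(m, n)) : rip X Y = \sum_j rip (col j X) (col j Y).
Proof.
rewrite /rip exchange_big; apply: eq_bigr => j _; apply: eq_bigr => i _.
by rewrite big_ord1 !mxE.
Qed.

Lemma opnorm_has_sup n (A : 'M[C]_n) :
  has_sup [set l2norm (A *m v) | v in [set v : 'cV[C]_n | l2norm v <= 1]].
Proof.
split.
  exists (l2norm (A *m 0)); exists 0 => //=.
  by rewrite l2normE rip0l sqrtr0.
exists (Num.sqrt (Num.max (lambda_max (A^h *m A)) 0)) => _ [v /= v1 <-].
have hh : (A^h *m A)^h = A^h *m A by rewrite ctrmx_mul ctrK.
rewrite l2normE ler_wsqrtr// rip_mull mulmxA (le_trans (rip_le_lambda_max _ hh))//.
have v2 : rip v v <= 1.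
  move: v1; rewrite l2normE -[leLHS]ger0_norm ?sqrtr_ge0// -[X in _ <= X]sqrtr1.
  by rewrite ger0_norm ?sqrtr_ge0// ler_sqrt.
have [h|h] := leP (lambda_max (A^h *m A)) 0.
  by rewrite mulr_le0_ge0// rip_ge0.
by rewrite -[leRHS]mulr1 ler_pM2l.
Qed.

Lemma opnorm_ge0 n (A : 'M[C]_n) : 0 <= opnorm A.
Proof.
apply: ub_le_sup; first by have [] := opnorm_has_sup A.
by exists 0 => /=; rewrite ?mulmx0 l2normE rip0l sqrtr0.
Qed.

Lemma opnorm_bound n (A : 'M[C]_n) K m (U : 'M[C]_(n, m)) : opnorm A <= K ->
  rip (A *m U) (A *m U) <= K ^+ 2 * rip U U.
Proof.
move=> AK; have K0 := le_trans (opnorm_ge0 A) AK.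
rewrite [leLHS]rip_cols [X in _ * X]rip_cols mulr_sumr; apply: ler_sum => j _.
have -> : col j (A *m U) = A *m col j U by rewrite !colE mulmxA.
move: (col j U) => v.
have hh : (A^h *m A)^h = A^h *m A by rewrite ctrmx_mul ctrK.
have := rip_ge0 v; rewrite le_eqVlt => /orP[/eqP e|v0].
  by rewrite rip_mull mulmxA (le_trans (rip_le_lambda_max _ hh))// -e !mulr0.
pose r := Num.sqrt (rip v v).
have r0 : 0 < r by rewrite sqrtr_gt0.
have rr : r ^+ 2 = rip v v by rewrite sqr_sqrtr// ltW.
have h1 : l2norm (A *m ((r^-1)%:C *: v)) <= K.
  apply: le_trans AK; apply: ub_le_sup; first by have [] := opnorm_has_sup A.
  exists ((r^-1)%:C *: v) => //=.
  rewrite l2normE ripZl ripZr -rr (_ : r^-1 * _ = 1) ?sqrtr1//.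
  by field; rewrite gt_eqF.
move: h1; rewrite l2normE -scalemxAr ripZl ripZr mulrA -expr2 => h1.
have : r ^- 2 * rip (A *m v) (A *m v) <= K ^+ 2.
  rewrite -exprVn -[leLHS]sqr_sqrtr ?lerXn2r ?nnegrE ?sqrtr_ge0//.
  by rewrite mulr_ge0 ?rip_ge0// exprn_ge0// invr_ge0 ltW.
by rewrite -rr mulrC ler_pdivrMr// exprn_gt0.
Qed.

Lemma opnorm_le n (A : 'M[C]_n) S : (forall v : 'cV[C]_n, rip v v <= 1 -> l2norm (A *m v) <= S) ->
  opnorm A <= S.
Proof.
move=> h; apply: ge_sup; first by have [] := opnorm_has_sup A.
move=> _ [v /= v1 <-]; apply: h; move: v1; rewrite l2normE.
by rewrite -[X in _ <= X]sqrtr1 ler_sqrt.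
Qed.

(** Polarization: for the unit vector w along H v, the forms at w + v and w - v differ by 4 |H v|,
    while the bounds on them add up to 2 S (1 + |v|^2) <= 4 S. *)
Lemma opnorm_herm_le n (H : 'M[C]_n) S : H^h = H -> 0 <= S ->
  (forall v : 'cV[C]_n, `|rip v (H *m v)| <= S * rip v v) -> opnorm H <= S.
Proof.
move=> hH S0 h; apply: opnorm_le => v v1.
have [e|e0] := eqVneq (l2norm (H *m v)) 0; first by rewrite e.
set r := l2norm _ in e0 *.
have r0 : 0 < r by rewrite lt_def e0 /r l2normE sqrtr_ge0.
have rr : rip (H *m v) (H *m v) = r ^+ 2 by rewrite /r l2normE sqr_sqrtr// rip_ge0.
pose w := (r^-1)%:C *: (H *m v).
have ww : rip w w = 1 by rewrite ripZl ripZr rr; field.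
have wHv : rip w (H *m v) = r by rewrite ripZl rr; field.
have sym (x y : 'cV[C]_n) : rip x (H *m y) = rip y (H *m x).
  by rewrite -{1}hH -rip_mull ripC.
have := h (w + v); have := h (w - v).
rewrite !mulmxDr !ripDl !ripDr !mulmxN !ripNl !ripNr (sym v w) wHv (ripC v w) ww.
rewrite !ler_norml => /andP[h1 _] /andP[_ h2].
have : S * rip v v <= S by rewrite -[leRHS]mulr1 ler_wpM2l.
lra.
Qed.

(** * Tensor vectors as matrices, and the bound on the comparison process *)

Lemma sum_tens_index (V : nmodType) n m (F : 'I_(n * m) -> V) :
  \sum_k F k = \sum_i \sum_j F (mxtens_index (i, j)).
Proof.
rewrite pair_big /= (reindex (@mxtens_index n m)) /=.
  by apply: eq_bigr => -[i j].
by exists (@mxtens_unindex n m) => ? _; [exact: mxtens_indexK|exact: mxtens_unindexK].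
Qed.

Definition unvec n m (v : 'cV[C]_(n * m)) : 'M[C]_(n, m) :=
  \matrix_(i, j) v (mxtens_index (i, j)) 0.

Lemma rip_unvec n m (v w : 'cV[C]_(n * m)) : rip (unvec v) (unvec w) = rip v w.
Proof.
rewrite [RHS]/rip sum_tens_index; apply: eq_bigr => i _; apply: eq_bigr => j _.
by rewrite big_ord1 !mxE.
Qed.

Lemma unvecD n m (v w : 'cV[C]_(n * m)) : unvec (v + w) = unvec v + unvec w.
Proof. by apply/matrixP => i j; rewrite !mxE. Qed.

Lemma unvec_tens n m (A : 'M[C]_n) (G : 'M[C]_m) (v : 'cV[C]_(n * m)) :
  unvec ((A *t G) *m v) = A *m unvec v *m G^T.
Proof.
apply/matrixP => i j; rewrite mxE mxE [RHS]mxE sum_tens_index exchange_big.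
apply: eq_bigr => l _; rewrite mxE mulr_suml; apply: eq_bigr => k _.
by rewrite tensmxE [in RHS]mxE [in RHS]mxE mulrAC.
Qed.

Lemma unvec_sum n m I (r : seq I) (F : I -> 'cV[C]_(n * m)) :
  unvec (\sum_(i <- r) F i) = \sum_(i <- r) unvec (F i).
Proof.
apply: (big_morph (@unvec n m)) => [v w|]; first exact: unvecD.
by apply/matrixP => i j; rewrite !mxE.
Qed.

Lemma unvecZ n m (c : C) (v : 'cV[C]_(n * m)) : unvec (c *: v) = c *: unvec v.
Proof. by apply/matrixP => i j; rewrite !mxE. Qed.

Lemma rip_rows m n (X Y : 'M[C]_(m, n)) : rip X Y = \sum_i rip (row i X) (row i Y).
Proof.
by apply: eq_bigr => i _; rewrite /rip big_ord1; apply: eq_bigr => j _; rewrite !mxE.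
Qed.

(** The hypothesis says that the block column of the Gam i has norm at most s. For y a row of the
    sum, test it on the corresponding rows of the B i and on y^h, then cancel one factor |y|. *)
Lemma bilinear_to_frobenius N M (I : finType) (Gam : I -> 'M[C]_(N, M)) (s : R) p (B : I -> 'M[C]_(p, N)) :
  0 <= s ->
  (forall (u : I -> 'cV[C]_N) (v : 'cV[C]_M),
    \sum_i rip (u i) (Gam i *m v) <= s * Num.sqrt (\sum_i rip (u i) (u i)) * Num.sqrt (rip v v)) ->
  rip (\sum_i B i *m Gam i) (\sum_i B i *m Gam i) <= s ^+ 2 * \sum_i rip (B i) (B i).
Proof.
move=> s0 h.
under [X in _ <= _ * X]eq_bigr do rewrite rip_rows.
rewrite [leLHS]rip_rows [X in _ <= _ * X]exchange_big mulr_sumr; apply: ler_sum => r _.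
have -> : row r (\sum_i B i *m Gam i) = \sum_i row r (B i) *m Gam i.
  by rewrite rowE mulmx_sumr; apply: eq_bigr => i _; rewrite rowE mulmxA.
set y := \sum_i _; set w := \sum_i _.
have w0 : 0 <= w by apply: sumr_ge0 => i _; exact: rip_ge0.
have e : rip y y = \sum_i rip (row r (B i))^h (Gam i *m y^h).
  rewrite {1}/y rip_suml; apply: eq_bigr => i _.
  by rewrite rip_mulr -rip_ctr ctrmx_mul ctrK.
have := h (fun i => (row r (B i))^h) y^h.
rewrite -e rip_ctr; under eq_bigr do rewrite rip_ctr; rewrite -/w => h1.
have yy := rip_ge0 y.
have [y0|y0] := eqVneq (rip y y) 0; first by rewrite y0 mulr_ge0// sqr_ge0.
have q0 : 0 < Num.sqrt (rip y y) by rewrite sqrtr_gt0 lt_def y0.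
move: h1; rewrite -{1}(sqr_sqrtr yy) expr2 ler_pM2r// => h1.
rewrite -(sqr_sqrtr yy) -(sqr_sqrtr w0) -exprMn lerXn2r ?nnegrE ?sqrtr_ge0//.
by rewrite mulr_ge0// sqrtr_ge0.
Qed.

(** Inserting Q^-1 Q makes the left side a pairing of the sum of the B i Gam i with Q U, to which
    AM-GM at scale s applies. The norm of B i sees S only through S S^h = U U^h, so S is traded for
    U. *)
Lemma fidelity_bound N M (I : finType) (A : I -> 'M[C]_N) (Q S : 'M[C]_N) (U : 'M[C]_(N, M))
    (Gam : I -> 'M[C]_(N, M)) (s : R) :
  Q \in unitmx -> (forall i, (A i)^h = A i) -> S *m S^h = U *m U^h -> 0 < s ->
  (forall (u : I -> 'cV[C]_N) (v : 'cV[C]_M),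
    \sum_i rip (u i) (Gam i *m v) <= s * Num.sqrt (\sum_i rip (u i) (u i)) * Num.sqrt (rip v v)) ->
  2 * \sum_i rip (Gam i) (S^h *m A i *m U) <=
  s * (rip (Q *m U) (Q *m U) +
       \sum_i rip ((invmx Q)^h *m A i *m U) ((invmx Q)^h *m A i *m U)).
Proof.
move=> uQ hA hS s0 h.
pose B i := (invmx Q)^h *m A i *m S.
have e1 : \sum_i rip (Gam i) (S^h *m A i *m U) = rip (\sum_i B i *m Gam i) (Q *m U).
  rewrite rip_suml; apply: eq_bigr => i _.
  rewrite /B -!mulmxA rip_mull ctrK [invmx Q *m _]mulmxA mulVmx// mul1mx.
  by rewrite rip_mull hA rip_mull.
have e2 i : rip ((invmx Q)^h *m A i *m U) ((invmx Q)^h *m A i *m U) = rip (B i) (B i).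
  by rewrite /B [LHS]rip_mulr [RHS]rip_mulr -[_ *m U *m _]mulmxA -[_ *m S *m _]mulmxA hS.
under [X in _ + X]eq_bigr do rewrite e2.
have h1 := bilinear_to_frobenius B (ltW s0) h.
have h2 := rip_amgm_scaled (Q *m U) (\sum_i B i *m Gam i) s0.
rewrite e1 ripC (le_trans h2)// mulrDr lerD2l.
rewrite mulrC ler_pdivrMr// mulrAC -expr2//.
Qed.

Lemma posdef_factor n (Z : 'M[C]_n) : posdef Z ->
  Z^h = Z /\ exists2 Q : 'M[C]_n, Q \in unitmx & Z = Q^h *m Q.
Proof.
move=> [/hermsymmxP hZ pZ]; split=> //.
have ripq (v : 'cV[C]_n) : rip v (Z *m v) = complex.Re (quadform Z v).
  by rewrite rip_tr /quadform -mulmxA /mxtrace big_ord1.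
have [v|Q e] := psd_factor hZ.
  have [->|v0] := eqVneq v 0; first by rewrite rip0l.
  by rewrite ripq; have := pZ v v0; rewrite ltcE => /andP[_ /ltW].
exists Q => //.
rewrite -unitmx_tr -row_free_unit -kermx_eq0; apply/negPn/negP => /rowV0Pn[v /sub_kermxP vQ v0].
have : 0 < quadform Z v^T.
  by apply: pZ; apply: contra v0 => /eqP h; rewrite -[v]trmxK h trmx0.
rewrite ltcE -ripq e -mulmxA -rip_mull.
have -> : Q *m v^T = 0 by rewrite -[Q]trmxK -trmx_mul vQ trmx0.
by rewrite rip0l ltxx andbF.
Qed.

Lemma invmxM n (X Y : 'M[C]_n) : X \in unitmx -> Y \in unitmx -> invmx (X *m Y) = invmx Y *m invmx X.
Proof.
move=> uX uY; have uXY : X *m Y \in unitmx by rewrite unitmx_mul uX.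
apply: (can_inj (mulKmx uXY)); rewrite mulmxV// -mulmxA [Y *m _]mulmxA mulmxV// mul1mx.
by rewrite mulmxV.
Qed.

Lemma ctr1 n : (1%:M : 'M[C]_n)^h = 1%:M.
Proof. exact/hermsymmxP/hermitian1mx_subproof. Qed.

Lemma ctr_invmx n (X : 'M[C]_n) : X \in unitmx -> X^h \in unitmx /\ invmx X^h = (invmx X)^h.
Proof.
move=> uX; have e : X^h *m (invmx X)^h = 1%:M by rewrite -ctrmx_mul mulVmx// ctr1.
have [uXh _] := mulmx1_unit e; split=> //.
by rewrite -[RHS]mul1mx -(mulVmx uXh) -mulmxA e mulmx1.
Qed.

(* [T1] bounds the form for the given [Z] and [T2 <= c] for [Z = 1]. The excess [(s - 1) b / s] over
   [b / s <= T1] is controlled by the latter, so that no bound on [Z] enters. *)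
Lemma fidelity_arith (q0 b s T1 T2 c lam r : R) : b <= s * T1 -> b <= s * T2 -> T2 <= c ->
  q0 + T1 <= lam * r -> 0 <= r -> r <= 1 -> 1 <= s ->
  q0 + b <= Num.max lam 0 + (s - 1) * c.
Proof.
move=> h1 h2 T2c h3 r0 r1 s1; have s0 : 0 < s by rewrite (lt_le_trans ltr01).
have h4 : lam * r <= Num.max lam 0.
  have [l0|l0] := leP lam 0; first by rewrite mulr_le0_ge0.
  by rewrite -[leRHS]mulr1 ler_pM2l.
have b1 : b / s <= T1 by rewrite ler_pdivrMr// mulrC.
have b2 : b / s <= c by apply: le_trans T2c; rewrite ler_pdivrMr// mulrC.
have -> : b = b / s + (s - 1) * (b / s) by field; rewrite gt_eqF.
have h5 : (s - 1) * (b / s) <= (s - 1) * c by rewrite ler_wpM2l// subr_ge0.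
lra.
Qed.

Section RhoArg.
Variables (N n : nat) (A0 : 'M[C]_N) (A : 'I_n -> 'M[C]_N).
Hypotheses (hA0 : A0^h = A0) (hA : forall i, (A i)^h = A i).

Lemma rho_arg_factor Z : posdef Z -> exists2 Q, Q \in unitmx &
  (rho_arg A0 A Z)^h = rho_arg A0 A Z /\
  forall m (U : 'M[C]_(N, m)), rip U (rho_arg A0 A Z *m U) =
    rip U (A0 *m U) + (rip (Q *m U) (Q *m U) +
      \sum_i rip ((invmx Q)^h *m A i *m U) ((invmx Q)^h *m A i *m U)).
Proof.
move=> /posdef_factor[hZ [Q uQ ZE]]; exists Q => //.
have [uQh iQh] := ctr_invmx uQ.
have iZ : invmx Z = invmx Q *m (invmx Q)^h by rewrite ZE invmxM// iQh.
have AE i : A i *m invmx Z *m A i = ((invmx Q)^h *m A i)^h *m ((invmx Q)^h *m A i).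
  by rewrite iZ ctrmx_mul ctrK hA !mulmxA.
split=> [|m U].
  rewrite /rho_arg !ctrmxD hA0 hZ; congr (_ + _).
  transitivity (\sum_i (A i *m invmx Z *m A i)^h).
    apply: (big_morph (@ctr N N)) => [X Y|]; first exact: ctrmxD.
    by rewrite /ctr trmx0 map_mx0.
  by apply: eq_bigr => i _; rewrite AE ctrmx_mul ctrK.
have e1 : rip U (Z *m U) = rip (Q *m U) (Q *m U) by rewrite {1}ZE -mulmxA -rip_mull.
have e2 : rip U ((\sum_(i < n) A i *m invmx Z *m A i) *m U) =
    \sum_i rip ((invmx Q)^h *m A i *m U) ((invmx Q)^h *m A i *m U).
  rewrite mulmx_suml rip_sumr; apply: eq_bigr => i _.
  by rewrite AE -mulmxA -rip_mull.
by rewrite /rho_arg !mulmxDl !ripDr e1 e2 addrA.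
Qed.

Lemma lambda_max_rho_arg_ge Z (e : 'cV[C]_N) : posdef Z -> rip e e = 1 ->
  rip e (A0 *m e) <= lambda_max (rho_arg A0 A Z).
Proof.
move=> /rho_arg_factor[Q uQ [hr hq]] e1.
have := rip_le_lambda_max e hr; rewrite e1 mulr1; apply: le_trans.
by rewrite hq lerDl addr_ge0 ?rip_ge0// sumr_ge0// => i _; exact: rip_ge0.
Qed.

(** The maximum with 0 accounts for U ranging over the unit ball: a negative lambda_max times rip U
    U may exceed lambda_max. *)
Lemma fidelity_rho_bound M (Z S : 'M[C]_N) (U : 'M[C]_(N, M)) (Gam : 'I_n -> 'M[C]_(N, M)) (s K : R) :
  posdef Z -> (forall i, opnorm (A i) <= K) -> S *m S^h = U *m U^h -> rip U U <= 1 -> 1 <= s ->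
  (forall (u : 'I_n -> 'cV[C]_N) (v : 'cV[C]_M),
    \sum_i rip (u i) (Gam i *m v) <= s * Num.sqrt (\sum_i rip (u i) (u i)) * Num.sqrt (rip v v)) ->
  rip U (A0 *m U) + 2 * \sum_i rip (Gam i) (S^h *m A i *m U) <=
  Num.max (lambda_max (rho_arg A0 A Z)) 0 + (s - 1) * (1 + n%:R * K ^+ 2).
Proof.
move=> pZ AK hS U1 s1 h.
have s0 : 0 < s by rewrite (lt_le_trans ltr01).
have [Q uQ [hr hq]] := rho_arg_factor pZ.
have h1 := fidelity_bound uQ hA hS s0 h.
have h2 := fidelity_bound (unitmx1 _ _) hA hS s0 h.
rewrite invmx1 ctr1 mul1mx in h2.
have h3 := rip_le_lambda_max U hr.
rewrite hq in h3.
apply: (fidelity_arith h1 h2 _ h3 (rip_ge0 U) U1 s1).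
rewrite lerD// -[n in n%:R]card_ord -sum1_card natr_sum mulr_suml; apply: ler_sum => i _.
rewrite mul1mx mul1r (le_trans (opnorm_bound U (AK i)))// -[leRHS]mulr1.
by apply: ler_wpM2l => //; exact: sqr_ge0.
Qed.
End RhoArg.

(** * Symmetry between the two ends of the spectrum *)

Lemma lambda_minN n (X : 'M[C]_n) : lambda_min X = - lambda_max (- X).
Proof.
rewrite /lambda_min /lambda_max /inf; congr (- sup _); apply/seteqP; split => x /=.
  move=> [y /eigenvalueP[v vX v0] <-]; apply/eigenvalueP; exists v => //.
  by rewrite mulmxN vX -scaleNr; congr (_ *: _); rewrite rmorphN.
move=> /eigenvalueP[v vX v0]; exists (- x); last by rewrite opprK.
apply/eigenvalueP; exists v => //.
by rewrite -[X]opprK mulmxN vX -scaleNr; congr (_ *: _); rewrite rmorphN.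
Qed.

Lemma ctrN m n (X : 'M[C]_(m, n)) : (- X)^h = - X^h.
Proof. by apply/eqP; rewrite -addr_eq0 -ctrmxD addNr /ctr trmx0 map_mx0. Qed.

Lemma quadformN n (Z : 'M[C]_n) v : quadform (- Z) v = - quadform Z v.
Proof. by rewrite /quadform mulmxN mulNmx mxE. Qed.

Lemma negdef_opp n (Z : 'M[C]_n) : negdef Z -> posdef (- Z).
Proof.
move=> [/hermsymmxP h1 h2]; split; first by apply/hermsymmxP; rewrite ctrN h1.
by move=> v v0; rewrite quadformN oppr_gt0 h2.
Qed.

Lemma posdef_opp n (Z : 'M[C]_n) : posdef Z -> negdef (- Z).
Proof.
move=> [/hermsymmxP h1 h2]; split; first by apply/hermsymmxP; rewrite ctrN h1.
by move=> v v0; rewrite quadformN oppr_lt0 h2.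
Qed.

Lemma posdef_unit n (Z : 'M[C]_n) : posdef Z -> Z \in unitmx.
Proof.
by move=> /posdef_factor[_ [Q uQ ->]]; rewrite unitmx_mul uQ andbT; have [] := ctr_invmx uQ.
Qed.

Lemma posdef1 n : posdef (1%:M : 'M[C]_n).
Proof.
split; first exact: hermitian1mx_subproof.
move=> v v0; rewrite /quadform mulmx1 mxE.
have [i vi] : exists i, v i 0 != 0.
  apply: contrapT => h; move/negP: v0; apply; apply/eqP/colP => i; rewrite mxE.
  by apply/eqP; apply: contrapT => /negP vi; apply: h; exists i.
rewrite (bigD1 i)//= ltr_wpDr//.
  by apply: sumr_ge0 => j _; rewrite !mxE mulrC mul_conjC_ge0.
by rewrite !mxE mulrC mul_conjC_gt0.
Qed.

Lemma rho_argN N n (A0 : 'M[C]_N) (A : 'I_n -> 'M[C]_N) Z :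
  Z \in unitmx -> rho_arg (- A0) A (- Z) = - rho_arg A0 A Z.
Proof.
move=> uZ; rewrite /rho_arg !opprD -sumrN; congr (_ + _); apply: eq_bigr => i _.
have -> : invmx (- Z) = - invmx Z.
  have e : (- Z) *m (- invmx Z) = 1%:M by rewrite mulNmx mulmxN opprK mulmxV.
  have [uN _] := mulmx1_unit e.
  by rewrite -[LHS]mulmx1 -e mulKmx.
by rewrite mulmxN mulNmx.
Qed.

Lemma rho_minusE N n (A0 : 'M[C]_N) (A : 'I_n -> 'M[C]_N) :
  - rho_minus A0 A = rho_plus (- A0) A.
Proof.
rewrite /rho_minus /rho_plus /inf; congr (- sup _); apply/seteqP; split => x /=.
  move=> [Z nZ <-]; exists (lambda_max (rho_arg (- A0) A (- Z))).
    by exists (- Z) => //; exact: negdef_opp.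
  rewrite lambda_minN rho_argN//.
  by rewrite -[Z]opprK -scaleN1r unitmxZ ?unitrN1// posdef_unit//; exact: negdef_opp.
move=> [_ [W pW <-] <-]; exists (- W); first exact: posdef_opp.
by rewrite lambda_minN -rho_argN ?opprK// -scaleN1r unitmxZ ?unitrN1// posdef_unit.
Qed.

Lemma rho_plus_nonempty N n (A0 : 'M[C]_N) (A : 'I_n -> 'M[C]_N) :
  [set lambda_max (rho_arg A0 A Z) | Z in [set Z | posdef Z]] !=set0.
Proof. by exists (lambda_max (rho_arg A0 A 1%:M)); exists 1%:M => //=; exact: posdef1. Qed.

(** The infima may not be attained, so the argument is by contradiction: if x exceeded both, some Z
    and some W would have values strictly below x. *)
Lemma le_rho_star N n (A0 : 'M[C]_N) (A : 'I_n -> 'M[C]_N) (x : R) :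
  (forall Z W, posdef Z -> posdef W ->
    x <= Num.max (lambda_max (rho_arg A0 A Z)) (lambda_max (rho_arg (- A0) A W))) ->
  x <= rho_star A0 A.
Proof.
move=> h; rewrite leNgt; apply/negP; rewrite /rho_star rho_minusE gt_max => /andP[h1 h2].
have [_ [Z pZ <-] hZ] := inf_lt (@rho_plus_nonempty _ _ A0 A) h1.
have [_ [W pW <-] hW] := inf_lt (@rho_plus_nonempty _ _ (- A0) A) h2.
have := h Z W pZ pW; rewrite le_max => /orP[h3|h3].
  by have := lt_le_trans hZ h3; rewrite ltxx.
by have := lt_le_trans hW h3; rewrite ltxx.
Qed.

(** * Entrywise convergence and countable dense families of matrices *)

Lemma cvgn_sum (I : Type) (r : seq I) (f : I -> nat -> R) (l : I -> R) :
  (forall i, f i k @[k --> \oo] --> l i) ->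
  (\sum_(i <- r) f i k) @[k --> \oo] --> \sum_(i <- r) l i.
Proof.
move=> h; elim: r => [|i r IH].
  rewrite big_nil; under eq_fun do rewrite big_nil; exact: cvg_cst.
rewrite big_cons; under eq_fun do rewrite big_cons.
by apply: (@cvgD _ R^o); [exact: h|exact: IH].
Qed.

Definition cvgmx m n (Y : nat -> 'M[C]_(m, n)) (X : 'M[C]_(m, n)) := forall i j,
  (complex.Re (Y k i j) @[k --> \oo] --> complex.Re (X i j)) /\
  (complex.Im (Y k i j) @[k --> \oo] --> complex.Im (X i j)).

Lemma cvgmx_rip m n Y (X : 'M[C]_(m, n)) Y' X' : cvgmx Y X -> cvgmx Y' X' ->
  rip (Y k) (Y' k) @[k --> \oo] --> rip X X'.
Proof.
move=> h h'; rewrite /rip; apply: cvgn_sum => i; apply: cvgn_sum => j.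
rewrite cipE; under eq_fun do rewrite cipE.
by have [? ?] := h i j; have [? ?] := h' i j; apply: (@cvgD _ R^o); apply: cvgM.
Qed.

Lemma cvgmx_mull m n p (A : 'M[C]_(m, n)) Y (X : 'M[C]_(n, p)) : cvgmx Y X ->
  cvgmx (fun k => A *m Y k) (A *m X).
Proof.
move=> h i j; split.
  under eq_fun do rewrite mxE Re_sum; rewrite mxE Re_sum; apply: cvgn_sum => l.
  have [h1 h2] := h l j.
  have e z : complex.Re (A i l * z) = complex.Re (A i l) * complex.Re z + - complex.Im (A i l) * complex.Im z.
    by case: (A i l) => a b; case: z => c d /=; ring.
  under eq_fun do rewrite e; rewrite e.
  by apply: (@cvgD _ R^o); apply: cvgM => //; exact: cvg_cst.
under eq_fun do rewrite mxE Im_sum; rewrite mxE Im_sum; apply: cvgn_sum => l.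
have [h1 h2] := h l j.
have e z : complex.Im (A i l * z) = complex.Re (A i l) * complex.Im z + complex.Im (A i l) * complex.Re z.
  by case: (A i l) => a b; case: z => c d /=; ring.
under eq_fun do rewrite e; rewrite e.
by apply: (@cvgD _ R^o); apply: cvgM => //; exact: cvg_cst.
Qed.

Lemma cvgmx_col m n Y (X : 'M[C]_(m, n)) j : cvgmx Y X -> cvgmx (fun k => col j (Y k)) (col j X).
Proof. by move=> h i k; rewrite mxE; under eq_fun do rewrite mxE; under [in X in _ /\ X]eq_fun do rewrite mxE; exact: h. Qed.

(** Rational functions on D are enumerated by [unpickle], with 0 for invalid codes; s lists the
    codes of the roundings of x at step 1 / (n + 1). *)
Lemma rational_approx (D : finType) : exists q : nat -> D -> R, forall x : D -> R,
  exists s : nat -> nat, forall d, q (s k) d @[k --> \oo] --> x d.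
Proof.
exists (fun k d => ratr (odflt [ffun=> 0] (unpickle k : option {ffun D -> rat}) d)) => x.
pose r n : {ffun D -> rat} := [ffun d => (Num.floor (x d * n.+1%:R))%:~R / n.+1%:R].
exists (fun n => pickle (r n)) => d.
under eq_fun do rewrite pickleK /= ffunE fmorph_div /= ratr_int ratr_nat.
apply/(@cvgrPdist_le _ R^o) => e e0; near=> n.
have n0 : 0 < n.+1%:R :> R by rewrite ltr0n.
have /andP[h1 h2] := floor_itv (x d * n.+1%:R).
have -> : x d - (Num.floor (x d * n.+1%:R))%:~R / n.+1%:R =
    (x d * n.+1%:R - (Num.floor (x d * n.+1%:R))%:~R) / n.+1%:R.
  by rewrite mulrBl mulfK ?gt_eqF.
rewrite ger0_norm; last by rewrite divr_ge0 ?subr_ge0.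
apply: (@le_trans _ _ n.+1%:R^-1).
  rewrite ler_pdivrMr// mulVf ?gt_eqF//.
  by rewrite lerBlDl; move: h2; rewrite intrD => /ltW.
by apply: ltW; near: n; exact: (near_infty_natSinv_lt (PosNum e0)).
Unshelve. all: by end_near. Qed.

Lemma dense_mx m n : exists q : nat -> 'M[C]_(m, n), forall X,
  exists s : nat -> nat, cvgmx (fun k => q (s k)) X.
Proof.
have [q hq] := rational_approx (bool * ('I_m * 'I_n))%type.
exists (fun k => \matrix_(i, j) (q k (true, (i, j)) +i* q k (false, (i, j)))%C) => X.
have [s hs] := hq (fun d => if d.1 then complex.Re (X d.2.1 d.2.2) else complex.Im (X d.2.1 d.2.2)).
exists s => i j; split.
  by under eq_fun do rewrite mxE /=; exact: (hs (true, (i, j))).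
by under eq_fun do rewrite mxE /=; exact: (hs (false, (i, j))).
Qed.

Lemma cvgn_le0 (f : nat -> R) l : f k @[k --> \oo] --> l -> (forall k, f k <= 0) -> l <= 0.
Proof.
move=> h h0; rewrite -(cvg_lim (@Rhausdorff R) h).
by apply: limr_le; [apply/cvg_ex; exists l|exact: nearW].
Qed.

Lemma cvgn_sqrt (u : nat -> R) l : u k @[k --> \oo] --> l ->
  Num.sqrt (u k) @[k --> \oo] --> Num.sqrt l.
Proof.
by move=> c; apply: (cvg_comp u (@Num.sqrt R) c); exact: sqrt_continuous.
Qed.

(** Since 0^-1 = 0, the zero matrix goes to itself and the result always lies in the unit ball. *)
Definition normalize m n (X : 'M[C]_(m, n)) : 'M[C]_(m, n) := ((Num.sqrt (rip X X))^-1)%:C *: X.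

Lemma rip_normalize_le1 m n (X : 'M[C]_(m, n)) : rip (normalize X) (normalize X) <= 1.
Proof.
rewrite ripZl ripZr mulrA -expr2 exprVn sqr_sqrtr ?rip_ge0//.
have [->|h] := eqVneq (rip X X) 0; first by rewrite mulr0.
by rewrite mulVf.
Qed.

Lemma rip_eq0 m n (X : 'M[C]_(m, n)) : rip X X = 0 -> X = 0.
Proof.
move=> h; apply/matrixP => i j; rewrite mxE; apply: Normc.eq0_normc.
apply/eqP; rewrite -sqrf_eq0 -cip_normc; apply/eqP/le_anti; rewrite cip_ge0 andbT -h.
rewrite /rip (bigD1 i)//= (bigD1 j)//= -addrA lerDl addr_ge0//.
  by apply: sumr_ge0 => l _; exact: cip_ge0.
by apply: sumr_ge0 => l _; apply: sumr_ge0 => k _; exact: cip_ge0.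
Qed.

Lemma normalizeK m n (X : 'M[C]_(m, n)) : (Num.sqrt (rip X X))%:C *: normalize X = X.
Proof.
have [h|h] := eqVneq (rip X X) 0; first by rewrite (rip_eq0 h) /normalize !scaler0.
rewrite /normalize scalerA -rmorphM divff ?rmorph1 ?scale1r//.
by rewrite gt_eqF// sqrtr_gt0 lt_def h rip_ge0.
Qed.

(** Homogeneity turns the bound at normalized points into an inequality at the q k themselves, which
    passes to limits by continuity. *)
Lemma herm_form_dense n (q : nat -> 'cV[C]_n) (H : 'M[C]_n) (s : R) :
  (forall X, exists k : nat -> nat, cvgmx (fun l => q (k l)) X) ->
  (forall k, `|rip (normalize (q k)) (H *m normalize (q k))| <= s) ->
  forall v : 'cV[C]_n, `|rip v (H *m v)| <= s * rip v v.
Proof.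
move=> dq h v; have [k hk] := dq v.
have hq l : `|rip (q l) (H *m q l)| <= s * rip (q l) (q l).
  rewrite -{1 2}[q l]normalizeK -scalemxAr ripZl ripZr mulrA -expr2 sqr_sqrtr ?rip_ge0//.
  by rewrite normrM ger0_norm ?rip_ge0// mulrC ler_wpM2r ?rip_ge0.
have c1 := cvgmx_rip hk (cvgmx_mull H hk).
have c2 : s * rip (q (k l)) (q (k l)) @[l --> \oo] --> s * rip v v.
  by apply: cvgM; [exact: cvg_cst|exact: cvgmx_rip].
have p1 : rip v (H *m v) - s * rip v v <= 0.
  apply: (cvgn_le0 (@cvgB _ R^o _ _ _ _ _ _ _ c1 c2)) => l /=.
  by rewrite subr_le0; have := hq (k l); rewrite ler_norml => /andP[].
have p2 : - rip v (H *m v) - s * rip v v <= 0.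
  apply: (cvgn_le0 (@cvgB _ R^o _ _ _ _ _ _ _ (@cvgN _ R^o _ _ _ _ _ c1) c2)) => l /=.
  by rewrite subr_le0 lerNl; have := hq (k l); rewrite ler_norml => /andP[].
by rewrite ler_norml; move: p1 p2; lra.
Qed.

Lemma bilinear_form_dense N M (I : finType) (q1 : nat -> 'M[C]_(N, #|I|)) (q2 : nat -> 'cV[C]_M)
    (Gam : I -> 'M[C]_(N, M)) (s : R) :
  (forall X, exists k : nat -> nat, cvgmx (fun l => q1 (k l)) X) ->
  (forall X, exists k : nat -> nat, cvgmx (fun l => q2 (k l)) X) ->
  (forall k1 k2, \sum_i rip (col (enum_rank i) (normalize (q1 k1))) (Gam i *m normalize (q2 k2)) <= s) ->
  forall (u : I -> 'cV[C]_N) (v : 'cV[C]_M),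
    \sum_i rip (u i) (Gam i *m v) <= s * Num.sqrt (\sum_i rip (u i) (u i)) * Num.sqrt (rip v v).
Proof.
move=> d1 d2 h u v.
(* The family u is packed into one matrix, so that a single sequence approximates all its members at
   once. *)
pose W : 'M[C]_(N, #|I|) := \matrix_(a, j) u (enum_val j) a 0.
have uE i : u i = col (enum_rank i) W.
  by apply/colP => a; rewrite !mxE enum_rankK.
have -> : \sum_i rip (u i) (u i) = rip W W.
  rewrite rip_cols (reindex (@enum_rank I)) /=; last by apply: onW_bij; exact: enum_rank_bij.
  by apply: eq_bigr => i _; rewrite uE.
under eq_bigr do rewrite uE.
have [k1 c1] := d1 W; have [k2 c2] := d2 v.
have hq l1 l2 : \sum_i rip (col (enum_rank i) (q1 l1)) (Gam i *m q2 l2) <=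
   s * Num.sqrt (rip (q1 l1) (q1 l1)) * Num.sqrt (rip (q2 l2) (q2 l2)).
  have := h l1 l2; set r1 := Num.sqrt (rip (q1 l1) (q1 l1)); set r2 := Num.sqrt (rip (q2 l2) (q2 l2)) => hh.
  have -> : \sum_i rip (col (enum_rank i) (q1 l1)) (Gam i *m q2 l2) =
     r1 * r2 * \sum_i rip (col (enum_rank i) (normalize (q1 l1))) (Gam i *m normalize (q2 l2)).
    rewrite mulr_sumr; apply: eq_bigr => i _.
    rewrite -{1}[q1 l1]normalizeK -{1}[q2 l2]normalizeK -scalemxAr.
    have -> (c : C) (X : 'M[C]_(N, #|I|)) j : col j (c *: X) = c *: col j X by apply/colP => a; rewrite !mxE.
    by rewrite ripZl ripZr mulrA.
  have -> : s * r1 * r2 = r1 * r2 * s by ring.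
  by apply: ler_wpM2l hh; rewrite mulr_ge0// sqrtr_ge0.
rewrite -subr_le0.
apply: (@cvgn_le0 (fun l => \sum_i rip (col (enum_rank i) (q1 (k1 l))) (Gam i *m q2 (k2 l)) -
   s * Num.sqrt (rip (q1 (k1 l)) (q1 (k1 l))) * Num.sqrt (rip (q2 (k2 l)) (q2 (k2 l))))); last first.
  by move=> l; rewrite subr_le0.
apply: (@cvgB _ R^o).
  by apply: cvgn_sum => i; apply: cvgmx_rip; [exact: cvgmx_col|exact: cvgmx_mull].
have cs m n Y (X : 'M[C]_(m, n)) : cvgmx Y X ->
    Num.sqrt (rip (Y l) (Y l)) @[l --> \oo] --> Num.sqrt (rip X X).
  by move=> c; apply: cvgn_sqrt; exact: cvgmx_rip.
apply: cvgM; last exact: cs.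
by apply: cvgM; [exact: cvg_cst|exact: cs].
Qed.

(* The coefficients of the coordinates [herm_entry G] in [Re tr (D G)], for Hermitian [D] and [G]. *)
Definition hcoef M (D : 'M[C]_M) (ij : 'I_M * 'I_M) : R :=
  if ij.1 == ij.2 then complex.Re (D ij.1 ij.2)
  else if (ij.1 <= ij.2)%N then 2 * complex.Re (D ij.1 ij.2)
  else - (2 * complex.Im (D ij.2 ij.1)).

Definition herm_entry M (G : 'M[C]_M) (ij : 'I_M * 'I_M) : R :=
  if (ij.1 <= ij.2)%N then complex.Re (G ij.1 ij.2) else complex.Im (G ij.2 ij.1).

Definition herm_sd M (ij : 'I_M * 'I_M) : R := if ij.1 == ij.2 then 1 else Num.sqrt (1 / 2).

(** The positions (i, j) and (j, i) store the real and the imaginary part of one Hermitian entry, so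
    the identities below hold only after adding the two transposed terms. *)
Lemma sum_symmetrize M (f g : 'I_M -> 'I_M -> R) :
  (forall i j, f i j + f j i = g i j + g j i) -> \sum_i \sum_j f i j = \sum_i \sum_j g i j.
Proof.
move=> h.
have e (k : 'I_M -> 'I_M -> R) : \sum_i \sum_j (k i j + k j i) = 2 * \sum_i \sum_j k i j.
  under eq_bigr do rewrite big_split; rewrite big_split /=.
  by rewrite [X in _ + X]exchange_big /= -mulr2n mulr_natl.
apply: (@mulfI _ (2 : R)); first by rewrite pnatr_eq0.
by rewrite -!e; apply: eq_bigr => i _; apply: eq_bigr => j _.
Qed.

Lemma herm_entries M (D : 'M[C]_M) i j : D^h = D ->
  complex.Re (D j i) = complex.Re (D i j) /\ complex.Im (D j i) = - complex.Im (D i j).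
Proof.
by move=> /(congr1 (fun X : 'M[C]_M => X j i)); rewrite ctrmxE => <-; case: (D i j).
Qed.

Lemma hcoef_sum M (D G : 'M[C]_M) : D^h = D -> G^h = G ->
  \sum_i \sum_j complex.Re (D i j * G i j) = \sum_ij hcoef D ij * herm_entry G ij.
Proof.
move=> hD hG; rewrite -(pair_bigA _ (fun i j => hcoef D (i, j) * herm_entry G (i, j))) /=.
apply: sum_symmetrize => i j.
have [d1 d2] := herm_entries i j hD; have [g1 g2] := herm_entries i j hG.
have rE (z w : C) : complex.Re (z * w) = complex.Re z * complex.Re w - complex.Im z * complex.Im w.
  by case: z; case: w.
rewrite !rE d1 d2 g1 g2 /hcoef /herm_entry /=.
have [ij|ij] := eqVneq i j.
  rewrite -ij leqnn; rewrite -ij in d1 d2 g1 g2 *.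
  by have : complex.Im (D i i) = 0 by [lra|]; nra.
have [h|h] := leqP i j.
  have -> : (j <= i)%N = false by apply/negbTE; rewrite -ltnNge ltn_neqAle ij h.
  by rewrite ?d1 ?g1; ring.
by rewrite (ltnW h) d1 g1 d2 g2; ring.
Qed.

(** This reflects the GUE normalization: an off-diagonal coefficient 2 x at variance 1/2 contributes
    2 x^2, the share of two conjugate entries of D. *)
Lemma hcoef_norm M (D : 'M[C]_M) : D^h = D -> \sum_ij (herm_sd ij * hcoef D ij) ^+ 2 = rip D D.
Proof.
move=> hD; rewrite -(pair_bigA _ (fun i j => (herm_sd (i, j) * hcoef D (i, j)) ^+ 2)) /=.
apply: sum_symmetrize => i j.
have [d1 d2] := herm_entries i j hD.
rewrite !cipE d1 d2 /hcoef /herm_sd /=.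
have s2 : Num.sqrt (1 / 2) ^+ 2 = 1 / 2 :> R by rewrite sqr_sqrtr.
have [ij|ij] := eqVneq i j.
  rewrite -ij; rewrite -ij in d1 d2 *.
  have z : complex.Im (D i i) = 0 by move: d2; move: (complex.Im _) => x; lra.
  by rewrite z; ring.
have [h|h] := leqP i j.
  have -> : (j <= i)%N = false by apply/negbTE; rewrite -ltnNge ltn_neqAle ij h.
  by rewrite ?d1 !exprMn s2; field.
by rewrite (ltnW h) d1 d2 !exprMn sqrrN s2 !exprMn sqrrN; field.
Qed.

Lemma hcoefB M (D E : 'M[C]_M) ij : hcoef (D - E) ij = hcoef D ij - hcoef E ij.
Proof.
rewrite /hcoef !mxE; case: (D _ _) => a b; case: (E _ _) => c d; case: (D _ _) => a' b'; case: (E _ _) => c' d' /=.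
by case: ifP => // _; case: ifP => // _; ring.
Qed.

Lemma hcoefZ M (c : R) (D : 'M[C]_M) ij : hcoef (c%:C *: D) ij = c * hcoef D ij.
Proof.
rewrite /hcoef !mxE; case: (D _ _) => a b; case: (D _ _) => a' b' /=.
by case: ifP => // _; [|case: ifP => // _]; ring.
Qed.

Lemma hcoef0 M ij : hcoef (0 : 'M[C]_M) ij = 0.
Proof. by rewrite /hcoef !mxE /=; case: ifP => // _; case: ifP => // _; rewrite mulr0 ?oppr0. Qed.

Lemma rip_tens_form N M (A : 'M[C]_N) (G : 'M[C]_M) (U : 'M[C]_(N, M)) :
  rip U (A *m U *m G^T) = \sum_i \sum_j complex.Re ((U^h *m A *m U) i j * G i j).
Proof.
have e : G^T = (G^T)^h^h by rewrite ctrK.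
rewrite {1}e -rip_mulr rip_mull mulmxA; apply: eq_bigr => i _; apply: eq_bigr => j _.
by rewrite /cip ctrmxE mxE conjCK mulrC.
Qed.

Lemma gauss_model_form n N M (A0 : 'M[C]_N) (A : 'I_n -> 'M[C]_N) (G : 'I_n -> 'M[C]_M) (v : 'cV[C]_(N * M)) :
  rip v (gauss_model A0 A G *m v) = rip (unvec v) (A0 *m unvec v) +
    (Num.sqrt M%:R)^-1 * \sum_l \sum_i \sum_j complex.Re (((unvec v)^h *m A l *m unvec v) i j * G l i j).
Proof.
rewrite -rip_unvec /gauss_model mulmxDl unvecD ripDr unvec_tens trmx1 mulmx1; congr (_ + _).
rewrite -scalemxAl unvecZ ripZr mulmx_suml unvec_sum rip_sumr; congr (_ * _).
by apply: eq_bigr => l _; rewrite unvec_tens rip_tens_form.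
Qed.

Lemma gauss_model_herm n N M (A0 : 'M[C]_N) (A : 'I_n -> 'M[C]_N) (G : 'I_n -> 'M[C]_M) :
  A0^h = A0 -> (forall l, (A l)^h = A l) -> (forall l, (G l)^h = G l) ->
  (gauss_model A0 A G)^h = gauss_model A0 A G.
Proof.
move=> h0 hA hG.
have ht (X : 'M[C]_N) (Y : 'M[C]_M) : X^h = X -> Y^h = Y -> (X *t Y)^h = X *t Y.
  by move=> hX hY; rewrite -{2}hX -{2}hY /ctr trmx_tens map_mxT.
rewrite /gauss_model ctrmxD ctrZ ht ?ctr1//; congr (_ + _ *: _).
transitivity (\sum_(i < n) (A i *t G i)^h); last by apply: eq_bigr => i _; rewrite ht.
apply: (big_morph (@ctr (N * M) (N * M))) => [X Y|]; first exact: ctrmxD.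
by rewrite /ctr trmx0 map_mx0.
Qed.
End RealInner.

Local Notation "A ^h" := (ctr A) (at level 8, format "A ^h").

(** * The norm of a block column of Gaussian matrices *)
Section GaussianRectangular.
Context {R : realType}.
Local Notation C := R[i].
Local Notation stdn q := (gauss_tuple q (fun=> (1 : R))).
Variables (N M : nat) (I : finType).

Definition gidx : finType := (bool * (I * ('I_N * 'I_M)))%type.
Implicit Types (f : I -> 'M[C]_(N, M)).

(* [gmat x i] has independent complex entries of variance [1 / M] when [x] is standard Gaussian. *)
Definition gscale : R := (Num.sqrt (2 * M%:R))^-1.

Definition gcoef f (j : gidx) : R :=
  gscale * (if j.1 then complex.Re (f j.2.1 j.2.2.1 j.2.2.2)
            else complex.Im (f j.2.1 j.2.2.1 j.2.2.2)).

Definition gmat (x : gidx -> R) (i : I) : 'M[C]_(N, M) :=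
  \matrix_(a, b) (gscale%:C * (x (true, (i, (a, b))) +i* x (false, (i, (a, b))))%C).

Lemma sum_bool (V : nmodType) (F : bool -> V) : \sum_b F b = F true + F false.
Proof. by rewrite (bigD1 true)//= (bigD1 false)//= big1 ?addr0// => -[]. Qed.

Lemma sum_pair (V : nmodType) (A B : finType) (F : A * B -> V) :
  \sum_p F p = \sum_a \sum_b F (a, b).
Proof. by rewrite pair_bigA /=; apply: eq_bigr => -[]. Qed.

Lemma sum_gidx (F : gidx -> R) :
  \sum_j F j = \sum_i \sum_a \sum_b (F (true, (i, (a, b))) + F (false, (i, (a, b)))).
Proof.
rewrite sum_pair sum_bool !sum_pair -big_split; apply: eq_bigr => i _ /=.
rewrite !sum_pair -big_split; apply: eq_bigr => a _ /=.
by rewrite -big_split.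
Qed.

Lemma gmat_rip x f : \sum_i rip (gmat x i) (f i) = \sum_j gcoef f j * x j.
Proof.
rewrite sum_gidx; apply: eq_bigr => i _; apply: eq_bigr => a _; apply: eq_bigr => b _.
rewrite cipE mxE /gcoef /=; ring.
Qed.

Lemma gcoefB f g j : gcoef f j - gcoef g j = gcoef (fun i => f i - g i) j.
Proof.
rewrite /gcoef !mxE; case: (f _ _ _) => a b; case: (g _ _ _) => c d /=.
by case: ifP => _; ring.
Qed.

Lemma gcoef0 j : gcoef (fun=> 0) j = 0.
Proof. by rewrite /gcoef !mxE /=; case: ifP; rewrite mulr0. Qed.

Lemma gcoef_norm f : \sum_j gcoef f j ^+ 2 = gscale ^+ 2 * \sum_i rip (f i) (f i).
Proof.
rewrite sum_gidx mulr_sumr; apply: eq_bigr => i _; rewrite mulr_sumr; apply: eq_bigr => a _.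
rewrite mulr_sumr; apply: eq_bigr => b _.
rewrite cipE /gcoef /=; ring.
Qed.

Lemma cipM (z w : C) : cip (z * w) (z * w) = cip z z * cip w w.
Proof. by rewrite !cip_normc Normc.normcM exprMn. Qed.

Lemma rip_rank1 (x : 'cV[C]_N) (y : 'cV[C]_M) :
  rip (x *m y^h) (x *m y^h) = rip x x * rip y y.
Proof.
rewrite /rip mulr_suml; apply: eq_bigr => i _; rewrite big_ord1 mulr_sumr.
apply: eq_bigr => j _; rewrite big_ord1 mxE big_ord1 cipM ctrmxE; congr (_ * _).
by rewrite !cipE; case: (y j 0) => a b /=; rewrite mulrNN.
Qed.

Lemma rip_mul_rank1 (X : 'M[C]_(N, M)) (x : 'cV[C]_N) (y : 'cV[C]_M) :
  rip x (X *m y) = rip X (x *m y^h).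
Proof. by rewrite ripC rip_mulr. Qed.

Lemma ripB m n (X Y : 'M[C]_(m, n)) : rip (X - Y) (X - Y) = rip X X + rip Y Y - 2 * rip X Y.
Proof. by rewrite ripDl !ripDr !ripNl !ripNr (ripC Y X); ring. Qed.

Lemma rip_sum_le m n (X Y : 'M[C]_(m, n)) (e : R) : 0 < e ->
  rip (X + Y) (X + Y) <= (1 + e) * rip X X + (1 + e^-1) * rip Y Y.
Proof.
move=> e0; have := rip_amgm_scaled X Y e0.
by rewrite ripDl !ripDr (ripC Y X); lra.
Qed.

(** Write the difference as u (v - v')^h + (u - u') v'^h. The factor 1 + e, close to 1 for small e,
    goes to the v side, which produces the leading constant; the large factor 1 + e^-1 goes to the u
    side, whose dimension is small against M. *)
Lemma rank1_increments (u u' : I -> 'cV[C]_N) (v v' : 'cV[C]_M) (e : R) : 0 < e ->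
  \sum_i rip (u i) (u i) <= 1 -> rip v' v' <= 1 ->
  \sum_i rip (u i *m v^h - u' i *m v'^h) (u i *m v^h - u' i *m v'^h) <=
  (1 + e) * rip (v - v') (v - v') + (1 + e^-1) * \sum_i rip (u i - u' i) (u i - u' i).
Proof.
move=> e0 u1 v1.
apply: le_trans (_ : \sum_i ((1 + e) * (rip (u i) (u i) * rip (v - v') (v - v')) +
  (1 + e^-1) * (rip (u i - u' i) (u i - u' i) * rip v' v')) <= _).
  apply: ler_sum => i _.
  have -> : u i *m v^h - u' i *m v'^h = u i *m (v - v')^h + (u i - u' i) *m v'^h.
    by rewrite ctrmxD ctrN mulmxDr mulmxN mulmxBl addrA subrK.
  by apply: le_trans (rip_sum_le _ _ e0) _; rewrite !rip_rank1.
rewrite big_split -!mulr_sumr -!mulr_suml lerD//.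
  apply: ler_wpM2l; first by rewrite addr_ge0// ltW.
  by apply: ler_piMl => //; exact: rip_ge0.
apply: ler_wpM2l; first by rewrite addr_ge0// invr_ge0 ltW.
by apply: ler_piMr => //; apply: sumr_ge0 => i _; exact: rip_ge0.
Qed.

(* Coordinates of a Gaussian vector paired with [v] (left) and of one paired with [u] (right). *)
Definition vidx : finType := (('I_M * bool) + (I * ('I_N * bool)))%type.

Definition vcoef (al be : R) (u : I -> 'cV[C]_N) (v : 'cV[C]_M) (j : vidx) : R :=
  match j with
  | inl (b, c) => al * (if c then complex.Re (v b 0) else complex.Im (v b 0))
  | inr (i, (a, c)) => be * (if c then complex.Re (u i a 0) else complex.Im (u i a 0))
  end.

Lemma sum_vidx (F : vidx -> R) : \sum_j F j =
  \sum_b (F (inl (b, true)) + F (inl (b, false))) +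
  \sum_i \sum_a (F (inr (i, (a, true))) + F (inr (i, (a, false)))).
Proof.
rewrite big_sumType /= !sum_pair; congr (_ + _).
  by apply: eq_bigr => b _; rewrite sum_bool.
by apply: eq_bigr => i _; rewrite sum_pair; apply: eq_bigr => a _; rewrite sum_bool.
Qed.

Lemma vcoefB al be u v u' v' j :
  vcoef al be u v j - vcoef al be u' v' j = vcoef al be (fun i => u i - u' i) (v - v') j.
Proof.
case: j => [[b c]|[i [a c]]] /=; rewrite !mxE.
  by case: (v b 0) => x y; case: (v' b 0) => x' y' /=; case: c; ring.
by case: (u i a 0) => x y; case: (u' i a 0) => x' y' /=; case: c; ring.
Qed.

Lemma vcoef0 al be j : vcoef al be (fun=> 0) 0 j = 0.
Proof. by case: j => [[b c]|[i [a c]]] /=; rewrite !mxE; case: c; rewrite mulr0. Qed.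

Lemma vcoef_norm al be u v : \sum_j vcoef al be u v j ^+ 2 =
  al ^+ 2 * rip v v + be ^+ 2 * \sum_i rip (u i) (u i).
Proof.
rewrite sum_vidx /rip mulr_sumr; congr (_ + _).
  by apply: eq_bigr => b _; rewrite big_ord1 cipE /=; ring.
rewrite mulr_sumr; apply: eq_bigr => i _; rewrite mulr_sumr; apply: eq_bigr => a _.
by rewrite big_ord1 cipE /=; ring.
Qed.

(** Weights of the squared coordinates in [vcoef_le]: [wnoise] is the small u side, while [wmean]
    averages the 2 M squares of the v side. *)
Definition wnoise (be : R) (j : vidx) : R := if j is inr _ then be else 0.
Definition wmean (j : vidx) : R := if j is inl _ then (2 * M%:R)^-1 else 0.

Lemma sum_wnoise be : \sum_j wnoise be j = be * (2 * (#|I| * N)%:R).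
Proof.
rewrite sum_vidx /= [X in X + _]big1 ?add0r//.
under eq_bigr do rewrite sumr_const card_ord -mulr_natr.
by rewrite sumr_const -mulr_natr natrM; ring.
Qed.

Lemma sum_wmean : (0 < M)%N -> \sum_j wmean j = 1.
Proof.
move=> M0; rewrite sum_vidx /= [X in _ + X]big1 ?addr0; last first.
  by move=> i _; rewrite big1// => a _; rewrite addr0.
have M0' : (M%:R : R) != 0 by rewrite pnatr_eq0 -lt0n.
by rewrite sumr_const card_ord -mulr_natr; field.
Qed.

Lemma sum_wmean_sqr : (0 < M)%N -> \sum_j wmean j ^+ 2 = (2 * M%:R)^-1.
Proof.
move=> M0; rewrite sum_vidx /= [X in _ + X]big1 ?addr0; last first.
  by move=> i _; rewrite big1// => a _; rewrite expr0n addr0.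
have M0' : (M%:R : R) != 0 by rewrite pnatr_eq0 -lt0n.
by rewrite sumr_const card_ord -mulr_natr; field.
Qed.

Lemma gscale_sqr : gscale ^+ 2 = (2 * M%:R)^-1.
Proof. by rewrite /gscale exprVn sqr_sqrtr// mulr_ge0. Qed.

(** Young's inequality in each coordinate replaces norms of Gaussian vectors by their squares, whose
    moments are explicit; [ta] balances the u side. *)
Lemma vcoef_amgm (al be ta : R) u v (x : vidx -> R) : 0 < ta ->
  \sum_j vcoef al be u v j * x j <=
  2^-1 * (rip v v + ta * \sum_i rip (u i) (u i)) +
  \sum_j (if j is inl _ then 2^-1 * al ^+ 2 else 2^-1 * be ^+ 2 / ta) * x j ^+ 2.
Proof.
move=> ta0.
have -> : rip v v + ta * \sum_i rip (u i) (u i) = \sum_j vcoef 1 (Num.sqrt ta) u v j ^+ 2.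
  by rewrite vcoef_norm expr1n mul1r sqr_sqrtr// ltW.
rewrite mulr_sumr -big_split; apply: ler_sum => -[[b c]|[i [a c]]] _ /=.
  set y := if c then _ else _; rewrite mul1r.
  by have := sqr_ge0 (y - al * x (inl (b, c))); nra.
set y := if c then _ else _; set X := x _; rewrite exprMn (sqr_sqrtr (ltW ta0)).
rewrite -subr_ge0 (_ : _ - _ = 2^-1 * ta * (y - be * X / ta) ^+ 2).
  by rewrite mulr_ge0// ?sqr_ge0// mulr_ge0// ltW.
by field; rewrite gt_eqF.
Qed.

(** The leading 1 is 1/2 from Young's inequality plus 1/2 from the mean of the averaged squares. The
    fluctuation Y of that average is at most th / 2 + Y^2 / (2 th), so its variance is enough. *)
Lemma vcoef_le (eta th ta : R) u v (x : vidx -> R) : (0 < M)%N ->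
  0 < eta -> 0 < th -> 0 < ta -> rip v v <= 1 -> \sum_i rip (u i) (u i) <= 1 ->
  \sum_j vcoef (gscale * Num.sqrt (1 + eta)) (gscale * Num.sqrt (1 + eta^-1)) u v j * x j <=
  1 + (2^-1 * eta + 4^-1 * (1 + eta) * th + 2^-1 * ta +
  \sum_j wnoise ((1 + eta^-1) / (4 * M%:R * ta)) j * x j ^+ 2 +
  4^-1 * (1 + eta) / th * (\sum_j wmean j * (x j ^+ 2 - gvar)) ^+ 2).
Proof.
move=> M0 e0 th0 ta0 v1 u1.
have M0' : (M%:R : R) != 0 by rewrite pnatr_eq0 -lt0n.
have e1 : 0 <= 1 + eta by rewrite addr_ge0// ltW.
have e2 : 0 <= 1 + eta^-1 by rewrite addr_ge0// invr_ge0 ltW.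
apply: le_trans (vcoef_amgm _ _ u v x ta0) _.
set Y := \sum_j wmean j * _.
have -> : \sum_j (if j is inl _ then 2^-1 * (gscale * Num.sqrt (1 + eta)) ^+ 2
    else 2^-1 * (gscale * Num.sqrt (1 + eta^-1)) ^+ 2 / ta) * x j ^+ 2 =
  \sum_j wnoise ((1 + eta^-1) / (4 * M%:R * ta)) j * x j ^+ 2 +
  2^-1 * (1 + eta) * (Y + gvar).
  rewrite [X in _ * (Y + X)](_ : _ = \sum_j wmean j * gvar); last by rewrite -mulr_suml sum_wmean// mul1r.
  rewrite /Y -big_split/= mulr_sumr -big_split/=.
  apply: eq_bigr => -[p|p] _ /=; rewrite !exprMn gscale_sqr !sqr_sqrtr//.
    by field.
  by field; rewrite M0' !gt_eqF.
have h1 : 2^-1 * (rip v v + ta * \sum_i rip (u i) (u i)) <= 2^-1 * (1 + ta).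
  rewrite ler_wpM2l// lerD// -[leRHS]mulr1; apply: ler_wpM2l => //; exact: ltW.
have h2 : 2^-1 * (1 + eta) * (Y + gvar) <= 2^-1 * (1 + eta) * (2^-1 * th + 2^-1 * Y ^+ 2 / th + 1).
  apply: ler_wpM2l; first by rewrite mulr_ge0.
  apply: lerD; last exact: gvar_le1.
  rewrite -subr_ge0 (_ : _ - _ = 2^-1 * th * (1 - Y / th) ^+ 2).
    by rewrite mulr_ge0// ?sqr_ge0// mulr_ge0// ltW.
  by field; rewrite gt_eqF.
apply: le_trans (lerD h1 (lerD (lexx _) h2)) _.
rewrite le_eqVlt; apply/orP; left; apply/eqP.
by field; rewrite gt_eqF.
Qed.

(* The excess over 1 of the supremum of the bilinear form of [gmat] along [uu] and [vv]: the [-1]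
   is absent at the index 0, where [uu] and [vv] vanish, so that the excess is nonnegative. *)
Definition exc (uu : nat -> I -> 'cV[C]_N) (vv : nat -> 'cV[C]_M) (t : #|gidx|.-tuple R) : \bar R :=
  ereal_sup (range (fun k : nat =>
    ((if k is 0 then 0 else -1) +
     \sum_j gcoef (fun i => uu k i *m (vv k)^h) j * tnth t (enum_rank j))%:E)).

Lemma integral_exc_le (uu : nat -> I -> 'cV[C]_N) (vv : nat -> 'cV[C]_M) (eta th ta : R) :
  (0 < M)%N -> 0 < eta -> 0 < th -> 0 < ta ->
  (forall k, \sum_i rip (uu k i) (uu k i) <= 1) -> (forall k, rip (vv k) (vv k) <= 1) ->
  uu 0%N = (fun=> 0) -> vv 0%N = 0 ->
  (\int[stdn #|gidx|]_t exc uu vv t <=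
   (2^-1 * eta + 4^-1 * (1 + eta) * th + 2^-1 * ta +
    (1 + eta^-1) / (4 * M%:R * ta) * (2 * (#|I| * N)%:R) +
    4^-1 * (1 + eta) / th * (kurt * (2 * M%:R)^-1))%:E)%E.
Proof.
move=> M0 e0 th0 ta0 u1 v1 u00 v00.
have M0' : (M%:R : R) != 0 by rewrite pnatr_eq0 -lt0n.
have e1 : 0 <= 1 + eta by rewrite addr_ge0// ltW.
have e2 : 0 <= 1 + eta^-1 by rewrite addr_ge0// invr_ge0 ltW.
set c := 2^-1 * eta + _ + _; set w := _ / (4 * _ * _); set z := 4^-1 * _ / th.
have c0 : 0 <= c by rewrite /c !addr_ge0// !mulr_ge0// ltW.
have w0 : 0 <= w by rewrite /w divr_ge0// !mulr_ge0// ltW.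
have z0 : 0 <= z by rewrite /z divr_ge0// ?mulr_ge0// ltW.
pose q := #|vidx|.
pose f1 (t : q.-tuple R) := c + \sum_k wnoise w (enum_val k) * tnth t k ^+ 2.
pose f2 (t : q.-tuple R) := 0 + \sum_k wmean (enum_val k) * (tnth t k ^+ 2 - gvar).
have mt k : measurable_fun setT (fun t : q.-tuple R => tnth t k) by exact: measurable_tnth.
have mf1 : measurable_fun setT f1.
  apply: measurable_funD => //; apply: measurable_sum => k.
  by apply: measurable_funM => //; apply: measurable_funX.
have mf2 : measurable_fun setT f2.
  apply: measurable_funD => //; apply: measurable_sum => k.
  apply: measurable_funM => //; apply: measurable_funB => //; exact: measurable_funX.
have mf2X : measurable_fun setT (fun t => (f2 t ^+ 2)%:E).
  by apply/measurable_EFinP; exact: measurable_funX.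
have wn0 k : 0 <= wnoise w k by case: k.
pose F t := ((f1 t)%:E + z%:E * (f2 t ^+ 2)%:E)%E.
apply: (@le_trans _ _ (\int[stdn q]_t F t)%E).
  apply: (@gauss_comparison_law _ _ _ _ _ vidx (fun j t => tnth t (enum_rank j)) (fun=> 1)
    (fun k => if k is 0 then 0 else -1) (fun k => gcoef (fun i => uu k i *m (vv k)^h))
    (fun k => vcoef (gscale * Num.sqrt (1 + eta)) (gscale * Num.sqrt (1 + eta^-1)) (uu k) (vv k))) => //.
  - by move=> j; exact: measurable_tnth.
  - exact: gauss_tuple_coord_law.
  - by move=> k; rewrite u00 v00; under eq_fun do rewrite mul0mx; exact: gcoef0.
  - by move=> k; rewrite u00 v00 vcoef0.
  - move=> i j; under eq_bigr do rewrite mul1r gcoefB; under [leRHS]eq_bigr do rewrite vcoefB.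
    rewrite gcoef_norm vcoef_norm !exprMn !sqr_sqrtr// gscale_sqr -![(2 * _)^-1 * _ * _]mulrA -mulrDr.
    apply: ler_wpM2l; first by rewrite invr_ge0 mulr_ge0.
    exact: rank1_increments.
  - apply: emeasurable_funD; first exact/measurable_EFinP.
    by apply: measurable_funeM.
  - move=> k t; rewrite /F -EFinM -EFinD lee_fin.
    rewrite /f1 (big_enum_rank (fun i k => wnoise w i * tnth t k ^+ 2)).
    rewrite /f2 add0r (big_enum_rank (fun i k => wmean i * (tnth t k ^+ 2 - gvar))).
    case: k => [|k].
      rewrite u00 v00 add0r big1; last by move=> j _; rewrite vcoef0 mul0r.
      apply: addr_ge0; last by apply: mulr_ge0 => //; exact: sqr_ge0.
      apply: addr_ge0 => //.
      by apply: sumr_ge0 => j _; apply: mulr_ge0; [case: j|exact: sqr_ge0].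
    have := vcoef_le (fun j => tnth t (enum_rank j)) M0 e0 th0 ta0 (v1 k.+1) (u1 k.+1).
    by rewrite -/c -/w -/z; lra.
rewrite /F ge0_integralD//; last 4 first.
- move=> t _; rewrite lee_fin addr_ge0//; apply: sumr_ge0 => k _.
  by rewrite mulr_ge0// sqr_ge0.
- exact/measurable_EFinP.
- by move=> t _; rewrite -EFinM lee_fin mulr_ge0// sqr_ge0.
- exact: measurable_funeM.
rewrite ge0_integralZl//; last by move=> t _; rewrite lee_fin sqr_ge0.
rewrite integral_gauss_tuple_sqr// integral_gauss_tuple_dev -EFinM -EFinD lee_fin.
rewrite (big_enum_rank (fun i _ => wnoise w i)) (big_enum_rank (fun i _ => wmean i ^+ 2)).
rewrite sum_wnoise sum_wmean_sqr// expr0n add0r lerD2r lerD2l.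
apply: ler_piMl; last exact: gvar_le1.
by apply: mulr_ge0 => //; rewrite mulr_ge0.
Qed.

(* [integral_exc_le] at [eta = sqrt r], [th = m ^ - 1/2] and [ta = sqrt (r + sqrt r)]. *)
Definition deviation (r m : R) : R :=
  2^-1 * Num.sqrt r + Num.sqrt (r + Num.sqrt r) +
  (1 + Num.sqrt r) * (4^-1 + kurt / 8) / Num.sqrt m.

Lemma integral_exc_deviation (uu : nat -> I -> 'cV[C]_N) (vv : nat -> 'cV[C]_M) :
  (0 < M)%N -> (0 < #|I| * N)%N ->
  (forall k, \sum_i rip (uu k i) (uu k i) <= 1) -> (forall k, rip (vv k) (vv k) <= 1) ->
  uu 0%N = (fun=> 0) -> vv 0%N = 0 ->
  (\int[stdn #|gidx|]_t exc uu vv t <=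
   (deviation ((#|I| * N)%:R / M%:R) M%:R)%:E)%E.
Proof.
move=> M0 K0 u1 v1 u00 v00.
set k := (#|I| * N)%:R : R; set m := M%:R : R.
have m0 : 0 < m by rewrite ltr0n.
have k0 : 0 < k by rewrite ltr0n.
have r0 : 0 < k / m by rewrite divr_gt0.
set s := Num.sqrt (k / m); have s0 : 0 < s by rewrite sqrtr_gt0.
have ss : k = s ^+ 2 * m by rewrite sqr_sqrtr ?ltW// divfK// gt_eqF.
have o0 : 0 < k / m + s by rewrite addr_gt0.
set ta := Num.sqrt (k / m + s); have ta0 : 0 < ta by rewrite sqrtr_gt0.
have tt : s ^+ 2 + s = ta ^+ 2 by rewrite /ta !sqr_sqrtr// ltW.
set th := (Num.sqrt m)^-1.
have sm0 : 0 < Num.sqrt m by rewrite sqrtr_gt0.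
have th0 : 0 < th by rewrite invr_gt0.
apply: le_trans (integral_exc_le M0 s0 th0 ta0 u1 v1 u00 v00) _.
rewrite lee_fin -/k -/m le_eqVlt; apply/orP; left; apply/eqP.
(* The choice ta^2 = r + sqrt r, with r = s^2 = k / m, makes the u side noise equal to the cost ta /
   2 of Young's inequality. *)
have -> : (1 + s^-1) / (4 * m * ta) * (2 * k) = 2^-1 * ta.
  rewrite ss; have -> : 2^-1 * ta = 2^-1 * (s ^+ 2 + s) / ta by rewrite tt; field; rewrite gt_eqF.
  by field; rewrite !gt_eqF.
have mm : m = Num.sqrt m ^+ 2 by rewrite sqr_sqrtr// ltW.
rewrite /deviation -/s -/ta /th [X in kurt / (2 * X)]mm.
by field; rewrite gt_eqF.
Qed.
End GaussianRectangular.

(** * Comparison for the Gaussian model *)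
Section ModelComparison.
Context {R : realType}.
Local Notation C := R[i].

Lemma rip_gram_product m p n (x : 'M[C]_(m, p)) (a : 'M[C]_(m, n)) :
  x *m x^h = a *m a^h -> rip (x^h *m a) (x^h *m a) = rip (a^h *m a) (a^h *m a).
Proof.
by move=> e; rewrite !rip_mull !ctrK !mulmxA e.
Qed.

(** With A = L^h L the squared norms on the two sides agree up to the factor 2, and what is left
    concerns the cross terms: this is [comparison_increments] for L U and L S. *)
Lemma form_increments N M (A S S' : 'M[C]_N) (U U' : 'M[C]_(N, M)) :
  A^h = A -> (forall v : 'cV[C]_N, 0 <= rip v (A *m v)) ->
  S *m S^h = U *m U^h -> S' *m S'^h = U' *m U'^h ->
  rip (U^h *m A *m U - U'^h *m A *m U') (U^h *m A *m U - U'^h *m A *m U') <=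
  2 * rip (S^h *m A *m U - S'^h *m A *m U') (S^h *m A *m U - S'^h *m A *m U').
Proof.
move=> hA pA hS hS'; have [L ->] := psd_factor hA pA.
have e p q (X : 'M[C]_(N, p)) (Y : 'M[C]_(N, q)) :
    X^h *m (L^h *m L) *m Y = (L *m X)^h *m (L *m Y).
  by rewrite ctrmx_mul !mulmxA.
have e' p q (X : 'M[C]_(N, p)) (Y : 'M[C]_(N, q)) : X *m X^h = Y *m Y^h ->
    (L *m X) *m (L *m X)^h = (L *m Y) *m (L *m Y)^h.
  by move=> h; rewrite !ctrmx_mul !mulmxA -!(mulmxA L) h.
rewrite !e; have := comparison_increments (e' _ _ _ _ hS) (e' _ _ _ _ hS').
rewrite !ripB (rip_gram_product (e' _ _ _ _ hS)) (rip_gram_product (e' _ _ _ _ hS')).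
move: (L *m U) (L *m S) (L *m U') (L *m S') => a x b y.
by rewrite ripDl !ripDr (ripC (b^h *m b) (a^h *m a)); lra.
Qed.

Lemma form_norm N M (A S : 'M[C]_N) (U : 'M[C]_(N, M)) :
  A^h = A -> (forall v : 'cV[C]_N, 0 <= rip v (A *m v)) -> S *m S^h = U *m U^h ->
  rip (S^h *m A *m U) (S^h *m A *m U) = rip (U^h *m A *m U) (U^h *m A *m U).
Proof.
move=> hA pA hS; have [L ->] := psd_factor hA pA.
have -> : S^h *m (L^h *m L) *m U = (L *m S)^h *m (L *m U) by rewrite ctrmx_mul !mulmxA.
have -> : U^h *m (L^h *m L) *m U = (L *m U)^h *m (L *m U) by rewrite ctrmx_mul !mulmxA.
by apply: rip_gram_product; rewrite !ctrmx_mul !mulmxA -!(mulmxA L) hS.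
Qed.

Definition bsgn (b : bool) : R := if b then 1 else -1.

(** For equal signs this is [form_increments]. For opposite signs the right side has no cross term,
    and |B + B'|^2 <= 2 |B|^2 + 2 |B'|^2 suffices. *)
Lemma signed_form_increments N M (A S S' : 'M[C]_N) (U U' : 'M[C]_(N, M)) (s s' : bool)
    (D := (bsgn s)%:C *: (U^h *m A *m U) - (bsgn s')%:C *: (U'^h *m A *m U'))
    (f := fun t => (if t == s then S^h *m A *m U else 0) - (if t == s' then S'^h *m A *m U' else 0)) :
  A^h = A -> (forall v : 'cV[C]_N, 0 <= rip v (A *m v)) ->
  S *m S^h = U *m U^h -> S' *m S'^h = U' *m U'^h ->
  rip D D <= 2 * \sum_t rip (f t) (f t).
Proof.
move=> hA pA hS hS'; rewrite sum_bool /D /f {D f}.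
have n1 := form_norm hA pA hS; have n2 := form_norm hA pA hS'.
have := form_increments hA pA hS hS'.
move: (U^h *m _ *m U) (U'^h *m _ *m U') (S^h *m _ *m U) (S'^h *m _ *m U') n1 n2 => B B' g g' n1 n2 h.
have h' : rip (B + B') (B + B') <= 2 * (rip g g + rip g' g').
  by rewrite n1 n2 ripDl !ripDr (ripC B' B); have := rip_amgm B B'; lra.
have sc (X : 'M[C]_M) : (-1)%:C *: X = - X by rewrite -[RHS]scaleN1r rmorphN1.
case: s; case: s' => /=; rewrite ?sc ?scale1r ?subr0 ?sub0r ?ripNl ?ripNr ?opprK ?rip0l ?addr0 ?add0r//.
  by rewrite -opprD ripNl ripNr opprK [X in _ <= _ * X]addrC.
by rewrite addrC -opprB ripNl ripNr opprK.
Qed.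

(** * The comparison applied to the quadratic forms of H_M and - H_M *)

Section ProcessBound.
Variables (n N M : nat) (A0 : 'M[C]_N) (A : 'I_n -> 'M[C]_N).
Hypotheses (n0 : (0 < n)%N) (N0 : (0 < N)%N) (M0 : (0 < M)%N).
Hypotheses (hA0 : A0^h = A0) (hA : forall i, (A i)^h = A i).
Hypothesis pA : forall i (v : 'cV[C]_N), 0 <= rip v (A i *m v).

Local Notation sI := ('I_n * bool)%type.
Local Notation stdn q := (gauss_tuple q (fun=> (1 : R))).

Lemma measurable_exc (I : finType) uu vv :
  measurable_fun setT (exc uu vv : #|gidx N M I|.-tuple R -> \bar R).
Proof.
apply: ereal_sup_measurable => k; apply/measurable_EFinP.
apply: measurable_funD => //; apply: measurable_sum => j.
by apply: measurable_funM => //; exact: measurable_tnth.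
Qed.

Lemma exc_ge0 (I : finType) uu vv (t : #|gidx N M I|.-tuple R) :
  uu 0%N = (fun=> 0) -> vv 0%N = 0 -> (0 <= exc uu vv t)%E.
Proof.
move=> u0 v0; apply: ereal_sup_ubound; exists 0%N => //; rewrite u0 v0.
rewrite add0r big1// => j _.
by under eq_fun do rewrite mul0mx; rewrite gcoef0 mul0r.
Qed.

(** Together with [right_dirs], enumerates pairs of dense directions: p.+1 codes a pair, invalid
    codes give (0, 0), and index 0 is the pinned zero. *)
Definition left_dirs (I : finType) (q1 : nat -> 'M[C]_(N, #|I|)) (k : nat) (i : I) : 'cV[C]_N :=
  if k is p.+1 then col (enum_rank i) (normalize (q1 (odflt (0, 0) (unpickle p : option (nat * nat))).1))
  else 0.
Definition right_dirs (q2 : nat -> 'cV[C]_M) (k : nat) : 'cV[C]_M :=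
  if k is p.+1 then normalize (q2 (odflt (0, 0) (unpickle p : option (nat * nat))).2) else 0.

Lemma rip_left_dirs (I : finType) q1 k : \sum_i rip (@left_dirs I q1 k i) (left_dirs q1 k i) <= 1.
Proof.
case: k => [|p] /=; first by rewrite big1// => i _; rewrite rip0l.
set X := normalize _; rewrite -(big_enum_rank (fun i k => rip (col k X) (col k X))) -rip_cols.
exact: rip_normalize_le1.
Qed.

Lemma rip_right_dirs q2 k : rip (right_dirs q2 k) (right_dirs q2 k) <= 1.
Proof. by case: k => [|p]; [rewrite rip0l|exact: rip_normalize_le1]. Qed.

Lemma exc_bilinear (I : finType) (q1 : nat -> 'M[C]_(N, #|I|)) (q2 : nat -> 'cV[C]_M)
    (t : #|gidx N M I|.-tuple R) (e : R) :
  (forall X, exists k : nat -> nat, cvgmx (fun l => q1 (k l)) X) ->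
  (forall X, exists k : nat -> nat, cvgmx (fun l => q2 (k l)) X) ->
  exc (left_dirs q1) (right_dirs q2) t = e%:E ->
  forall (u : I -> 'cV[C]_N) (v : 'cV[C]_M),
    \sum_i rip (u i) (gmat (fun j => tnth t (enum_rank j)) i *m v) <=
    (1 + e) * Num.sqrt (\sum_i rip (u i) (u i)) * Num.sqrt (rip v v).
Proof.
move=> d1 d2 he; apply: bilinear_form_dense d1 d2 _ => k1 k2.
have [p hp] : exists p, unpickle p = Some (k1, k2) by exists (pickle (k1, k2)); rewrite pickleK.
under eq_bigr do rewrite rip_mul_rank1.
rewrite (gmat_rip _ (fun i => col (enum_rank i) (normalize (q1 k1)) *m (normalize (q2 k2))^h)).
rewrite -lerBlDl -lee_fin -he addrC; apply: ereal_sup_ubound; exists p.+1; first by [].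
by rewrite /left_dirs /right_dirs hp.
Qed.

Definition gram_root (U : 'M[C]_(N, M)) : 'M[C]_N := sval (cid (gram_sqrt U)).

Lemma gram_rootP U : gram_root U *m (gram_root U)^h = U *m U^h.
Proof. exact: svalP (cid (gram_sqrt U)). Qed.

Definition signed_form (s : bool) (U : 'M[C]_(N, M)) (p : 'I_n * ('I_M * 'I_M)) : R :=
  (Num.sqrt M%:R)^-1 * hcoef ((bsgn s)%:C *: (U^h *m A p.1 *m U)) p.2.

(* The Gaussian matrices with second index [true] and [false] serve [H_M] and [- H_M]; processes of
   different signs are thus independent on the comparison side. *)
Definition comparison_dir (s : bool) (U : 'M[C]_(N, M)) (i : sI) : 'M[C]_(N, M) :=
  if i.2 == s then (gram_root U)^h *m A i.1 *m U else 0.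

Lemma signed_form_le s s' U U' :
  \sum_p (herm_sd p.2 * (signed_form s U p - signed_form s' U' p)) ^+ 2 <=
  \sum_j (2 * gcoef (comparison_dir s U) j - 2 * gcoef (comparison_dir s' U') j) ^+ 2.
Proof.
under [leRHS]eq_bigr do rewrite -mulrBr gcoefB exprMn.
rewrite -mulr_sumr gcoef_norm gscale_sqr [X in _ * (_ * X)]sum_pair sum_pair !mulr_sumr.
apply: ler_sum => l _.
pose D := (bsgn s)%:C *: (U^h *m A l *m U) - (bsgn s')%:C *: (U'^h *m A l *m U').
have hD : D^h = D.
  rewrite /D ctrmxD ctrN; congr (_ - _); rewrite ctrZ; congr (_ *: _).
    by rewrite !ctrmx_mul ctrK hA mulmxA.
  by rewrite !ctrmx_mul ctrK hA mulmxA.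
under eq_bigr do rewrite /= /signed_form /= -mulrBr -hcoefB -/D mulrCA exprMn.
rewrite -mulr_sumr hcoef_norm// exprVn sqr_sqrtr//.
apply: le_trans (_ : M%:R^-1 * (2 * \sum_b rip (comparison_dir s U (l, b) - comparison_dir s' U' (l, b))
  (comparison_dir s U (l, b) - comparison_dir s' U' (l, b))) <= _).
  apply: ler_wpM2l; first by rewrite invr_ge0.
  exact: signed_form_increments (hA l) (pA l) (gram_rootP U) (gram_rootP U').
rewrite le_eqVlt; apply/orP; left; apply/eqP.
have M0' : (M%:R : R) != 0 by rewrite pnatr_eq0 -lt0n.
set Q := \sum_b _; by field.
Qed.

(** If x is the form of A0 at a unit vector, the two values are at least x and - x, so their maximum
    is nonnegative and absorbs the truncation at 0. *)
Lemma max_rho_arg_le Z W (lam := Num.max (lambda_max (rho_arg A0 A Z)) (lambda_max (rho_arg (- A0) A W))) :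
  posdef Z -> posdef W ->
  Num.max (lambda_max (rho_arg A0 A Z)) 0 <= lam /\ Num.max (lambda_max (rho_arg (- A0) A W)) 0 <= lam.
Proof.
move=> pZ pW; have [e e1] : exists e : 'cV[C]_N, rip e e = 1.
  exists (delta_mx (Ordinal N0) 0); rewrite /rip (bigD1 (Ordinal N0))//= big_ord1 big1 ?addr0.
    by rewrite !mxE !eqxx cipE /= mulr1 mulr0 addr0.
  by move=> i ni; rewrite big_ord1 !mxE (negbTE ni) cipE /= !mulr0 addr0.
have hA0N : (- A0)^h = - A0 by rewrite ctrN hA0.
have h1 := lambda_max_rho_arg_ge hA0 hA pZ e1.
have h2 := lambda_max_rho_arg_ge hA0N hA pW e1.
rewrite mulNmx ripNr in h2.
have aux (a b x : R) : x <= a -> - x <= b -> Num.max a 0 <= Num.max a b /\ Num.max b 0 <= Num.max a b.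
  move=> xa xb; have h : 0 <= Num.max a b.
    rewrite le_max; have [x0|x0] := leP 0 x; first by rewrite (le_trans x0 xa).
    by apply/orP; right; apply: le_trans xb; rewrite oppr_ge0 ltW.
  by rewrite !ge_max h !le_max !lexx orbT.
exact: aux h1 h2.
Qed.

Lemma excess_arith (a b m c c' e lam : R) :
  a + b <= m + (1 + e - 1) * c' -> m <= lam -> c = c' -> a + b <= lam + c * e.
Proof.
move=> h h1 ->; apply: le_trans h _; have -> : 1 + e - 1 = e by rewrite addrC addKr.
by rewrite [e * _]mulrC; exact: lerD.
Qed.

Lemma gauss_process_le (d : measure_display) (T : measurableType d) (P : probability T R)
    (X : 'I_n * ('I_M * 'I_M) -> T -> R) (U : nat -> 'M[C]_(N, M)) (s : nat -> bool) (K : R)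
    (Z W : 'M[C]_N) (lam : R) :
  Num.max (lambda_max (rho_arg A0 A Z)) 0 <= lam ->
  Num.max (lambda_max (rho_arg (- A0) A W)) 0 <= lam ->
  posdef Z -> posdef W -> (forall i, opnorm (A i) <= K) ->
  (forall p, measurable_fun setT (X p)) -> box_law P X (fun p => herm_sd p.2) ->
  U 0%N = 0 -> (forall k, rip (U k) (U k) <= 1) ->
  (\int[P]_w ereal_sup (range (fun k =>
     (bsgn (s k) * rip (U k) (A0 *m U k) + \sum_p signed_form (s k) (U k) p * X p w)%:E)) <=
   (lam + (1 + n%:R * K ^+ 2) * deviation ((2 * n * N)%:R / M%:R) M%:R)%:E)%E.
Proof.
move=> lamZ lamW pZ pW AK mX lawX U0 U1.
have [c cE] : exists c, c = 1 + n%:R * K ^+ 2 by exists (1 + n%:R * K ^+ 2).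
rewrite -cE.
have c0 : 0 < c by rewrite cE ltr_pwDl// mulr_ge0// sqr_ge0.
have lam0 : 0 <= lam by apply: le_trans lamZ; rewrite le_max lexx orbT.
have [q1 d1] := @dense_mx R N #|{: sI}|.
have [q2 d2] := @dense_mx R M 1.
pose ex := exc (left_dirs q1) (right_dirs q2) : #|gidx N M sI|.-tuple R -> \bar R.
have mex : measurable_fun setT ex by exact: measurable_exc.
have ex0 t : (0 <= ex t)%E by exact: exc_ge0.
(* The random excess [ex] plays the part of s - 1 in [fidelity_rho_bound]; where it is infinite, so
   is the majorant. *)
apply: (@le_trans _ _ (\int[stdn #|gidx N M sI|]_t (lam%:E + c%:E * ex t))%E).
  apply: (@gauss_comparison_law _ _ _ _ _ (gidx N M sI) X (fun p => herm_sd p.2)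
    (fun k => bsgn (s k) * rip (U k) (A0 *m U k)) (fun k => signed_form (s k) (U k))
    (fun k j => 2 * gcoef (comparison_dir (s k) (U k)) j)) => //.
  - by move=> p; rewrite /herm_sd; case: ifP => // _; rewrite sqrtr_gt0.
  - by rewrite U0 rip0l mulr0.
  - by move=> p; rewrite U0 /signed_form mulmx0 scaler0 hcoef0 mulr0.
  - move=> j; rewrite U0 (_ : comparison_dir _ _ = fun=> 0) ?gcoef0 ?mulr0//.
    by apply/funext => i; rewrite /comparison_dir mulmx0 if_same.
  - by move=> i j; exact: signed_form_le.
  - by apply: emeasurable_funD => //; exact: measurable_funeM.
  - move=> k t; case E : (ex t) (ex0 t) => [e| |//] e0; last first.
      by rewrite mulry gtr0_sg// mul1e addey// leey.
    rewrite -EFinM -EFinD lee_fin.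
    set x := fun j => tnth t (enum_rank j).
    have -> : \sum_j 2 * gcoef (comparison_dir (s k) (U k)) j * tnth t (enum_rank j) =
        2 * \sum_(l < n) rip (gmat x (l, s k)) ((gram_root (U k))^h *m A l *m U k).
      under eq_bigr do rewrite -mulrA; rewrite -mulr_sumr -gmat_rip sum_pair; congr (_ * _).
      apply: eq_bigr => l _; rewrite (bigD1 (s k))//= big1 ?addr0 => [|b /negbTE nb].
        by rewrite /comparison_dir eqxx.
      by rewrite /comparison_dir nb rip0r.
    have bil (u : 'I_n -> 'cV[C]_N) (v : 'cV[C]_M) :
        \sum_(l < n) rip (u l) (gmat x (l, s k) *m v) <=
        (1 + e) * Num.sqrt (\sum_l rip (u l) (u l)) * Num.sqrt (rip v v).
      (* Families supported on the sign s k reduce the bound for all 2 n matrices to the n matrices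
         that enter this index. *)
      have := exc_bilinear d1 d2 E (fun i => if i.2 == s k then u i.1 else 0) v.
      rewrite !sum_pair.
      have aux (g : 'I_n -> bool -> R) : (forall l b, b != s k -> g l b = 0) ->
          \sum_l \sum_b g l b = \sum_l g l (s k).
        by move=> h; apply: eq_bigr => l _; rewrite (bigD1 (s k))//= big1 ?addr0// => b; exact: h.
      rewrite (aux (fun l b => rip (if b == s k then u l else 0) (gmat x (l, b) *m v))).
        rewrite (aux (fun l b => rip (if b == s k then u l else 0) (if b == s k then u l else 0))).
          by rewrite eqxx.
        by move=> l b /negbTE ->; rewrite rip0l.
      by move=> l b /negbTE ->; rewrite rip0l.
    have e1 : 1 <= 1 + e by rewrite lerDl -lee_fin.
    case: (s k) bil => /= bil.
      have f := fidelity_rho_bound hA0 hA pZ AK (gram_rootP (U k)) (U1 k) e1 bil.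
      by rewrite mul1r; exact: excess_arith f lamZ cE.
    have hA0N : (- A0)^h = - A0 by rewrite ctrN hA0.
    have f := fidelity_rho_bound hA0N hA pW AK (gram_rootP (U k)) (U1 k) e1 bil.
    rewrite mulNmx ripNr in f.
    by rewrite mulN1r; exact: excess_arith f lamW cE.
rewrite ge0_integralD//; last 2 first.
- by move=> t _; rewrite mule_ge0// lee_fin ltW.
- exact: measurable_funeM.
have -> : (\int[stdn #|gidx N M sI|]__ lam%:E = lam%:E)%E.
  by rewrite integral_cst// [X in (_ * X)%E]probability_setT mule1.
rewrite ge0_integralZl//; last by rewrite lee_fin ltW.
rewrite EFinD EFinM leeD2l// lee_pmul2l//.
have K0 : (0 < #|{: sI}| * N)%N by rewrite card_prod card_ord card_bool !muln_gt0 n0 N0.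
have := integral_exc_deviation M0 K0 (rip_left_dirs q1) (rip_right_dirs q2) erefl erefl.
by rewrite (_ : #|{: sI}| = (2 * n)%N)// card_prod card_ord card_bool mulnC.
Qed.

Lemma signed_gauss_model_form (G : 'I_n -> 'M[C]_M) (s : bool) (v : 'cV[C]_(N * M)) :
  (forall l, (G l)^h = G l) ->
  bsgn s * rip v (gauss_model A0 A G *m v) =
  bsgn s * rip (unvec v) (A0 *m unvec v) +
  \sum_p signed_form s (unvec v) p * herm_entry (G p.1) p.2.
Proof.
move=> hG; rewrite gauss_model_form mulrDr; congr (_ + _).
rewrite sum_pair !mulr_sumr; apply: eq_bigr => l _.
have hB : ((unvec v)^h *m A l *m unvec v)^h = (unvec v)^h *m A l *m unvec v.
  by rewrite !ctrmx_mul ctrK hA mulmxA.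
rewrite hcoef_sum// !mulr_sumr; apply: eq_bigr => ij _.
by rewrite /signed_form hcoefZ /=; ring.
Qed.

(** Both signs of every dense direction occur along U, interleaved by parity, so a bound on the
    sequence controls the absolute value of the form. *)
Lemma opnorm_gauss_model_le (G : 'I_n -> 'M[C]_M) (q : nat -> 'cV[C]_(N * M)) (S : \bar R)
    (U := fun k => if k is p.+1 then unvec (normalize (q p./2)) else 0) :
  (forall l, (G l)^h = G l) ->
  (forall X, exists k : nat -> nat, cvgmx (fun l => q (k l)) X) ->
  (forall k, (bsgn (odd k) * rip (U k) (A0 *m U k) +
     \sum_p signed_form (odd k) (U k) p * herm_entry (G p.1) p.2)%:E <= S)%E ->
  ((opnorm (gauss_model A0 A G))%:E <= S)%E.
Proof.
move=> hG dq hS.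
have S0 : (0 <= S)%E.
  have := hS 0%N; rewrite /U /= rip0l mulr0 add0r big1// => p _.
  by rewrite /signed_form mulmx0 scaler0 hcoef0 mulr0 mul0r.
case: S S0 hS => [S| |]// S0 hS; last by rewrite leey.
rewrite lee_fin; apply: opnorm_herm_le => //; first exact: gauss_model_herm.
apply: herm_form_dense dq _ => k; rewrite ler_norml.
have h s : bsgn s * rip (normalize (q k)) (gauss_model A0 A G *m normalize (q k)) <= S.
  rewrite signed_gauss_model_form// -lee_fin.
  (* This index has parity s, and its predecessor halves to k. *)
  have := hS (k.*2 + ~~ s).+1; rewrite /U /= oddD odd_double addFb.
  have -> : (k.*2 + ~~ s)./2 = k by rewrite addnC half_bit_double.
  by case: s.
have h1 := h true; have h2 := h false; rewrite /bsgn mul1r in h1; rewrite /bsgn mulN1r in h2.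
by rewrite h1 andbT lerNl.
Qed.
End ProcessBound.

(** The integral of a nonnegative function is a supremum over simple functions below it, hence
    monotone for arbitrary functions. It is applied to the operator norm, whose measurability in w
    is not established. *)
Lemma le_integral_nonneg (d : measure_display) (T : measurableType d)
    (mu : {measure set T -> \bar R}) (f g : T -> \bar R) :
  (forall x, 0 <= f x)%E -> (forall x, f x <= g x)%E ->
  (\int[mu]_x f x <= \int[mu]_x g x)%E.
Proof.
move=> f0 fg; rewrite !ge0_integralTE//; last by move=> x; exact: le_trans (f0 x) (fg x).
by apply: ereal_sup_le => _ [h hf <-]; exists h => // x; exact: le_trans (hf x) (fg x).
Qed.

(** * Joint law of the real coordinates of the GUE matrices *)

Section GaussianHermitian.
Context {d : measure_display} {T : measurableType d}.
Variable P : probability T R.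
Variables (n M : nat) (G : 'I_n -> T -> 'M[C]_M).
Hypothesis hG : independent_GUE P G.

Lemma gue_measurable p : measurable_fun setT (fun w => herm_entry (G p.1 w) p.2).
Proof. by have [/(_ p.1)[_ /(_ p.2)[]]] := hG. Qed.

(** The box event is grouped by matrix: independence of the generated sigma-algebras splits it over
    l, then independence inside each G l splits it over coordinates. *)
Lemma gue_box_law : box_law P (fun p w => herm_entry (G p.1 w) p.2) (fun p => herm_sd p.2).
Proof.
move=> B mB; have [hg hi] := hG.
pose F l ij := [set w | B (l, ij) (herm_coord (G l) ij w)].
pose E l := \bigcap_(ij in [set` [set: 'I_M * 'I_M]%SET]) F l ij.
have -> : [set w | forall p, B p (herm_entry (G p.1 w) p.2)] =
    \bigcap_(l in [set` [set: 'I_n]%SET]) E l.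
  apply/seteqP; split => w /= h; first by move=> l _ ij _; exact: h.
  by move=> [l ij]; apply: (h l) => /=; rewrite inE.
rewrite hi; last first.
  move=> l _; rewrite /mx_sigma_algebra; set GG := \bigcup_(ij in _) _.
  apply: (@fin_bigcap_measurable _ (g_sigma_algebraType GG)); first exact: finite_finset.
  move=> [i j] _; apply: sub_sigma_algebra; rewrite /F /herm_coord /=.
  case: (i <= j)%N; [exists (i, j) => //; left|exists (j, i) => //; right].
    by exists (B (l, (i, j))) => //; rewrite setTI.
  by exists (B (l, (i, j))) => //; rewrite setTI.
transitivity (\prod_l \prod_ij normal_prob 0 (herm_sd ij) (B (l, ij)))%E; last first.
  by rewrite pair_bigA /=; apply: eq_bigr => -[].
rewrite big_mkcond; apply: eq_bigr => l _; rewrite inE.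
have [_ hc hI] := hg l.
rewrite /E hI; last by move=> ij _; exists (B (l, ij)) => //; rewrite setTI.
rewrite big_mkcond; apply: eq_bigr => ij _; rewrite inE.
by have [_ ->] := hc ij.
Qed.
End GaussianHermitian.

Lemma expected_opnorm_le (d : measure_display) (T : measurableType d) (P : probability T R)
    (n N M : nat) (A0 : 'M[C]_N) (A : 'I_n -> 'M[C]_N) (G : 'I_n -> T -> 'M[C]_M) (K : R) :
  (0 < n)%N -> (0 < N)%N -> (0 < M)%N -> A0 \is hermsymmx -> (forall i, possemidef (A i)) ->
  (forall i, opnorm (A i) <= K) -> independent_GUE P G ->
  ('E_P[fun w => opnorm (gauss_model A0 A (fun i => G i w))] <=
   (rho_star A0 A + (1 + n%:R * K ^+ 2) * deviation ((2 * n * N)%:R / M%:R) M%:R)%:E)%E.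
Proof.
move=> n0 N0 M0 /hermsymmxP hA0 psA AK hG.
have hA i : (A i)^h = A i by have [/hermsymmxP] := psA i.
have pA i (v : 'cV[C]_N) : 0 <= rip v (A i *m v).
  have [_ /(_ v)] := psA i; rewrite lecE => /andP[_].
  by rewrite rip_tr /quadform -mulmxA /mxtrace big_ord1.
have hGh w l : (G l w)^h = G l w by have [/(_ l)[/(_ w) /hermsymmxP]] := hG.
rewrite unlock.
set E := (\int[P]_w _)%E; set D := _ * deviation _ _.
have E0 : (0 <= E)%E by apply: integral_ge0 => w _; rewrite lee_fin; exact: opnorm_ge0.
have [q dq] := @dense_mx R (N * M) 1.
have EZW (Z W : 'M[C]_N) : posdef Z -> posdef W ->
    (E <= (Num.max (lambda_max (rho_arg A0 A Z)) (lambda_max (rho_arg (- A0) A W)) + D)%:E)%E.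
  move=> pZ pW; have [lamZ lamW] := max_rho_arg_le N0 hA0 hA pZ pW.
  pose U k : 'M[C]_(N, M) := if k is p.+1 then unvec (normalize (q p./2)) else 0.
  have U1 k : rip (U k) (U k) <= 1.
    by case: k => [|k]; [rewrite rip0l|rewrite rip_unvec rip_normalize_le1].
  have := gauss_process_le n0 N0 M0 hA0 hA pA odd lamZ lamW pZ pW AK
    (gue_measurable hG) (gue_box_law hG) (erefl : U 0%N = 0) U1.
  apply: le_trans; apply: le_integral_nonneg => w.
    by rewrite lee_fin; exact: opnorm_ge0.
  apply: (opnorm_gauss_model_le hA0 hA) dq _ => // k.
  by apply: ereal_sup_ubound; exists k.
(* The bound at Z = W = 1 excludes an infinite expectation; for a real E the infima over Z and W can
   then be taken. *)
case: E E0 EZW => [e| |]// E0 EZW; last first.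
  by have := EZW _ _ (posdef1 N) (posdef1 N).
rewrite lee_fin -lerBlDr; apply: le_rho_star => Z W pZ pW.
by rewrite lerBlDr -lee_fin; exact: EZW.
Qed.

Lemma deviation_cvg0 (r m : nat -> R) :
  r @ \oo --> (0 : R) -> (fun k => (m k)^-1) @ \oo --> (0 : R) -> (forall k, 0 <= m k) ->
  (fun k => deviation (r k) (m k)) @ \oo --> (0 : R).
Proof.
move=> r0 m0 mge.
have sq (f : nat -> R) : f @ \oo --> (0 : R) -> (fun k => Num.sqrt (f k)) @ \oo --> (0 : R).
  by move=> f0; rewrite -[in X in _ --> X](sqrtr0 R); apply: continuous_cvg f0; exact: sqrt_continuous.
have s0 := sq _ r0.
have t0 : (fun k => Num.sqrt (r k + Num.sqrt (r k))) @ \oo --> (0 : R).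
  by apply: sq; rewrite -[in X in _ --> X](addr0 0); exact: cvgD r0 s0.
have v0 : (fun k => (Num.sqrt (m k))^-1) @ \oo --> (0 : R).
  by have := sq _ m0; apply: cvg_trans; apply: near_eq_cvg; near=> k; rewrite sqrtrV.
rewrite [in X in _ --> X](_ : 0 = 2^-1 * 0 + 0 + (1 + 0) * (4^-1 + kurt / 8) * 0 :> R); last by rewrite !(mulr0, addr0).
apply: cvgD; first by apply: cvgD => //; apply: cvgM => //; exact: cvg_cst.
by apply: cvgM => //; apply: cvgM; [apply: cvgD => //|]; exact: cvg_cst.
Unshelve. all: by end_near.
Qed.

Lemma littleo_ratio_cvg0 (f g : nat -> nat) :
  (fun k => (f k)%:R : R^o) =o_\oo (fun k => (g k)%:R : R^o) -> (\forall k \near \oo, (0 < g k)%N) ->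
  (fun k => (f k)%:R / (g k)%:R) @ \oo --> (0 : R).
Proof.
move=> /eqoP fg g0; apply/cvgrPdist_le => e e0.
have := fg _ e0; apply: filter_app; apply: filterS g0 => k k0.
rewrite !normr_nat => h; rewrite sub0r normrN normrM normrV ?unitfE ?pnatr_eq0 -?lt0n// !normr_nat.
by rewrite ler_pdivrMr// ltr0n.
Qed.
End ModelComparison.

Theorem corollary1p2 (R : realType) (n : nat) (hn : (1 <= n)%N)
    (N : nat -> nat) (hN : forall M, (1 <= M)%N -> (1 <= N M)%N)
    (A0 : forall M, 'M[R[i]]_(N M)) (A : forall M, 'I_n -> 'M[R[i]]_(N M))
    (hA0 : forall M, (1 <= M)%N -> A0 M \is hermsymmx)
    (hA : forall M, (1 <= M)%N -> forall i, possemidef (A M i))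
    (hNM : (fun M => (N M)%:R : R^o) =o_\oo (fun M => M%:R : R^o))
    (K : R)
    (hK : forall M, (1 <= M)%N -> forall i, opnorm (A M i) <= K)
    (d : nat -> measure_display) (T : forall M, measurableType (d M))
    (P : forall M, probability (T M) R)
    (G : forall M, 'I_n -> T M -> 'M[R[i]]_M)
    (hG : forall M, (1 <= M)%N -> independent_GUE (P M) (G M)) :
  let EH := fun M : nat =>
    'E_(P M)[fun w => opnorm (gauss_model (A0 M) (A M) (fun i => G M i w))]%E in
  let rho_seq := fun M : nat => rho_star (A0 M) (A M) in
  (exists eps : nat -> R,
     eps @ \oo --> (0 : R) /\
     \forall M \near \oo, (EH M <= (rho_seq M + eps M)%:E)%E) /\
  (forall rho : R, rho_seq @ \oo --> rho -> (limn_esup EH <= rho%:E)%E).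
Proof.
move=> EH rho_seq.
pose eps M : R := (1 + n%:R * K ^+ 2) * deviation ((2 * n * N M)%:R / M%:R) M%:R.
have eps0 : eps @ \oo --> (0 : R).
  rewrite -[in X in _ --> X](mulr0 (1 + n%:R * K ^+ 2)); apply: cvgM; first exact: cvg_cst.
  have M0 : \forall M \near \oo, (0 < M)%N by exists 1%N.
  have r0 : (fun M => (2 * n * N M)%:R / M%:R : R) @ \oo --> (0 : R).
    rewrite (_ : (fun M => _) = fun M => (2 * n)%:R * ((N M)%:R / M%:R)); last first.
      by apply/funext => M; rewrite natrM mulrA.
    rewrite -[in X in _ --> X](mulr0 (2 * n)%:R); apply: cvgM; first exact: cvg_cst.
    exact: littleo_ratio_cvg0 hNM M0.
  apply: deviation_cvg0 => //.
  apply/cvgrPdist_le => e e0; near=> M.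
  rewrite sub0r normrN ger0_norm ?invr_ge0//.
  have M1 : (0 < M)%N by near: M; exists 1%N.
  rewrite -[e]invrK lef_pV2 ?qualifE/= ?invr_gt0 ?ltr0n//.
  near: M; exact: nbhs_infty_ger.
have EHle : \forall M \near \oo, (EH M <= (rho_seq M + eps M)%:E)%E.
  exists 1%N => // M M1.
  exact: expected_opnorm_le hn (hN _ M1) M1 (hA0 _ M1) (hA _ M1) (hK _ M1) (hG _ M1).
split; first by exists eps.
move=> rho rho_cvg; apply/lee_addgt0Pr => e e0.
have lim : (fun M => rho_seq M + eps M) @ \oo --> rho.
  by rewrite -[rho]addr0; exact: cvgD.
have rho_e : rho < rho + e by rewrite ltrDl.
have H : \forall M \near \oo, (EH M <= (rho + e)%:E)%E.
  near=> M; apply: (@le_trans _ _ (rho_seq M + eps M)%:E); first by near: M.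
  by rewrite lee_fin; near: M; exact: cvgr_le lim _ rho_e.
(* The upper limit is an infimum, over sets of the filter at infinity, of suprema; this set is one
   of them by [H]. *)
apply: (@le_trans _ _ (ereal_sup (EH @` [set M | (EH M <= (rho + e)%:E)%E]))).
  by apply: ereal_inf_lbound; exists [set M | (EH M <= (rho + e)%:E)%E].
by apply: ge_ereal_sup => _ [M h <-].
Unshelve. all: by end_near.
Qed.
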